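(* For every $c>0$, $c\neq 1$, there exists a number $\nu(c)\in(0,1)$, depending only on $c$, such that the following holds. Let $p\in S^1$ and let $f\in B^3(p,c)$ be a circle homeomorphism with irrational rotation number $\rho$ whose Schwarzian derivative satisfies $S(f)(x)<0$ at all points of smoothness, i.e. at all $x\in S^1\setminus\{p\}$. Let $g$ be the unique linear fractional circle map of class $B^3(p,c)$ with rotation number $\rho$. Then $f$ is not $C^{1+\alpha}$ conjugate to $g$ for any $\alpha>1-\nu(c)$ (where $\alpha\le 1$).
   Context: $S^1=\mathbb R/\mathbb Z$; circle homeomorphisms are orientation preserving. A circle homeomorphism $f$ is of class $B^r(p,c)$ ($c>0$, $c\ne 1$) if it is $C^r$ smooth everywhere except at the unique break point $p$, and $f'(p-0)/f'(p+0)=c$; precisely, a lift of $f$ restricted to $[p,p+1]$ is $C^r$ up to the endpoints (one-sided derivatives at the endpoints) with $f'>0$ on $[p,p+1]$. A linear fractional circle map of class $B^r(p,c)$ is one whose lift restricted to $[p,p+1]$ is a linear fractional (Möbius) function $x\mapsto (ax+b)/(a'x+b')$. The Schwarzian derivative is $S(f)=\frac{f'''}{f'}-\frac32\left(\frac{f''}{f'}\right)^2$. A map is $C^{1+\alpha}$, $0<\alpha\le 1$, if it is continuously differentiable and its derivative is Hölder continuous with exponent $\alpha$. Two circle homeomorphisms $f,g$ are $C^{1+\alpha}$ conjugate if there is a circle diffeomorphism $h$ of class $C^{1+\alpha}$ with $h\circ f=g\circ h$. *)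

(* Defs.v *)
(* MathComp-Analysis.

   The circle is R/Z with R : realType: a point is given by a representative
   in R, and a circle map by a lift R -> R.  Every notion below is invariant
   under changing a representative or a lift by an integer. *)
From mathcomp Require Import all_boot all_order all_algebra.
From mathcomp Require Import all_classical all_reals all_analysis.

Set Implicit Arguments.
Unset Strict Implicit.
Unset Printing Implicit Defensive.

Import Order.TTheory GRing.Theory Num.Theory.
Import numFieldNormedType.Exports.

Local Open Scope classical_set_scope.
Local Open Scope ring_scope.

Definition circle_eq (R : realType) (x y : R) : Prop := x - y \is a Num.int.

Definition circle_homeo (R : realType) (F : R -> R) : Prop :=
  [/\ continuous F,
      {homo F : x y / x < y} &
      forall x, F (x + 1) = F x + 1].

(* l is the derivative at x of the restriction of f to [a, b]; it is
   one-sided when x is an endpoint. *)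
Definition is_derive_seg (R : realType) (a b : R) (f : R -> R) (x l : R)
    : Prop :=
  (f y - f x) / (y - x) @[y --> within `[a, b] x^'] --> l.

(* The restriction of f to [a, b] is C^r up to the endpoints. *)
Fixpoint C_seg (R : realType) (r : nat) (a b : R) (f : R -> R) : Prop :=
  if r is r'.+1 then
    exists f' : R -> R,
      (forall x, x \in `[a, b] -> is_derive_seg a b f x (f' x)) /\
      C_seg r' a b f'
  else {within `[a, b], continuous f}.

(* The class B^r(p, c), r >= 1. *)
Definition class_B (R : realType) (r : nat) (p c : R) (F : R -> R) : Prop :=
  [/\ circle_homeo F,
      C_seg r p (p + 1) F,
      (forall x, x \in `[p, p + 1] ->
        exists2 d, 0 < d & is_derive_seg p (p + 1) F x d) &
      exists dl dr : R,
        [/\ derive1 F x @[x --> p^'-] --> dl,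
            derive1 F x @[x --> p^'+] --> dr &
            dl / dr = c]].

Definition linear_fractional (R : realType) (p : R) (F : R -> R) : Prop :=
  exists a b a' b' : R, a * b' - b * a' != 0 /\
    forall x, x \in `[p, p + 1] ->
      a' * x + b' != 0 /\ F x = (a * x + b) / (a' * x + b').

Definition schwarzian (R : realType) (F : R -> R) (x : R) : R :=
  derive1n 3 F x / derive1 F x -
  3 / 2 * (derive1n 2 F x / derive1 F x) ^+ 2.

(* The rotation number in R/Z of the circle map lifted by F is the class of
   rho; the integer k accounts for the choice of the lift. *)
Definition has_rotation_number (R : realType) (F : R -> R) (rho : R) : Prop :=
  exists k : int, forall x : R,
    (iter n F x - x) / n%:R @[n --> \oo] --> rho + k%:~R.

Definition C1 (R : realType) (F : R -> R) : Prop :=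
  (forall x, derivable F x 1) /\ continuous (derive1 F).

(* The derivative of a lift is 1-periodic, so Hoelder continuity on R amounts
   to Hoelder continuity for the distance of R/Z. *)
Definition C1_hoelder (R : realType) (alpha : R) (F : R -> R) : Prop :=
  C1 F /\
  exists K : R, forall x y,
    `|derive1 F x - derive1 F y| <= K * `|x - y| `^ alpha.

Definition circle_diffeo (R : realType) (H : R -> R) : Prop :=
  [/\ circle_homeo H, C1 H &
      exists H' : R -> R, [/\ cancel H H', cancel H' H & C1 H']].

Definition C1_hoelder_conjugate (R : realType) (alpha : R) (F G : R -> R)
    : Prop :=
  exists H : R -> R,
    [/\ circle_diffeo H,
        C1_hoelder alpha H &
        forall x, circle_eq (H (F x)) (G (H x))].

(* Main.v *)
(** Let [h] conjugate [F] to [G] and consider the degenerate cross-ratio distortion of a map [f] on an arc [[a, b]],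
    [(f b - f a)^2 / ((b - a)^2 f'(a) f'(b))].  It equals 1 for the Moebius pieces of [G], is at least
    [1 + kappa (b - a)^2] for [F] because [S(F) < 0], and differs from 1 by [O((b - a)^alpha)] for [h] if [h] is
    [C^(1 + alpha)].  Following an arc that avoids the break along a closest return of the rotation, of distance [d],
    these facts add up to: the squares of the lengths of the [1/d] arcs of the dynamical partition have sum
    [O(d^alpha)].

    On the other hand the lengths of these arcs cannot be nearly equal: the break forces [G] to be nonlinear away from
    it, so on every break-free arc the return map is far from a translation, uniformly over all scales, with constants
    depending on [c] only.  Hence cutting the cells of the invariant measure into [2^m] cells of equal measure
    multiplies the sum of the squares of their lengths by at least [(1 + kap) / 2^m], where [m] and [kap]
    depend on [c] only.  The two bounds contradict each other as soon as [2^(m (1 - alpha)) < 1 + kap]. *)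

(* Arcs are compared by their [phi]-length, that is, by the invariant measure. Over the [N] iterates
   of a closest return, [phi]-length below [d] keeps the images from overlapping on the circle, and
   [phi]-length at least [2 * d] makes their lengths add up to at least 1. Hence for arcs of
   [phi]-length at most [8 * d] both the total image length and the number of breaks met over three
   returns are bounded by absolute numbers, which is why the distortion constants depend on [c]
   only.

   Equal lengths are excluded through the return map: it adds [s] to [phi], so if all cells were cut
   almost evenly, [phi] would be nearly affine on a long cell and the return map nearly a
   translation there.

   For the upper bound the obstacle is that the Hoelder estimate helps only at times when the image
   arc is short. Averaging yields an image of length [O(1 / N) = O(d)] during the first and during
   the third return, and the gain is collected over the second one. A uniform gain exists only at a
   distance from the break, because nothing keeps [S(F)] away from 0 near [p]; so the counted cells
   lie in a fixed window away from it. *)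
Require Import Defs.
From mathcomp Require Import all_boot all_order all_algebra.
From mathcomp Require Import all_classical all_reals all_analysis.
From mathcomp Require Import ring lra zify.
Import Order.TTheory GRing.Theory Num.Theory.
Import numFieldNormedType.Exports.
Set Implicit Arguments.
Unset Strict Implicit.
Unset Printing Implicit Defensive.
Local Open Scope classical_set_scope.
Local Open Scope ring_scope.

(** * Closest returns of a rotation *)

Section ClosestReturns.
Context {R : realType}.
Implicit Types (x y rho : R) (k l : int).

Definition dint x : R :=
  Num.min (x - (Num.floor x)%:~R) ((Num.floor x)%:~R + 1 - x).

Lemma dint_attained x : exists k, `|x - k%:~R| = dint x.
Proof.
rewrite /dint; have /andP[f1 f2] := floor_itv x; rewrite intrD in f2.
case: leP => h; [exists (Num.floor x)|exists (Num.floor x + 1)].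
  by rewrite ger0_norm// subr_ge0.
by rewrite intrD distrC ger0_norm// subr_ge0 ltW.
Qed.

Lemma dint_le x k : dint x <= `|x - k%:~R|.
Proof.
have /andP[f1 f2] := floor_itv x; rewrite intrD in f2.
have [lek|ltk] := leP k (Num.floor x).
  have : k%:~R <= (Num.floor x)%:~R :> R by rewrite ler_int.
  by rewrite /dint ge_min => h; apply/orP; left; rewrite ger0_norm; lra.
have : (Num.floor x + 1)%:~R <= k%:~R :> R by rewrite ler_int lezD1.
rewrite intrD /dint ge_min => h; apply/orP; right.
by rewrite distrC ger0_norm; lra.
Qed.

Lemma irrational_neq rho (n : nat) k :
  irrational rho -> (0 < n)%N -> n%:R * rho != k%:~R.
Proof.
move=> irr n0; apply/negP => /eqP h; apply: irr; apply/rationalP.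
exists k, n; rewrite -h mulrC mulKf// pnatr_eq0; lia.
Qed.

(** Pigeonhole: the fractional parts of [M + 1] multiples of [rho] fall into [M] boxes of length
    [1 / M <= tau]. *)
Lemma dirichlet rho (tau : R) : 0 < tau ->
  exists2 n : nat, (0 < n)%N & dint (n%:R * rho) <= tau.
Proof.
move=> tau0; pose M := (Num.truncn (tau^-1)).+1.
have M0 : 0 < M%:R :> R by rewrite ltr0n.
have Mt : M%:R^-1 <= tau.
  rewrite -[leRHS]invrK lef_pV2 ?posrE ?invr_gt0//.
  exact/ltW/truncnS_gt.
pose fr (i : nat) : R := i%:R * rho - (Num.floor (i%:R * rho))%:~R.
have fr0 i : 0 <= fr i < 1.
  rewrite /fr; have := floor_itv (i%:R * rho); rewrite intrD; lra.
have trlt i : (Num.truncn (M%:R * fr i) < M)%N.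
  have /andP[? ?] := fr0 i.
  by rewrite truncn_lt_nat ?mulr_ge0// -[ltRHS]mulr1 ltr_pM2l.
pose f (i : 'I_M.+1) : 'I_M := Ordinal (trlt i).
have [/injectiveP/leq_card|] := boolP (injectiveb f).
  by rewrite !card_ord ltnn.
move=> /injectivePn[i [j ij fij]].
have {fij} fij : Num.truncn (M%:R * fr i) = Num.truncn (M%:R * fr j) by case: fij.
have clo : `|fr i - fr j| <= tau.
  apply: le_trans Mt; rewrite -(ler_pM2l M0) mulfV ?gt_eqF//.
  have h1 := @truncn_itv _ (M%:R * fr i); have h2 := @truncn_itv _ (M%:R * fr j).
  have /andP[? _] := fr0 i; have /andP[? _] := fr0 j.
  have {}h1 := h1 (mulr_ge0 (ltW M0) _); have {}h2 := h2 (mulr_ge0 (ltW M0) _).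
  rewrite -[X in X * _]gtr0_norm// -normrM mulrBr ler_norml.
  move: (h1 ltac:(done)) (h2 ltac:(done)); rewrite fij -natr1; lra.
wlog ltij : i j ij fij clo / (i < j)%N => [wl|].
  move: (ij); rewrite neq_ltn => /orP[|] h; first exact: wl h.
  by apply: (wl j i) h; rewrite 1?eq_sym// 1?distrC.
exists (j - i)%N; first lia.
apply: le_trans clo.
have -> : fr i - fr j = - ((j - i)%:R * rho -
    (Num.floor (j%:R * rho) - Num.floor (i%:R * rho))%:~R).
  by rewrite /fr natrB ?(ltnW ltij)// intrB; ring.
by rewrite normrN; exact: dint_le.
Qed.

(** In continued fraction terms [N] is a denominator [q_(n+1)], [d] is the distance from [q_n rho]
    to the integers, and [s] is the signed error of [q_(n+1) rho]. *)
Definition closest_return rho (N : nat) (d s : R) (kN : int) : Prop :=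
  [/\ (1 < N)%N, 0 < d,
      forall (i : nat) k, (0 < i < N)%N -> d <= `|i%:R * rho - k%:~R|,
      exists (m : nat) k, (0 < m < N)%N /\ `|m%:R * rho - k%:~R| = d &
      N%:R * rho = s + kN%:~R /\ `|s| < d].

(** It gives each point of an orbit segment of length [N] a neighbour less than [2 * d] to its
    right: the index jumps by [m] if it stays below [N], and by [m - N] otherwise. If the record
    time errs to the left, its complement to [N] errs to the right. *)
Lemma closest_return_next rho N d s kN : closest_return rho N d s kN ->
  exists (m : nat) k1 k2,
  [/\ (0 < m < N)%N, 0 < m%:R * rho - k1%:~R < 2 * d &
      0 < m%:R * rho - N%:R * rho - k2%:~R < 2 * d].
Proof.
case=> N1 d0 dmin [m [k [mN mk]]] [Ns sd].
have [h|h] : m%:R * rho - k%:~R = d \/ m%:R * rho - k%:~R = - d.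
- have [h|h] := leP 0 (m%:R * rho - k%:~R).
    by left; rewrite -mk ger0_norm.
  by right; rewrite -mk ltr0_norm// opprK.
- exists m, k, (k - kN); split=> //; first lra.
  rewrite Ns intrB; move: sd; rewrite ltr_norml; lra.
- exists (N - m)%N, (kN - k), (- k); split; first lia.
    rewrite natrB; last lia.
    rewrite mulrBl Ns intrB; move: sd; rewrite ltr_norml; lra.
  rewrite natrB; last lia.
  rewrite mulrBl Ns mulrNz; move: sd; rewrite ltr_norml; lra.
Qed.

(** [N] is the first time within [tau] of an integer and [d] the best distance before it;
    [tau < dint rho] rules out [N = 1]. *)
Lemma closest_return_exists rho (tau : R) : irrational rho ->
  0 < tau < dint rho ->
  exists N d s kN, closest_return rho N d s kN /\ `|s| <= tau < d.
Proof.
move=> irr /andP[tau0 tau1].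
have ex : exists n : nat, (0 < n)%N && (dint (n%:R * rho) <= tau).
  by have [n n0 h] := dirichlet rho tau0; exists n; rewrite n0.
pose N := ex_minn ex.
have [N0 Nt Nmin] : [/\ (0 < N)%N, dint (N%:R * rho) <= tau &
    forall i, (0 < i < N)%N -> tau < dint (i%:R * rho)].
  rewrite /N; case: ex_minnP => n /andP[n0 nt] nmin; split=> // i /andP[i0 iN].
  by rewrite ltNge; apply/negP => h; have := nmin i; rewrite i0 h => /(_ isT); lia.
have N1 : (1 < N)%N.
  rewrite ltn_neqAle N0 andbT eq_sym; apply/negP => /eqP NE.
  by move: Nt; rewrite NE mul1r; lra.
pose P := fun i : 'I_N => (0 < i)%N.
pose i0 : 'I_N := Ordinal N1.
pose m := [arg min_(i < i0 | P i) dint (i%:R * rho)]%O.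
have [m0 mmin] : (0 < m)%N /\ forall j : 'I_N, (0 < j)%N -> dint (m%:R * rho) <= dint (j%:R * rho).
  by rewrite /m; case: Order.TotalTheory.arg_minP => //.
have [k km] := dint_attained (m%:R * rho).
have [kN kNm] := dint_attained (N%:R * rho).
have tm : tau < dint (m%:R * rho) by apply: Nmin; rewrite m0 ltn_ord.
exists N, (dint (m%:R * rho)), (N%:R * rho - kN%:~R), kN; split; last first.
  by rewrite kNm; apply/andP; split.
split=> //.
- exact: lt_trans tm.
- move=> i l /andP[i1 iN]; apply: le_trans (dint_le _ l).
  exact: (mmin (Ordinal iN)).
- by exists m, k; rewrite m0 ltn_ord.
- by split; [ring | rewrite kNm; apply: le_lt_trans tm].
Qed.

Lemma dint_gt0 rho (n : nat) : irrational rho -> (0 < n)%N -> 0 < dint (n%:R * rho).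
Proof.
move=> irr n0; have [k <-] := dint_attained (n%:R * rho).
by rewrite normr_gt0 subr_eq0 irrational_neq.
Qed.

(** If [n] is a time at distance at most [e], a return closer than all of the first [n] times occurs
    after [n], so [n] competes in the minimum [d]. *)
Lemma closest_return_small rho (e : R) : irrational rho -> 0 < e ->
  exists2 tau : R, 0 < tau &
    forall N d s kN, closest_return rho N d s kN -> `|s| <= tau -> d <= e.
Proof.
move=> irr e0; have [n n0 ne] := dirichlet rho e0.
pose t := \big[Order.min/1]_(1 <= i < n.+1) dint (i%:R * rho).
have t0 : 0 < t.
  rewrite /t big_nat; elim/big_ind: _ => //.
    by move=> x y; rewrite lt_min => -> ->.
  by move=> i /andP[i0 _]; apply: dint_gt0.
exists (t / 2) => [|N d s kN [N1 d0 dmin _ [Ns sd]] st]; first by lra.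
have [ltNn|] := leqP N n; last first.
  move=> nN; have [k km] := dint_attained (n%:R * rho).
  have := dmin n k; rewrite km n0 nN => /(_ isT); lra.
have : t <= dint (N%:R * rho).
  rewrite /t (@bigD1_seq _ _ _ _ _ N)/=; last 2 first.
  - by rewrite mem_index_iota; lia.
  - exact: iota_uniq.
  by rewrite ge_min lexx.
have := dint_le (N%:R * rho) kN; rewrite Ns addrK; lra.
Qed.

(** Multiples of a nonzero step shorter than [b - a] cannot jump over the interval. That [m] is
    positive matters for the semiconjugacy, where the approximating orbit point has to be an image
    under [G]. *)
Lemma irrational_dense rho (a b : R) : irrational rho -> a < b ->
  exists (m : nat) k, (0 < m)%N /\ a < m%:R * rho + k%:~R < b.
Proof.
move=> irr ab.
have [n n0 nd] := dirichlet rho (ltac:(lra) : 0 < (b - a) / 2).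
have [k km] := dint_attained (n%:R * rho).
have dl0 : 0 < `|n%:R * rho - k%:~R| by rewrite km dint_gt0.
have dl1 : `|n%:R * rho - k%:~R| < b - a by rewrite km; lra.
have key (u v : R) (dl : R) : 0 < dl -> dl < v - u ->
    exists (j : nat) l, (0 < j)%N /\ u < j%:R * dl - l%:~R < v.
  move=> dlp dlv; pose l := Num.ceil (- u).
  have ul : 0 <= u + l%:~R by have := ceil_ge (- u); rewrite -/l; lra.
  exists (Num.truncn ((u + l%:~R) / dl)).+1, l; split=> //.
  have /andP[h1 h2] := truncn_itv (divr_ge0 ul (ltW dlp)).
  move: h1 h2; rewrite ler_pdivlMr// ltr_pdivrMr//.
  rewrite -natr1 => h1 h2; rewrite mulrDl mul1r in h2 *; lra.
have [pos|neg] := leP 0 (n%:R * rho - k%:~R).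
  rewrite ger0_norm// in dl0 dl1.
  have [j [l [j0 h]]] := key _ _ _ dl0 dl1.
  exists (j * n)%N, (- (j%:Z * k) - l); split; first by rewrite muln_gt0 j0.
  suff -> : (j * n)%:R * rho + (- (j%:Z * k) - l)%:~R =
    j%:R * (n%:R * rho - k%:~R) - l%:~R by [].
  by rewrite intrB mulrNz intrM natrM -pmulrn; ring.
rewrite ltr0_norm// in dl0 dl1.
have [j [l [j0 h]]] := key (-b) (-a) _ dl0 (ltac:(lra)).
exists (j * n)%N, (- (j%:Z * k) + l); split; first by rewrite muln_gt0 j0.
have -> : (j * n)%:R * rho + (- (j%:Z * k) + l)%:~R =
    - (j%:R * - (n%:R * rho - k%:~R) - l%:~R).
  by rewrite intrD mulrNz intrM natrM -pmulrn; ring.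
lra.
Qed.

End ClosestReturns.

(** * Semiconjugacy to the rotation *)

Section Lifts.
Context {R : realType} (G : R -> R).
Hypothesis Ginc : {homo G : x y / x < y}.
Hypothesis Gper : forall x, G (x + 1) = G x + 1.

Lemma lift_mono : {mono G : x y / x <= y}.
Proof. exact: le_mono. Qed.

Lemma lift_mono_lt : {mono G : x y / x < y}.
Proof. exact: leW_mono lift_mono. Qed.

Lemma liftDz x (k : int) : G (x + k%:~R) = G x + k%:~R.
Proof.
have nat_case (n : nat) y : G (y + n%:R) = G y + n%:R.
  elim: n y => [|n IH] y; first by rewrite !addr0.
  by rewrite -natr1 !addrA Gper IH.
case: k => n; first exact: nat_case.
rewrite NegzE mulrNz; apply/eqP; rewrite eq_sym subr_eq -[_%:~R]/(n.+1%:R).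
by rewrite -nat_case subrK.
Qed.

Lemma iter_lift_mono n : {mono iter n G : x y / x <= y}.
Proof. by elim: n => [//|n IH] x y; rewrite !iterS lift_mono IH. Qed.

Lemma iter_lift_mono_lt n : {mono iter n G : x y / x < y}.
Proof. exact: leW_mono (@iter_lift_mono n). Qed.

Lemma iter_liftDz n x (k : int) : iter n G (x + k%:~R) = iter n G x + k%:~R.
Proof. by elim: n => [//|n IH]; rewrite !iterS IH liftDz. Qed.

Variable rho : R.
Hypothesis Grot : forall x, (iter n G x - x) / n%:R @[n --> \oo] --> rho.

(** Iterating the inequality moves [x] by at most [i * k] in [i * m] steps, so the mean displacement
    cannot tend to a limit above [k / m]. *)
Lemma rotation_le m (k : int) x : (0 < m)%N ->
  iter m G x <= x + k%:~R -> m%:R * rho <= k%:~R.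
Proof.
move=> m0 h; rewrite leNgt; apply/negP => hlt.
have mR : 0 < m%:R :> R by rewrite ltr0n.
have e0 : 0 < rho - k%:~R / m%:R by rewrite subr_gt0 ltr_pdivrMr// mulrC.
have /cvgrPdist_lt/(_ _ e0)[N _ HN] := Grot x.
have it i : iter (i * m) G x <= x + (i%:Z * k)%:~R.
  elim: i => [|i IH]; first by rewrite mul0r addr0.
  rewrite mulSn addnC iterD; apply: (@le_trans _ _ (iter (i * m) G (x + k%:~R))).
    by rewrite iter_lift_mono.
  by rewrite iter_liftDz intS mulrDl mul1r intrD [k%:~R + _]addrC addrA lerD2r.
have nR : 0 < (N.+1 * m)%:R :> R by rewrite ltr0n muln_gt0 m0.
have := HN (N.+1 * m)%N; rewrite /= => /(_ (leq_trans (leqnSn N) (leq_pmulr _ m0))).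
rewrite ltr_norml => /andP[_]; rewrite ltNge => /negP; apply; rewrite lerD2l lerN2.
rewrite ler_pdivrMr// lerBlDl (le_trans (it _))// lerD2l natrM intrM.
by rewrite -pmulrn mulrCA mulfVK ?gt_eqF.
Qed.

Lemma rotation_ge m (k : int) x : (0 < m)%N ->
  x + k%:~R <= iter m G x -> k%:~R <= m%:R * rho.
Proof.
move=> m0 h; rewrite leNgt; apply/negP => hlt.
have mR : 0 < m%:R :> R by rewrite ltr0n.
have e0 : 0 < k%:~R / m%:R - rho by rewrite subr_gt0 ltr_pdivlMr// mulrC.
have /cvgrPdist_lt/(_ _ e0)[N _ HN] := Grot x.
have it i : x + (i%:Z * k)%:~R <= iter (i * m) G x.
  elim: i => [|i IH]; first by rewrite mul0r addr0.
  rewrite mulSn addnC iterD; apply: (@le_trans _ _ (iter (i * m) G (x + k%:~R))).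
    by rewrite iter_liftDz intS mulrDl mul1r intrD [k%:~R + _]addrC addrA lerD2r.
  by rewrite iter_lift_mono.
have nR : 0 < (N.+1 * m)%:R :> R by rewrite ltr0n muln_gt0 m0.
have := HN (N.+1 * m)%N; rewrite /= => /(_ (leq_trans (leqnSn N) (leq_pmulr _ m0))).
rewrite ltr_norml => /andP[+ _]; rewrite opprB ltNge => /negP; apply.
rewrite lerD2l lerN2 ler_pdivlMr// lerBrDl (le_trans _ (it _))// lerD2l natrM intrM.
by rewrite -pmulrn mulrCA mulfVK ?gt_eqF.
Qed.

Hypothesis irr : irrational rho.
Variable p : R.

Lemma orbit_le m k m' k' :
  iter m G p + k%:~R <= iter m' G p + k'%:~R ->
  m%:R * rho + k%:~R <= m'%:R * rho + k'%:~R.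
Proof.
move=> h; have [mm|mm|mm] := ltngtP m m'.
- have e : m'%:R = (m' - m)%:R + m%:R :> R by rewrite -natrD subnK// ltnW.
  have := @rotation_ge (m' - m) (k - k') (iter m G p).
  rewrite -iterD (subnK (ltnW mm)) subn_gt0 mm e intrB => /(_ isT).
  by move=> /(_ (ltac:(lra))); rewrite mulrDl; lra.
- have e : m%:R = (m - m')%:R + m'%:R :> R by rewrite -natrD subnK// ltnW.
  have := @rotation_le (m - m') (k' - k) (iter m' G p).
  rewrite -iterD (subnK (ltnW mm)) subn_gt0 mm e intrB => /(_ isT).
  by move=> /(_ (ltac:(lra))); rewrite mulrDl; lra.
- by move: h; rewrite mm !lerD2l.
Qed.

Lemma orbit_lt m k m' k' :
  m%:R * rho + k%:~R < m'%:R * rho + k'%:~R ->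
  iter m G p + k%:~R < iter m' G p + k'%:~R.
Proof. by apply: contra_lt => /orbit_le. Qed.

(** This is the construction of Poincare: the orbit of [p] and its integer translates are ordered
    like their rotation positions, and [phi] extends this order-preserving correspondence by
    suprema. *)
Let below x := [set y | exists m (k : int),
  iter m G p + k%:~R <= x /\ y = m%:R * rho + k%:~R].
Let phi x := sup (below x).

Let below_sup x : has_sup (below x).
Proof.
split.
  exists (Num.floor (x - p))%:~R, 0%N, (Num.floor (x - p)); rewrite mul0r add0r.
  by split=> //=; have := floor_le (x - p); lra.
exists (Num.ceil (x - p))%:~R => y [m [k [h ->]]].
have := @orbit_le m k 0 (Num.ceil (x - p)); rewrite /= mul0r add0r; apply.
by have := ceil_ge (x - p); lra.
Qed.

Let phi_ge x m k : iter m G p + k%:~R <= x -> m%:R * rho + k%:~R <= phi x.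
Proof. by move=> h; apply: sup_upper_bound => //; exists m, k. Qed.

Let phi_le x y :
  (forall m k, iter m G p + k%:~R <= x -> m%:R * rho + k%:~R <= y) -> phi x <= y.
Proof.
move=> h; apply: ge_sup; first by have [] := below_sup x.
by move=> z [m [k [? ->]]]; exact: h.
Qed.

Let phi_orbit m k : phi (iter m G p + k%:~R) = m%:R * rho + k%:~R.
Proof.
apply/eqP; rewrite eq_le phi_ge// andbT; apply: phi_le => m' k'; exact: orbit_le.
Qed.

Let phi_homo : {homo phi : x y / x <= y}.
Proof.
move=> x y xy; apply: phi_le => m k h; apply: phi_ge; exact: le_trans xy.
Qed.

Let phi_lt x y : phi x < phi y -> x < y.
Proof. by apply: contra_lt => /phi_homo. Qed.

Let phi_per x : phi (x + 1) = phi x + 1.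
Proof.
apply/eqP; rewrite eq_le; apply/andP; split.
  apply: phi_le => m k h; have := @phi_ge x m (k - 1).
  rewrite intrB => /(_ (ltac:(lra))); lra.
rewrite -lerBrDr; apply: phi_le => m k h; have := @phi_ge (x + 1) m (k + 1).
rewrite intrD => /(_ (ltac:(lra))); lra.
Qed.

Let phi_eqv x : phi (G x) = phi x + rho.
Proof.
have orbS m k : iter m.+1 G p + k%:~R = G (iter m G p + k%:~R).
  by rewrite liftDz.
apply/eqP; rewrite eq_le; apply/andP; split.
  have pos m k : (0 < m)%N -> iter m G p + k%:~R <= G x ->
      m%:R * rho + k%:~R <= phi x + rho.
    case: m => // m _; rewrite orbS lift_mono => /phi_ge.
    by rewrite -natr1 mulrDl mul1r; lra.
  (* At time 0 the point [p + k] is not the image of a point of the forward orbit; density supplies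
     orbit points of positive time just below it. *)
  apply: phi_le => -[|m] k h; last exact: pos.
  rewrite leNgt; apply/negP => /(irrational_dense irr)[m [k' [m0 /andP[h1 h2]]]].
  have := pos m k' m0 (ltW (lt_le_trans (orbit_lt h2) h)).
  by rewrite leNgt h1.
rewrite -lerBrDr; apply: phi_le => m k h; have := @phi_ge (G x) m.+1 k.
rewrite orbS lift_mono => /(_ h); rewrite -natr1 mulrDl mul1r; lra.
Qed.

(** The values of the monotone [phi] on the orbit are dense, so [phi] cannot jump over [y] at the
    supremum of [E]. *)
Let phi_surj y : exists x, phi x = y.
Proof.
pose E := [set q | phi q <= y].
have Esup : has_sup E.
  split.
    exists (p + (Num.floor y)%:~R); have := phi_orbit 0 (Num.floor y).
    rewrite /E /= mul0r add0r => ->; exact: floor_le.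
  exists (p + (Num.floor y + 1)%:~R) => z /= h; apply/ltW/phi_lt.
  have := phi_orbit 0 (Num.floor y + 1); rewrite /= mul0r add0r => ->.
  exact: le_lt_trans (floorD1_gt _).
exists (sup E); apply/eqP; rewrite eq_le !leNgt; apply/andP; split; apply/negP.
  move=> /(irrational_dense irr)[m [k [m0 /andP[h1 h2]]]].
  rewrite -phi_orbit in h1 h2; have := phi_lt h2; rewrite ltNge => /negP; apply.
  apply: ge_sup; first by have [] := Esup.
  by move=> z /= h; apply/ltW/phi_lt/(le_lt_trans h).
move=> /(irrational_dense irr)[m [k [m0 /andP[h1 h2]]]].
rewrite -phi_orbit in h1 h2; have := phi_lt h1; rewrite ltNge => /negP; apply.
by apply: sup_upper_bound => //=; apply/ltW.
Qed.

Lemma rotation_semiconj : exists phi psi : R -> R,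
  [/\ {homo phi : x y / x <= y}, forall x, phi (x + 1) = phi x + 1,
      forall x, phi (G x) = phi x + rho, phi p = 0 & cancel psi phi].
Proof.
exists phi, (fun y => projT1 (cid (phi_surj y))); split=> //.
- by have := phi_orbit 0 0; rewrite mul0r addr0/= addr0.
- by move=> y; case: cid.
Qed.

End Lifts.

(** Induction on the number of intervals: all others end before the one with the largest left
    endpoint begins, and that endpoint becomes the new [b]. *)
Lemma disjoint_sum_le {R : realDomainType} (I : eqType) (s : seq I) (x y : I -> R) (a b : R) :
  a <= b -> uniq s ->
  (forall i, i \in s -> [/\ a <= x i, x i < y i & y i <= b]) ->
  (forall i j, i \in s -> j \in s -> i != j -> y i <= x j \/ y j <= x i) ->
  \sum_(i <- s) (y i - x i) <= b - a.
Proof.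
have [n ns] := ubnP (size s); elim: n s b ns => // n IH s b.
case: s => [|i0 s]; first by rewrite big_nil subr_ge0.
set s1 := i0 :: s => ss ab us itv dis.
have [i i1 imax] : exists2 i, i \in s1 & forall j, j \in s1 -> x j <= x i.
  rewrite /s1; move: i0 s {s1 ss us itv dis} => i0 s.
  elim: s i0 => [|i1 s IHs] i0.
    by exists i0; rewrite ?mem_seq1// => j; rewrite mem_seq1 => /eqP->.
  have [i is1 imax] := IHs i1; have [h|h] := leP (x i) (x i0).
    exists i0; first exact: mem_head.
    by move=> j; rewrite inE => /orP[/eqP->//|/imax/le_trans]; apply.
  exists i; first by rewrite inE is1 orbT.
  by move=> j; rewrite inE => /orP[/eqP->|/imax//]; exact: ltW.
have [ax xy yb] := itv _ i1.
have sub j : j \in rem i s1 -> j \in s1 by exact: mem_rem.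
rewrite (big_rem i)// (_ : b - a = (b - x i) + (x i - a)); last by ring.
apply: lerD; first by rewrite lerD2r.
apply: IH => //.
- by rewrite size_rem.
- exact: rem_uniq.
- move=> j; rewrite mem_rem_uniq// inE => /andP[ji js].
  have [? ? ?] := itv _ js; split=> //.
  have [|//] := dis _ _ i1 js (ltac:(by rewrite eq_sym)).
  by move=> h; have := imax _ js; lra.
- by move=> j k js ks; apply: dis; exact: sub.
Qed.

(** * Lifts that are linear fractional between breaks *)

(* [phi] semiconjugates [G] to the rotation and [psi] is a right inverse of it.  [ml_moebius] says that
   [G v - G u = sg (v - u) / (w u * w v)] on [[p + k, p + k + 1]], where [w] is affine with values [sg] and [1] at the
   two endpoints; hence [G' = sg / w^2] there, and the break of [G] has size [sg^2]. *)
Record moebius_lift {R : realType} (p sg rho : R) (G phi psi : R -> R) : Prop := {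
  ml_sg_gt0 : 0 < sg;
  ml_sg_neq1 : sg != 1;
  ml_incr : {homo G : x y / x < y};
  ml_per : forall x, G (x + 1) = G x + 1;
  ml_surj : forall y, exists x, G x = y;
  ml_moebius : forall (k : int) u v,
    p + k%:~R <= u -> u <= v -> v <= p + k%:~R + 1 ->
    (G v - G u) * ((sg + (1 - sg) * (u - k%:~R - p)) *
                   (sg + (1 - sg) * (v - k%:~R - p))) = sg * (v - u);
  ml_phi_homo : {homo phi : x y / x <= y};
  ml_phi_per : forall x, phi (x + 1) = phi x + 1;
  ml_phi_eqv : forall x, phi (G x) = phi x + rho;
  ml_phi_p : phi p = 0;
  ml_psiK : cancel psi phi
}.

(** Since [w] stays between [sg] and 1, the derivative [sg / w^2] stays between [sg] and [1 / sg];
    this is the Lipschitz constant of [G] and of its inverse. *)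
Definition lip_const {R : realType} (sg : R) : R := Num.max sg sg^-1.

(** An upper bound for [|w'| / w], which is half of [|G'' / G'|]. *)
Definition distortion_rate {R : realType} (sg : R) : R := `|1 - sg| / Num.min sg 1.

Lemma lip_const_ge1 {R : realType} (sg : R) : 0 < sg -> 1 <= lip_const sg.
Proof.
move=> sg0; rewrite /lip_const le_max; case: (leP 1 sg) => //= h.
by rewrite invf_ge1// ltW.
Qed.

Lemma distortion_rate_ge0 {R : realType} (sg : R) : 0 < sg -> 0 <= distortion_rate sg.
Proof. by move=> sg0; rewrite divr_ge0// ltW// lt_min sg0 ltr01. Qed.

Section MoebiusGeometry.
Context {R : realType} (p sg rho : R) (G phi psi : R -> R).
Hypothesis S : moebius_lift p sg rho G phi psi.
Implicit Types (x y u v l : R) (k : int).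
Let w x := sg + (1 - sg) * (x - p).
Let sg_gt0 := ml_sg_gt0 S.
Let lam := lip_const sg.
Let dlw := distortion_rate sg.
Let Ginc := ml_incr S.
Let Gmob := ml_moebius S.
Let phi_homo := ml_phi_homo S.
Let phi_per := ml_phi_per S.
Let phi_eqv := ml_phi_eqv S.
Let psiK := ml_psiK S.

Let mono := lift_mono Ginc.

Lemma phi_lt x y : phi x < phi y -> x < y.
Proof. by apply: contra_lt => /phi_homo. Qed.

Lemma psi_lt x y : x < y -> psi x < psi y.
Proof. by move=> xy; apply: phi_lt; rewrite !psiK. Qed.

Lemma psi_le x y : x <= y -> psi x <= psi y.
Proof. by rewrite le_eqVlt => /orP[/eqP->//|/psi_lt/ltW]. Qed.

Lemma phi_addz x (k : int) : phi (x + k%:~R) = phi x + k%:~R.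
Proof.
have nat_case (n : nat) y : phi (y + n%:R) = phi y + n%:R.
  elim: n y => [|n IH] y; first by rewrite !addr0.
  by rewrite -natr1 !addrA phi_per IH.
case: k => n; first exact: nat_case.
rewrite NegzE mulrNz; apply/eqP; rewrite eq_sym subr_eq -[_%:~R]/(n.+1%:R).
by rewrite -nat_case subrK.
Qed.

Lemma phi_iter n x : phi (iter n G x) = phi x + n%:R * rho.
Proof.
elim: n => [|n IH]; first by rewrite mul0r addr0.
by rewrite iterS phi_eqv IH -natr1; ring.
Qed.

Lemma iter_surj n y : exists x, iter n G x = y.
Proof.
elim: n y => [|n IH] y; first by exists y.
have [z zy] := ml_surj S y; have [x xz] := IH z; exists x.
by rewrite iterS xz.
Qed.

Let wmin : 0 < Num.min sg 1. Proof. by rewrite lt_min sg_gt0 ltr01. Qed.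

Let w_bound x : p <= x -> x <= p + 1 -> Num.min sg 1 <= w x <= Num.max sg 1.
Proof.
move=> h1 h2; rewrite /w minElt maxElt; case: ltP => h; apply/andP; split; nra.
Qed.

Let w_gt0 x : p <= x -> x <= p + 1 -> 0 < w x.
Proof. by move=> h1 h2; have /andP[+ _] := w_bound h1 h2; exact: lt_le_trans. Qed.

Let w_lip x y l : p <= x -> x <= p + 1 -> y - x <= l -> x - y <= l ->
  w y <= (1 + dlw * l) * w x.
Proof.
move=> h1 h2 l1 l2; have /andP[h3 _] := w_bound h1 h2.
have n0 := normr_ge0 (1 - sg); have l0 : 0 <= l by lra.
have wE : w y - w x = (1 - sg) * (y - x) by rewrite /w; ring.
have wl : w y - w x <= `|1 - sg| * l.
  rewrite wE (le_trans (ler_norm _))// normrM ler_wpM2l// ler_norml; lra.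
have : `|1 - sg| * l <= dlw * l * w x.
  rewrite (_ : _ * l * w x = `|1 - sg| * l * (w x / Num.min sg 1)).
    by rewrite ler_peMr ?mulr_ge0// ler_pdivlMr// mul1r.
  by rewrite /dlw /distortion_rate; ring.
lra.
Qed.

(** The difference quotient on [[u, v]] is [sg / (w u * w v)], and each of the two weights changes
    over [[x, y]] by a factor of at most [expR (dlw * (y - x))]. *)
Lemma lift_quot_free (k : int) x y u v u' v' :
  p + k%:~R <= x -> y <= p + k%:~R + 1 ->
  x <= u -> u < v -> v <= y -> x <= u' -> u' < v' -> v' <= y ->
  (G v - G u) * (v' - u') <= expR (2 * dlw * (y - x)) * ((v - u) * (G v' - G u')).
Proof.
move=> h1 h2 xu uv vy xu' uv' vy'.
have : _ * (w _ * w _) = _ := @Gmob k u v (ltac:(lra)) (ltac:(lra)) (ltac:(lra)).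
have : _ * (w _ * w _) = _ := @Gmob k u' v' (ltac:(lra)) (ltac:(lra)) (ltac:(lra)).
set wu := w (u - _); set wv := w (v - _); set wu' := w (u' - _); set wv' := w (v' - _).
move=> e' e; set l := y - x.
have wu0 : 0 < wu by apply: w_gt0; lra.
have wv0 : 0 < wv by apply: w_gt0; lra.
have wu'0 : 0 < wu' by apply: w_gt0; lra.
have wv'0 : 0 < wv' by apply: w_gt0; lra.
have l1 : wu' <= (1 + dlw * l) * wu by apply: w_lip; rewrite /l; lra.
have l2 : wv' <= (1 + dlw * l) * wv by apply: w_lip; rewrite /l; lra.
have ge1 : 1 + dlw * l <= expR (dlw * l) by exact: expR_ge1Dx.
have E0 := expR_gt0 (dlw * l).
have key : wu' * wv' <= expR (2 * dlw * l) * (wu * wv).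
  rewrite (_ : 2 * dlw * l = dlw * l + dlw * l); last by ring.
  rewrite expRD.
  rewrite mulrACA; apply: ler_pM; [exact: ltW|exact: ltW| |].
    by apply: le_trans l1 _; rewrite ler_pM2r.
  by apply: le_trans l2 _; rewrite ler_pM2r.
have P0 : 0 < wu * wv * (wu' * wv') by rewrite !mulr_gt0.
rewrite -(ler_pM2l P0).
have -> : wu * wv * (wu' * wv') * ((G v - G u) * (v' - u')) =
   (wu' * wv') * (((G v - G u) * (wu * wv)) * (v' - u')) by ring.
have -> : wu * wv * (wu' * wv') * (expR (2 * dlw * l) * ((v - u) * (G v' - G u'))) =
   expR (2 * dlw * l) * (wu * wv) * (((G v' - G u') * (wu' * wv')) * (v - u)) by ring.
rewrite e e' (_ : sg * (v - u) * (v' - u') = sg * (v' - u') * (v - u)); last by ring.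
by rewrite ler_wpM2r// !mulr_ge0 ?subr_ge0 ?ltW.
Qed.

Let lip1 (k : int) u v : p + k%:~R <= u -> u <= v -> v <= p + k%:~R + 1 ->
  G v - G u <= lam * (v - u) /\ v - u <= lam * (G v - G u).
Proof.
move=> h1 h2 h3; have e : _ * (w _ * w _) = _ := Gmob h1 h2 h3.
have := @w_bound (u - k%:~R) (ltac:(lra)) (ltac:(lra)).
have := @w_bound (v - k%:~R) (ltac:(lra)) (ltac:(lra)).
move: e; set wv := w (v - _); set wu := w (u - _) => e /andP[a1 a2] /andP[b1 b2].
have Guv : 0 <= G v - G u by rewrite subr_ge0 mono.
have sV : sg * sg^-1 = 1 by rewrite mulfV// gt_eqF.
have sV0 : 0 < sg^-1 by rewrite invr_gt0.
set D := G v - G u in e Guv *; set W := wu * wv in e.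
have W1 : Num.min sg 1 * Num.min sg 1 <= W by apply: ler_pM => //; exact: ltW.
have W2 : W <= Num.max sg 1 * Num.max sg 1.
  by apply: ler_pM => //; [exact: le_trans (ltW wmin) _|exact: le_trans (ltW wmin) _].
have DV : v - u = D * W * sg^-1 by rewrite e mulrC mulKf// gt_eqF.
rewrite /lam /lip_const; move: W1 W2; rewrite minElt !maxElt; case: ltP => s1 W1 W2.
  have -> : sg < sg^-1 by rewrite (lt_trans s1)// invf_gt1.
  split; last by rewrite DV mulrC ler_wpM2l ?(ltW sV0)// ler_piMr//; lra.
  rewrite (_ : sg^-1 * (v - u) = D * (W * (sg^-1 * sg^-1))); last by rewrite DV; ring.
  rewrite ler_peMr// -(_ : sg * sg * (sg^-1 * sg^-1) = 1).
    by rewrite ler_wpM2r// mulr_ge0// (ltW sV0).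
  by rewrite mulrACA sV mulr1.
have -> : sg < sg^-1 = false.
  by apply/negbTE; rewrite -leNgt (le_trans _ s1)// invf_le1.
split.
  rewrite (_ : sg * (v - u) = D * W); last by rewrite DV; field; rewrite gt_eqF.
  rewrite ler_peMr//; lra.
rewrite DV -mulrA mulrC ler_wpM2r// ler_pdivrMr//.
Qed.

(** An arc of length at most 1 has at most one break in its interior; it is cut there. *)
Lemma lift_lip u v : u <= v -> v <= u + 1 ->
  G v - G u <= lam * (v - u) /\ v - u <= lam * (G v - G u).
Proof.
move=> uv vu; pose k := Num.floor (u - p).
have /andP[k1 k2] := floor_itv (u - p); rewrite -/k intrD in k1 k2.
have [h|h] := leP v (p + k%:~R + 1).
  by apply: (@lip1 k) => //; lra.
have [a1 a2] := @lip1 k u (p + k%:~R + 1) (ltac:(lra)) (ltac:(lra)) (lexx _).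
have [b1 b2] := @lip1 (k + 1) (p + k%:~R + 1) v (ltac:(rewrite intrD; lra))
   (ltW h) (ltac:(rewrite intrD; lra)).
by split; lra.
Qed.

End MoebiusGeometry.

(** * Images of an arc along a closest return: total length and number of breaks met *)

Section OrbitArcs.
Context {R : realType} (p sg rho : R) (G phi psi : R -> R).
Hypothesis S : moebius_lift p sg rho G phi psi.
Context (N : nat) (d s : R) (kN : int).
Hypothesis C : closest_return rho N d s kN.
Implicit Types (x y u v : R) (k : int).

Let lt_phi x y : x < y -> phi x <= phi y.
Proof. by move=> /ltW/(ml_phi_homo S). Qed.

Let it_mono := iter_lift_mono (ml_incr S).
Let it_mono_lt := iter_lift_mono_lt (ml_incr S).

Let d_gt0 : 0 < d. Proof. by have [] := C. Qed.
Let N_gt1 : (1 < N)%N. Proof. by have [] := C. Qed.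

Lemma closest_return_le_half : d <= 2^-1.
Proof.
have [_ _ dm _ _] := C.
have [k hk] := dint_attained rho; have := dm 1%N k.
rewrite mul1r N_gt1 /= hk => /(_ isT) h; apply: le_trans h _.
rewrite /dint; have /andP[] := floor_itv rho; rewrite intrD => f1 f2.
by rewrite ge_min; case: (leP (rho - (Num.floor rho)%:~R) 2^-1) => //= h; lra.
Qed.

Lemma phi_iter_sub n x y : phi (iter n G y) - phi (iter n G x) = phi y - phi x.
Proof. by rewrite !(phi_iter S); ring. Qed.

(** The jumps by [m] and by [m - N] permute the indices below [N], so in the total displacement the
    multiples of [rho] cancel. What remains is an integer that is a sum of positive terms, each
    below [2 * d]. *)
Lemma closest_return_winding : exists (m : nat) k1 k2,
  [/\ (0 < m < N)%N, 0 < m%:R * rho - k1%:~R < 2 * d,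
      0 < m%:R * rho - N%:R * rho - k2%:~R < 2 * d &
      (1 <= - (N - m)%:R * k1%:~R - m%:R * k2%:~R :> R) /\ 1 <= N%:R * (2 * d)].
Proof.
have [m [k1 [k2 [mN h1 h2]]]] := closest_return_next C; exists m, k1, k2.
pose W : int := - ((N - m)%:Z * k1) - m%:Z * k2.
have WE : W%:~R = - (N - m)%:R * k1%:~R - m%:R * k2%:~R :> R.
  by rewrite /W intrB mulrNz !intrM mulNr.
have NE : N%:R = (N - m)%:R + m%:R :> R by rewrite -natrD subnK//; lia.
have Nm0 : 0 < (N - m)%:R :> R by rewrite ltr0n; lia.
have m0 : 0 < m%:R :> R by rewrite ltr0n; lia.
have WE2 : W%:~R = (N - m)%:R * (m%:R * rho - k1%:~R) +
   m%:R * (m%:R * rho - N%:R * rho - k2%:~R) :> R by rewrite WE NE; ring.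
have W0 : 0 < W%:~R :> R.
  by rewrite WE2; case/andP: h1 => ? _; case/andP: h2 => ? _; rewrite addr_gt0 ?mulr_gt0.
have W1 : 1 <= W%:~R :> R by rewrite -[1]/(1%:~R) ler_int -gtz0_ge1 -(ltr0z R).
split=> //; split; first by rewrite -WE.
apply: le_trans W1 _; rewrite WE2.
rewrite (_ : N%:R * (2 * d) = (N - m)%:R * (2 * d) + m%:R * (2 * d)); last first.
  by rewrite NE mulrDl.
apply: lerD; rewrite ler_pM2l//.
  by case/andP: h1 => _ /ltW.
by case/andP: h2 => _ /ltW.
Qed.

(** Each image arc reaches beyond the right neighbour [t j] of its left endpoint. The neighbours are
    the left endpoints permuted and shifted by integers, so the sum collapses to the winding
    number. *)
Lemma arc_sum_ge1 x y : 2 * d <= phi y - phi x ->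
  1 <= \sum_(0 <= j < N) (iter j G y - iter j G x).
Proof.
move=> dxy; have [m [k1 [k2 [mN h1 h2 [W1 _]]]]] := closest_return_winding.
have mN' : (m <= N)%N by lia.
pose t j := if (j < N - m)%N then iter (j + m) G x - k1%:~R
            else iter (j + m - N) G x - k2%:~R.
have tE : \sum_(0 <= j < N) (t j - iter j G x) =
    - (N - m)%:R * k1%:~R - m%:R * k2%:~R.
  rewrite sumrB (@big_cat_nat _ _ _ (N - m))//=; last exact: leq_subr.
  rewrite (@eq_big_nat _ _ _ 0 (N - m) _ (fun j => iter (j + m) G x - k1%:~R)); last first.
    by move=> j /andP[_ h]; rewrite /t h.
  rewrite -{2}(add0n (N - m)%N) big_addn (_ : (N - (N - m) = m)%N); last lia.
  rewrite (@eq_big_nat _ _ _ 0 m _ (fun j => iter j G x - k2%:~R)); last first.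
    move=> j /andP[_ h]; rewrite /t ifF; last by apply/negbTE; lia.
    by congr (iter _ _ _ - _); lia.
  rewrite !sumrB !sumr_const_nat !subn0.
  rewrite (_ : \sum_(0 <= i < N - m) iter (i + m) G x = \sum_(m <= i < N) iter i G x); last first.
    by rewrite -[in RHS](add0n m) big_addn.
  rewrite (@big_cat_nat _ _ _ m 0 N _ (fun j => iter j G x))//=.
  rewrite -[k1%:~R *+ _]mulr_natl -[k2%:~R *+ _]mulr_natl; ring.
apply: le_trans W1 _; rewrite -tE; apply: ler_sum_nat => j /andP[_ jN].
rewrite lerD2r; apply/ltW/(phi_lt S); rewrite !(phi_iter S).
rewrite /t; case: ifPn => hj.
  rewrite -mulrNz (phi_addz S) (phi_iter S) natrD mulrNz; case/andP: h1 => _ ?; lra.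
rewrite -mulrNz (phi_addz S) (phi_iter S) natrB; last lia.
by rewrite natrD mulrNz; case/andP: h2 => _ ?; lra.
Qed.

(** Two images overlapping modulo 1 would bring two rotation points with indices below [N] closer
    than [d]. *)
Lemma arc_sum_le1 x y : x < y -> phi y - phi x < d ->
  \sum_(0 <= j < N) (iter j G y - iter j G x) <= 1.
Proof.
move=> xy dxy; have [_ _ dmin _ _] := C.
have sep i j k : (i < N)%N -> (j < N)%N -> (i != j) || (k != 0) ->
    iter i G y <= iter j G x + k%:~R \/ iter j G y + k%:~R <= iter i G x.
  move=> iN jN neq.
  have [|a1] := leP (iter i G y) (iter j G x + k%:~R); first by left.
  have [|a2] := leP (iter j G y + k%:~R) (iter i G x); first by right.
  exfalso.
  have := lt_phi a1; have := lt_phi a2; rewrite !(phi_addz S) !(phi_iter S).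
  have := closest_return_le_half => d2.
  move=> b1 b2; have c1 : `|i%:R * rho - j%:R * rho - k%:~R| < d by rewrite ltr_norml; lra.
  have [ij|ij|ij] := ltngtP i j.
  - have := dmin (j - i)%N (- k) (ltac:(clear - ij iN jN; lia)).
    rewrite leNgt => /negP; apply; rewrite natrB 1?ltnW// mulrNz -normrN.
    by apply: le_lt_trans c1; rewrite le_eqVlt; apply/orP; left; apply/eqP; congr `|_|; ring.
  - have := dmin (i - j)%N k (ltac:(clear - ij iN jN; lia)).
    rewrite leNgt => /negP; apply; rewrite natrB 1?ltnW//.
    by apply: le_lt_trans c1; rewrite mulrBl.
  - move: neq; rewrite ij eqxx/= => k0.
    move: c1; rewrite ij subrr add0r normrN -intr_norm => c1.
    have : (1 : int)%:~R <= `|k|%:~R :> R by rewrite ler_int; clear - k0; lia.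
    rewrite mulr1z; lra.
(* All images are translated so as to begin in [[x, x + 1)]; they end by [x + 1] because they do not
   overlap the translate of the initial arc that begins there. *)
pose K j := Num.floor (iter j G x - x).
pose x' j := iter j G x - (K j)%:~R; pose y' j := iter j G y - (K j)%:~R.
rewrite (_ : 1 = x + 1 - x); last by ring.
rewrite (eq_bigr (fun j => y' j - x' j)) => [|j _]; last by rewrite /x' /y'; ring.
apply: disjoint_sum_le; rewrite ?iota_uniq//; first by rewrite lerDl.
- move=> j; rewrite mem_index_iota => jN; have jN' : (j < N)%N by lia.
  have := floor_itv (iter j G x - x); rewrite -/(K j) intrD => /andP[f1 f2].
  split; first by rewrite /x'; lra.
    by rewrite /x' /y' ltrD2r it_mono_lt.
  have := sep j 0%N (K j + 1) jN' (ltac:(lia)).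
  have [j0|j0] := eqVneq j 0%N.
    move=> _; rewrite /y' /K j0 /= subrr floor0 subr0.
    have := sep 0%N 0%N 1 (ltac:(lia)) (ltac:(lia)) isT; rewrite /= => -[]; lra.
  move=> /(_ isT); rewrite /= intrD /y'; move=> []; lra.
- move=> i j; rewrite !mem_index_iota => iN jN ij.
  have := sep i j (K i - K j) (ltac:(lia)) (ltac:(lia)) (ltac:(by rewrite ij)).
  by rewrite intrB /x' /y' => -[]; [left|right]; lra.
Qed.

Lemma arc_sum_le L x y : x < y -> phi y - phi x < L.+1%:R * d ->
  \sum_(0 <= j < N) (iter j G y - iter j G x) <= L.+1%:R.
Proof.
elim: L x y => [|L IH] x y xy D; first by apply: arc_sum_le1 => //; rewrite mul1r in D.
have [h|h] := ltP (phi y - phi x) d.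
  by apply: le_trans (arc_sum_le1 xy h) _; rewrite ler1n.
have L0 : 0 < L.+2%:R :> R by rewrite ltr0n.
(* The last piece of an equal division in [phi]-length is cut off; it is shorter than [d], and the
   rest falls under the induction hypothesis. *)
pose e := (phi y - phi x) / L.+2%:R.
have e0 : 0 < e by rewrite divr_gt0// (lt_le_trans d_gt0).
have ed : e < d by rewrite ltr_pdivrMr// mulrC.
have eE : phi y - phi x = e * L.+2%:R by rewrite mulfVK// gt_eqF.
pose z := psi (phi y - e).
have zE : phi z = phi y - e by exact: (ml_psiK S).
have L1 : 0 < L.+1%:R :> R by rewrite ltr0n.
have LE : L.+2%:R = L.+1%:R + 1 :> R by rewrite natr1.
have zy : z < y by apply: (phi_lt S); lra.
have xz : x < z by apply: (phi_lt S); rewrite zE; move: eE; rewrite LE; nra.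
have s1 := @arc_sum_le1 z y zy (ltac:(lra)).
have s2 := IH x z xz (ltac:(rewrite zE; move: eE; rewrite LE; nra)).
rewrite (eq_bigr (fun j => (iter j G y - iter j G z) + (iter j G z - iter j G x))).
  by rewrite big_split/= LE addrC lerD.
by move=> j _; ring.
Qed.

Lemma arc_sum3_le L n x y : x < y -> phi y - phi x < L.+1%:R * d -> (n <= 3 * N)%N ->
  \sum_(0 <= j < n) (iter j G y - iter j G x) <= (3 * L.+1)%:R.
Proof.
move=> xy D n3; apply: (@le_trans _ _ (\sum_(0 <= j < 3 * N) (iter j G y - iter j G x))).
  rewrite [leRHS](@big_cat_nat _ _ _ n)//= lerDl sumr_ge0// => j _.
  by rewrite subr_ge0 it_mono ltW.
have blk (k : nat) : \sum_(k * N <= j < k * N + N) (iter j G y - iter j G x) <= L.+1%:R.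
  rewrite -{1}(add0n (k * N)%N) big_addn addKn.
  rewrite (eq_bigr (fun j => iter j G (iter (k * N) G y) - iter j G (iter (k * N) G x))).
    by apply: arc_sum_le; rewrite ?it_mono_lt ?phi_iter_sub.
  by move=> j _; rewrite !iterD.
have b0 := blk 0%N; have b1 := blk 1%N; have b2 := blk 2%N.
rewrite (@big_cat_nat _ _ _ (2 * N))//=; last lia.
rewrite (@big_cat_nat _ _ _ (1 * N) 0 (2 * N))//=; last lia.
move: b0 b1 b2; rewrite mul0n add0n mul1n (_ : (2 * N + N = 3 * N)%N); last lia.
rewrite (_ : (N + N = 2 * N)%N); last lia.
by rewrite natrM; lra.
Qed.

Definition meets_break j x y : bool :=
  `[< exists k : int, iter j G x < p + k%:~R < iter j G y >].

(** A break in the image of time [j] shows up in [[phi x, phi y]] as the point [K j - j * rho].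
    These points are [d] apart, so each box of length [d] holds at most one of them. *)
Lemma meets_break_count1 L x y : phi y - phi x < L.+1%:R * d ->
  (count (fun j => meets_break j x y) (iota 0 N) <= L.+1)%N.
Proof.
move=> D; have [_ _ dmin _ _] := C.
have ex j : exists k : int, meets_break j x y -> iter j G x < p + k%:~R < iter j G y.
  by have [/asboolP[k h]|] := boolP (meets_break j x y); [exists k|exists 0].
pose K j := projT1 (cid (ex j)).
have KP j : meets_break j x y -> phi x <= (K j)%:~R - j%:R * rho <= phi y.
  move=> /(projT2 (cid (ex j)))/andP[/lt_phi + /lt_phi].
  by rewrite -/(K j) (phi_addz S) (ml_phi_p S) !(phi_iter S) => *; lra.
pose f j := Num.truncn (((K j)%:~R - j%:R * rho - phi x) / d).
rewrite -size_filter -(size_iota 0 L.+1) -(size_map f).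
apply: uniq_leq_size.
  rewrite map_inj_in_uniq ?filter_uniq ?iota_uniq// => i j.
  rewrite !mem_filter !mem_iota => /andP[/KP bi iN] /andP[/KP bj jN] fij.
  apply: contrapT => /eqP ij.
  have h1 : 0 <= ((K i)%:~R - i%:R * rho - phi x) / d by rewrite divr_ge0 ?(ltW d_gt0)//; lra.
  have h2 : 0 <= ((K j)%:~R - j%:R * rho - phi x) / d by rewrite divr_ge0 ?(ltW d_gt0)//; lra.
  have := truncn_itv h1; have := truncn_itv h2.
  rewrite -/(f i) -/(f j) fij !ler_pdivlMr// !ltr_pdivrMr// -natr1 mulrDl mul1r.
  move=> c1 c2.
  have c : `|i%:R * rho - j%:R * rho - (K i - K j)%:~R| < d.
    by rewrite intrB ltr_norml; lra.
  move: ij; rewrite neq_ltn => /orP[ij|ij].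
    have := dmin (j - i)%N (K j - K i) (ltac:(clear - ij iN jN; lia)).
    rewrite leNgt => /negP; apply; rewrite natrB 1?ltnW// -normrN.
    apply: le_lt_trans c; rewrite !intrB le_eqVlt; apply/orP; left; apply/eqP.
    by congr `|_|; ring.
  have := dmin (i - j)%N (K i - K j) (ltac:(clear - ij iN jN; lia)).
  rewrite leNgt => /negP; apply; rewrite natrB 1?ltnW//.
  by apply: le_lt_trans c; rewrite mulrBl.
move=> z /mapP[j]; rewrite mem_filter => /andP[/KP bj _] ->.
rewrite mem_iota/= add0n /f truncn_lt_nat ?ltr_pdivrMr//; first lra.
by rewrite divr_ge0 ?(ltW d_gt0)//; lra.
Qed.

Lemma meets_break_count L n x y : phi y - phi x < L.+1%:R * d -> (n <= 3 * N)%N ->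
  (count (fun j => meets_break j x y) (iota 0 n) <= 3 * L.+1)%N.
Proof.
move=> D n3.
have blk (k : nat) : (count (fun j => meets_break j x y) (iota (k * N) N) <= L.+1)%N.
  rewrite -[X in iota X]addn0 iotaDl count_map.
  rewrite (eq_count (a2 := fun j => meets_break j (iter (k * N) G x) (iter (k * N) G y))).
    by apply: meets_break_count1; rewrite phi_iter_sub.
  by move=> j; rewrite /= /meets_break addnC !iterD.
apply: (@leq_trans (count (fun j => meets_break j x y) (iota 0 (3 * N)))).
  by rewrite -[in leqRHS](subnKC n3) iotaD count_cat leq_addr.
have b0 := blk 0%N; have b1 := blk 1%N; have b2 := blk 2%N.
rewrite (_ : (3 * N = N + (N + N))%N); last lia.
rewrite !iotaD !count_cat add0n; move: b0 b1 b2.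
rewrite mul0n mul1n (_ : (2 * N = N + N)%N); last lia.
lia.
Qed.

End OrbitArcs.

(** * Distortion and break-free arcs *)

(* An arc of [phi]-length at most [8 d] has images of total length at most [27 = 3 * 9], and at most 27 of them meet
   the break, over three closest returns. *)
Definition distortion_const {R : realType} (sg : R) : R :=
  expR (54 * distortion_rate sg) * lip_const sg ^+ 54.

Definition nonlinearity {R : realType} (sg : R) : R := `|1 - sg| / Num.max sg 1.

(* Lower bound, relative to the length of the ambient arc, for the oscillation of [x |-> G^N x - x] on a break-free
   subarc occupying the proportion [b] of that arc. *)
Definition osc_const {R : realType} (sg b : R) : R :=
  let g := nonlinearity sg * b / distortion_const sg in g * b / (2 * (2 + g)).

Lemma distortion_const_gt0 {R : realType} (sg : R) : 0 < sg -> 0 < distortion_const sg.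
Proof.
move=> sg0; rewrite mulr_gt0 ?expR_gt0 ?exprn_gt0//.
exact: lt_le_trans ltr01 (lip_const_ge1 sg0).
Qed.

Lemma nonlinearity_gt0 {R : realType} (sg : R) : sg != 1 -> 0 < nonlinearity sg.
Proof.
move=> sg1; rewrite divr_gt0 ?normr_gt0 ?subr_eq0 1?eq_sym//.
by rewrite lt_max ltr01 orbT.
Qed.

Lemma osc_const_gt0 {R : realType} (sg b : R) : 0 < sg -> sg != 1 -> 0 < b ->
  0 < osc_const sg b.
Proof.
move=> sg0 sg1 b0; rewrite /osc_const.
have g0 : 0 < nonlinearity sg * b / distortion_const sg.
  apply: divr_gt0 (distortion_const_gt0 sg0).
  exact: mulr_gt0 (nonlinearity_gt0 sg1) b0.
apply: divr_gt0; first exact: mulr_gt0.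
by apply: mulr_gt0 => //; apply: addr_gt0.
Qed.

Lemma count_iotaS (P : pred nat) n :
  count P (iota 0 n.+1) = (count P (iota 0 n) + P n)%N.
Proof. by rewrite -addn1 iotaD count_cat add0n /= addn0. Qed.

Section Distortion.
Context {R : realType} (p sg rho : R) (G phi psi : R -> R).
Hypothesis S : moebius_lift p sg rho G phi psi.
Implicit Types (x y u v : R) (k : int).
Let lam := lip_const sg.
Let dlw := distortion_rate sg.
Let it_mono := iter_lift_mono (ml_incr S).
Let it_mono_lt := iter_lift_mono_lt (ml_incr S).
Let dlw0 : 0 <= dlw. Proof. exact: distortion_rate_ge0 (ml_sg_gt0 S). Qed.
Let lam_ge1 : 1 <= lam. Proof. exact: lip_const_ge1 (ml_sg_gt0 S). Qed.
Let lam_gt0 : 0 < lam. Proof. exact: lt_le_trans ltr01 lam_ge1. Qed.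

Let iter_le1 n x y : y <= x + 1 -> iter n G y <= iter n G x + 1.
Proof.
by move=> h; have := iter_liftDz (ml_per S) n x 1; rewrite mulr1z => <-; rewrite it_mono.
Qed.

Lemma not_meets_break n x y : ~~ meets_break p G n x y ->
  exists k, p + k%:~R <= iter n G x /\ iter n G y <= p + k%:~R + 1.
Proof.
move=> nb; exists (Num.floor (iter n G x - p)).
have := floor_itv (iter n G x - p); rewrite intrD => /andP[f1 f2]; split; first lra.
rewrite leNgt; apply/negP => h; move/asboolPn: nb; apply.
by exists (Num.floor (iter n G x - p) + 1); rewrite intrD; lra.
Qed.

(** Each iterate contributes one factor: [lift_quot_free] if the image avoids the break, and the
    crude [lam ^+ 2] if it meets it. *)
Lemma distortion_iter n x y u v u' v' : y <= x + 1 ->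
  x <= u -> u < v -> v <= y -> x <= u' -> u' < v' -> v' <= y ->
  (iter n G v - iter n G u) * (v' - u') <=
  expR (2 * dlw * \sum_(0 <= j < n) (iter j G y - iter j G x)) *
  (lam ^+ 2) ^+ (count (fun j => meets_break p G j x y) (iota 0 n)) *
  ((v - u) * (iter n G v' - iter n G u')).
Proof.
move=> yx xu uv vy xu' uv' vy'; elim: n => [|n IH].
  by rewrite big_geq// mulr0 expR0 expr0 !mul1r /= mulrC.
rewrite count_iotaS !iterS big_nat_recr// exprD (mulrDr (2 * dlw)) expRD.
set E := expR (2 * dlw * bigop _ _ _) in IH *; set M := _ ^+ count _ _ in IH *.
set A := iter n G v - iter n G u in IH; set A' := iter n G v' - iter n G u' in IH.
set B := G _ - G _; set B' := G _ - G (iter n G u').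
have A0 : 0 < A by rewrite subr_gt0 it_mono_lt.
have A'0 : 0 < A' by rewrite subr_gt0 it_mono_lt.
have B0 : 0 < B by rewrite subr_gt0 (lift_mono_lt (ml_incr S)) it_mono_lt.
have B'0 : 0 < B' by rewrite subr_gt0 (lift_mono_lt (ml_incr S)) it_mono_lt.
have E0 : 0 < E by exact: expR_gt0.
have M0 : 0 < M by rewrite !exprn_gt0.
have v'0 : 0 < v' - u' by rewrite subr_gt0.
have v0 : 0 < v - u by rewrite subr_gt0.
set e := expR (2 * dlw * (_ - _)); set m := _ ^+ nat_of_bool _.
have e0 : 0 < e by exact: expR_gt0.
have e1 : 1 <= e.
  rewrite /e -[leLHS]expR0 ler_expR; apply: mulr_ge0; first exact: (mulr_ge0 _ dlw0).
  by rewrite subr_ge0 it_mono; lra.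
have m1 : 1 <= m by rewrite exprn_ege1// exprn_ege1// lam_ge1.
have step : B * A' <= e * m * (A * B').
  have [mb|nmb] := boolP (meets_break p G n x y); last first.
    have [k [k1 k2]] := not_meets_break nmb.
    have := @lift_quot_free _ _ _ _ _ _ _ S k (iter n G x) (iter n G y)
      (iter n G u) (iter n G v) (iter n G u') (iter n G v').
    rewrite !it_mono !it_mono_lt => /(_ k1 k2 xu uv vy xu' uv' vy') h.
    by rewrite /m (negbTE nmb) expr0 mulr1.
  rewrite /m mb expr1.
  have uv1 : iter n G u <= iter n G v by rewrite it_mono ltW.
  have uv'1 : iter n G u' <= iter n G v' by rewrite it_mono ltW.
  have vu1 : iter n G v <= iter n G u + 1 by apply: iter_le1; lra.
  have vu'1 : iter n G v' <= iter n G u' + 1 by apply: iter_le1; lra.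
  have [l1 _] := lift_lip S uv1 vu1; have [_ l2] := lift_lip S uv'1 vu'1.
  apply: (@le_trans _ _ ((lam * A) * (lam * B'))).
    by apply: ler_pM => //; exact: ltW.
  rewrite (_ : lam * A * _ = lam ^+ 2 * (A * B')); last by ring.
  by rewrite -mulrA ler_peMl// !mulr_ge0// ?exprn_ge0// ltW.
rewrite -(ler_pM2l A'0).
have -> : A' * (B * (v' - u')) = (B * A') * (v' - u') by ring.
apply: (@le_trans _ _ (e * m * (A * B') * (v' - u'))); first by rewrite ler_pM2r.
have -> : e * m * (A * B') * (v' - u') = e * m * B' * (A * (v' - u')) by ring.
have -> : A' * (E * e * (M * m) * ((v - u) * B')) =
  e * m * B' * (E * M * ((v - u) * A')) by ring.
by rewrite ler_wpM2l// !mulr_ge0 ?ltW//; exact: lt_le_trans m1.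
Qed.

(** Whenever a break enters the current arc, the longer of the two pieces is kept. Lengths are
    measured at time 0, so a break costs a factor 2 whatever the distortion; one cut suffices
    because the image has length at most 1. *)
Lemma break_free_iter n x y : x < y -> y <= x + 1 ->
  exists u v, [/\ x <= u, u < v, v <= y,
    y - x <= 2 ^+ (count (fun j => meets_break p G j x y) (iota 0 n)) * (v - u) &
    forall j, (j < n)%N -> ~~ meets_break p G j u v].
Proof.
move=> xy yx; elim: n => [|n [u [v [xu uv vy h bf]]]].
  by exists x, y; split=> //; rewrite expr0 mul1r.
rewrite count_iotaS.
have sub u' v' : u <= u' -> v' <= v ->
    forall j, meets_break p G j u' v' -> meets_break p G j u v.
  move=> uu vv j /asboolP[k /andP[k1 k2]]; apply/asboolP; exists k.
  by rewrite (le_lt_trans _ k1) ?(lt_le_trans k2)// it_mono.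
have [mb|nmb] := boolP (meets_break p G n u v); last first.
  exists u, v; split=> //.
    apply: le_trans h _; rewrite ler_pM2r ?subr_gt0// ler_weXn2l//; first lra.
    exact: leq_addr.
  move=> j; rewrite ltnS leq_eqVlt => /orP[/eqP->//|]; exact: bf.
have mbxy : meets_break p G n x y.
  move/asboolP: mb => [k /andP[k1 k2]]; apply/asboolP; exists k.
  by rewrite (le_lt_trans _ k1) ?(lt_le_trans k2)// it_mono.
rewrite mbxy exprD expr1.
move/asboolP: mb => [k /andP[k1 k2]]; have [z zk] := iter_surj S n (p + k%:~R).
rewrite -zk !it_mono_lt in k1 k2.
have Gvu : iter n G v <= iter n G u + 1 by apply: iter_le1; lra.
have P0 : 0 < 2 ^+ count (fun j => meets_break p G j x y) (iota 0 n) :> R.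
  by rewrite exprn_gt0.
have bfS u' v' : u <= u' -> v' <= v -> ~~ meets_break p G n u' v' ->
    forall j, (j < n.+1)%N -> ~~ meets_break p G j u' v'.
  move=> uu vv nb j; rewrite ltnS leq_eqVlt => /orP[/eqP->//|/bf].
  by apply: contra => /sub; apply.
move: P0 h; set M := 2 ^+ _ => P0 h.
have [zz|zz] := leP (z - u) (v - z).
  exists z, v; split=> //; [lra| |].
    apply: le_trans h _; rewrite -mulrA ler_pM2l//; lra.
  apply: bfS => //; first exact: ltW.
  apply/negP => /asboolP[k' /andP[]]; rewrite zk ltrD2l ltr_int => kk k3.
  have : k%:~R + 1 <= k'%:~R :> R by rewrite -(intrD _ k 1) ler_int lezD1.
  have : iter n G u < p + k%:~R by rewrite -zk it_mono_lt.
  lra.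
exists u, z; split=> //; [lra| |].
  apply: le_trans h _; rewrite -mulrA ler_pM2l//; lra.
apply: bfS => //; first exact: ltW.
apply/negP => /asboolP[k' /andP[k3]]; rewrite zk ltrD2l ltr_int => kk.
have : k'%:~R + 1 <= k%:~R :> R by rewrite -(intrD _ k' 1) ler_int lezD1.
have : p + k%:~R < iter n G v by rewrite -zk it_mono_lt.
lra.
Qed.

Context (N : nat) (d s : R) (kN : int).
Hypothesis C : closest_return rho N d s kN.
Hypothesis d8 : 8 * d < 1.
Let Lam := distortion_const sg.
Let d_gt0 : 0 < d. Proof. by have [] := C. Qed.

Lemma short_arc_le1 x y : phi y - phi x <= 8 * d -> y <= x + 1.
Proof. by move=> h; apply/ltW/(phi_lt S); rewrite (ml_phi_per S); have := d8; lra. Qed.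

Let lt9 x y : phi y - phi x <= 8 * d -> phi y - phi x < 9 * d.
Proof. by move=> h; apply: le_lt_trans h _; rewrite ltr_pM2r// ltr_nat. Qed.

Lemma distortion n x y u v u' v' : phi y - phi x <= 8 * d -> (n <= 3 * N)%N ->
  x <= u -> u < v -> v <= y -> x <= u' -> u' < v' -> v' <= y ->
  (iter n G v - iter n G u) * (v' - u') <=
  Lam * ((v - u) * (iter n G v' - iter n G u')).
Proof.
move=> D n3 xu uv vy xu' uv' vy'.
apply: le_trans (distortion_iter n (short_arc_le1 D) xu uv vy xu' uv' vy') _.
have xy : x < y by lra.
rewrite ler_wpM2r//; first by rewrite mulr_ge0// subr_ge0 ?it_mono ltW.
rewrite /Lam /distortion_const; apply: ler_pM.
- exact: expR_ge0.
- by rewrite !exprn_ge0// ltW.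
- rewrite ler_expR (_ : 54 * _ = 2 * dlw * 27); last by rewrite /dlw; ring.
  apply: ler_wpM2l; first by rewrite mulr_ge0// dlw0.
  by have := arc_sum3_le S C xy (lt9 D) n3.
- rewrite -exprM ler_weXn2l//.
  rewrite -[leqRHS]/(2 * 27)%N leq_pmul2l//.
  exact: leq_trans (meets_break_count S C (lt9 D) n3) _.
Qed.

Lemma break_free_subarc x y : x < y -> phi y - phi x <= 8 * d ->
  exists u v, [/\ x < u, u < v, v < y, y - x <= 2 ^+ 28 * (v - u) &
    forall j, (j < 3 * N)%N ->
      exists k, p + k%:~R < iter j G u /\ iter j G v < p + k%:~R + 1].
Proof.
move=> xy D; have [u [v [xu uv vy h bf]]] := break_free_iter (3 * N) xy (short_arc_le1 D).
have c27 := meets_break_count S C (lt9 D) (leqnn (3 * N)).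
(* Removing a quarter at each end makes all inclusions strict; this halves the arc and turns the
   exponent 27 into 28. *)
exists (u + (v - u) / 4), (v - (v - u) / 4); split; [lra|lra|lra| |].
  have : y - x <= 2 ^+ 27 * (v - u).
    apply: le_trans h _; rewrite ler_pM2r ?subr_gt0// ler_weXn2l//.
    lra.
  rewrite (exprS _ 27); move: (2 ^+ 27) => z; lra.
move=> j jN; have [k [k1 k2]] := not_meets_break (bf _ jN).
exists k; split; [apply: le_lt_trans k1 _|apply: lt_le_trans k2].
  by rewrite it_mono_lt; lra.
by rewrite it_mono_lt; lra.
Qed.

(** The images of the inner arc have total length at least 1, those of the outer arc at most 9;
    bounded distortion carries this comparison back to time 0. *)
Lemma arc_comparable x y x' y' : x <= x' -> y' <= y ->
  2 * d <= phi y' - phi x' -> phi y - phi x <= 8 * d ->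
  y - x <= 9 * Lam * (y' - x').
Proof.
move=> xx yy D' D.
have x'y' : x' < y' by apply: (phi_lt S); have := d_gt0; lra.
have xy : x < y by lra.
have s1 := arc_sum_ge1 S C D'; have s9 := arc_sum_le S C xy (lt9 D).
have Lam0 : 0 < Lam := distortion_const_gt0 (ml_sg_gt0 S).
apply: (@le_trans _ _ ((y - x) * \sum_(0 <= j < N) (iter j G y' - iter j G x'))).
  by rewrite ler_peMr// subr_ge0 ltW.
apply: (@le_trans _ _ (Lam * (y' - x') * \sum_(0 <= j < N) (iter j G y - iter j G x))).
  rewrite !mulr_sumr; apply: ler_sum_nat => j /andP[_ jN].
  rewrite [leLHS]mulrC -[leRHS]mulrA; apply: (distortion D) => //.
  exact: leq_trans (ltnW jN) (leq_pmull _ _).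
rewrite [leRHS](_ : _ = Lam * (y' - x') * 9); last by ring.
by rewrite ler_wpM2l// mulr_ge0 ?subr_ge0 ?(ltW Lam0) ?(ltW x'y').
Qed.

(* On a break-free arc the ratio of the difference quotients of [G^n] over the two halves is a product of
   quotients [w (G^j v) / w (G^j u)], all on the same side of 1. *)
Let halves_ratio n u v t : u < t -> t < v ->
  (forall j, (j < n)%N -> exists k, p + k%:~R < iter j G u /\ iter j G v < p + k%:~R + 1) ->
  let g := 1 + nonlinearity sg * \sum_(0 <= j < n) (iter j G v - iter j G u) in
  if sg < 1 then
    g * ((t - u) * (iter n G v - iter n G t)) <= (iter n G t - iter n G u) * (v - t)
  else
    g * ((v - t) * (iter n G t - iter n G u)) <= (iter n G v - iter n G t) * (t - u).
Proof.
move=> ut tv; elim: n => [|n IH] bf /=.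
  by rewrite big_geq// mulr0 addr0 !mul1r; case: ifP => _; rewrite mulrC.
have {}IH := IH (fun j jn => bf j (ltnW jn)).
have [k [k1 k2]] := bf n (ltnSn n).
rewrite big_nat_recr//=.
have ut' : iter n G u < iter n G t by rewrite it_mono_lt.
have tv' : iter n G t < iter n G v by rewrite it_mono_lt.
have := @ml_moebius _ _ _ _ _ _ _ S k (iter n G u) (iter n G t)
  (ltac:(lra)) (ltac:(lra)) (ltac:(lra)).
have := @ml_moebius _ _ _ _ _ _ _ S k (iter n G t) (iter n G v)
  (ltac:(lra)) (ltac:(lra)) (ltac:(lra)).
set wu := sg + _ * (iter n G u - _ - _); set wt := sg + _ * (iter n G t - _ - _).
set wv := sg + _ * (iter n G v - _ - _).
move=> e2 e1.
have sg0 := ml_sg_gt0 S; have sg1 := ml_sg_neq1 S.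
have wE : wv - wu = (1 - sg) * (iter n G v - iter n G u) by rewrite /wv /wu; ring.
set Sm := \sum_(0 <= j < n) _ in IH *.
have Sm0 : 0 <= Sm.
  by apply: sumr_ge0 => j _; rewrite subr_ge0 it_mono ltW// (lt_trans ut).
have nl0 := nonlinearity_gt0 sg1.
set A := iter n G t - iter n G u in IH e1; set B := iter n G v - iter n G t in IH e2.
set A' := G (iter n G t) - _ in e1 *; set B' := G (iter n G v) - _ in e2 *.
have A0 : 0 < A by rewrite subr_gt0.
have B0 : 0 < B by rewrite subr_gt0.
have A'0 : 0 < A' by rewrite subr_gt0 (ml_incr S).
have B'0 : 0 < B' by rewrite subr_gt0 (ml_incr S).
have lE : iter n G v - iter n G u = A + B by rewrite /A /B; ring.
rewrite lE in wE *; set l := A + B in wE *.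
have wpos x : p + k%:~R < x -> x < p + k%:~R + 1 ->
    0 < sg + (1 - sg) * (x - k%:~R - p) /\ sg + (1 - sg) * (x - k%:~R - p) <= Num.max sg 1.
  move=> h1 h2; have [] : 0 < x - k%:~R - p /\ x - k%:~R - p < 1 by split; lra.
  move: (x - _ - p) => z z0 z1; rewrite maxElt.
  have a1 : 0 < sg * (1 - z) by rewrite mulr_gt0// subr_gt0.
  case: (ltP sg 1) => h; split; try lra.
    have : 0 <= (1 - sg) * (1 - z) by apply: mulr_ge0; lra.
    lra.
  have : 0 <= (sg - 1) * z by apply: mulr_ge0; lra.
  lra.
have [wu0 wum] := wpos (iter n G u) (ltac:(lra)) (ltac:(lra)).
have [wv0 wvm] := wpos (iter n G v) (ltac:(lra)) (ltac:(lra)).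
have [wt0 wtm] := wpos (iter n G t) (ltac:(lra)) (ltac:(lra)).
rewrite -/wu -/wv -/wt in wu0 wum wv0 wvm wt0 wtm.
have l0 : 0 < l by rewrite addr_gt0.
have max0 : 0 < Num.max sg 1 by rewrite lt_max ltr01 orbT.
(* In the quotient of the two Moebius identities the weight at the middle point cancels, leaving
   only the weights at the ends. *)
have cross : B * A' * wu = A * B' * wv.
  have : sg * (B * A' * wu) * wt = sg * (A * B' * wv) * wt.
    rewrite (_ : sg * (B * A' * wu) * wt = A' * (wu * wt) * (sg * B)); last by ring.
    by rewrite e1 -e2; ring.
  move/(mulIf (lt0r_neq0 wt0)); exact: mulfI (lt0r_neq0 sg0) _ _.
have bign : 1 + nonlinearity sg * (Sm + l) <=
    (1 + nonlinearity sg * Sm) * (1 + nonlinearity sg * l).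
  by have := mulr_ge0 (mulr_ge0 (ltW nl0) Sm0) (mulr_ge0 (ltW nl0) (ltW l0)); lra.
have t0 : 0 < t - u by rewrite subr_gt0.
have v0 : 0 < v - t by rewrite subr_gt0.
set g := 1 + nonlinearity sg * Sm in IH bign *.
set h := 1 + nonlinearity sg * l in bign *.
have g0 : 0 < g by rewrite ltr_wpDr// mulr_ge0// ltW.
have h0 : 0 < h by rewrite ltr_wpDr// mulr_ge0// ltW.
move: IH; case: ifPn => sgl IH.
  have wh : h * wu <= wv.
    have : nonlinearity sg * l * wu <= (1 - sg) * l.
      rewrite (_ : _ * l * wu = (1 - sg) * l * (wu / Num.max sg 1)); last first.
        by rewrite /nonlinearity gtr0_norm ?subr_gt0//; ring.
      rewrite ler_piMr ?ler_pdivrMr ?mul1r// mulr_ge0 ?(ltW l0)// subr_ge0; exact: ltW.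
    by rewrite -wE /h; lra.
  have step : h * (A * B') <= B * A'.
    rewrite -(ler_pM2r wu0) cross (_ : h * (A * B') * wu = A * B' * (h * wu)); last by ring.
    by rewrite ler_pM2l// mulr_gt0.
  apply: (@le_trans _ _ (g * h * ((t - u) * B'))).
    by rewrite ler_wpM2r// mulr_ge0// ltW.
  rewrite -(ler_pM2l (mulr_gt0 A0 B0)).
  rewrite (_ : A * B * (g * h * _) = (g * ((t - u) * B)) * (h * (A * B'))); last by ring.
  rewrite (_ : A * B * _ = A * (v - t) * (B * A')); last by ring.
  by apply: ler_pM => //; rewrite !mulr_ge0// ltW.
have sgg : 1 < sg by rewrite lt_neqAle eq_sym sg1 leNgt.
have wh : h * wv <= wu.
  have : nonlinearity sg * l * wv <= (sg - 1) * l.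
    rewrite (_ : _ * l * wv = (sg - 1) * l * (wv / Num.max sg 1)); last first.
      by rewrite /nonlinearity distrC gtr0_norm ?subr_gt0//; ring.
    rewrite ler_piMr ?ler_pdivrMr ?mul1r// mulr_ge0 ?(ltW l0)// subr_ge0; exact: ltW.
  by move: wE; rewrite /h; lra.
have step : h * (B * A') <= A * B'.
  rewrite -(ler_pM2r wv0) -cross (_ : h * (B * A') * wv = B * A' * (h * wv)); last by ring.
  by rewrite ler_pM2l// mulr_gt0.
apply: (@le_trans _ _ (g * h * ((v - t) * A'))).
  by rewrite ler_wpM2r// mulr_ge0// ltW.
rewrite -(ler_pM2l (mulr_gt0 A0 B0)).
rewrite (_ : A * B * (g * h * _) = (g * ((v - t) * A)) * (h * (B * A'))); last by ring.
rewrite (_ : A * B * _ = B * (t - u) * (A * B')); last by ring.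
by apply: ler_pM => //; rewrite !mulr_ge0// ltW.
Qed.

(** If the displacements at [u], at the midpoint and at [v] were nearly equal, the two halves would
    have images of nearly equal length, against [halves_ratio]. *)
Lemma displacement_osc x y u v b : 0 < b -> b * (y - x) <= v - u ->
  x <= u -> u < v -> v <= y ->
  2 * d <= phi y - phi x -> phi y - phi x <= 8 * d ->
  (forall j, (j < 3 * N)%N -> exists k, p + k%:~R < iter j G u /\ iter j G v < p + k%:~R + 1) ->
  exists t t', [/\ u <= t <= v, u <= t' <= v &
    osc_const sg b * (y - x) <= `|(iter N G t - t) - (iter N G t' - t')|].
Proof.
move=> b0 byx xu uv vy D1 D2 bf.
have xy : x < y by lra.
have Lam0 : 0 < Lam := distortion_const_gt0 (ml_sg_gt0 S).
have nl0 := nonlinearity_gt0 (ml_sg_neq1 S).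
set t := (u + v) / 2.
(* The images of [[x, y]] have total length at least 1 and distortion passes a fixed share on to
   [[u, v]]; so the accumulated nonlinearity has a lower bound free of the scale. *)
have sumge : b <= Lam * \sum_(0 <= j < N) (iter j G v - iter j G u).
  have yx0 : 0 < y - x by rewrite subr_gt0.
  rewrite -(ler_pM2r yx0); apply: le_trans byx _.
  apply: (@le_trans _ _ ((v - u) * \sum_(0 <= j < N) (iter j G y - iter j G x))).
    by rewrite ler_peMr ?(arc_sum_ge1 S C)// subr_ge0 ltW.
  rewrite (_ : _ * (y - x) = \sum_(0 <= j < N) Lam * ((y - x) * (iter j G v - iter j G u))).
    rewrite mulrC mulr_suml; apply: ler_sum_nat => j /andP[_ jN].
    apply: (distortion D2) => //; exact: leq_trans (ltnW jN) (leq_pmull _ _).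
  by rewrite -!mulr_sumr; ring.
have bfN j : (j < N)%N -> exists k, p + k%:~R < iter j G u /\ iter j G v < p + k%:~R + 1.
  by move=> jN; apply: bf; apply: leq_trans jN (leq_pmull _ _).
have := @halves_ratio N u v t (ltac:(rewrite /t; lra)) (ltac:(rewrite /t; lra)) bfN.
set Sm := \sum_(0 <= j < N) _ in sumge *; move=> /= HR.
rewrite /osc_const; set g := nonlinearity sg * b / _.
have g0 : 0 < g by apply: divr_gt0 => //; apply: mulr_gt0.
have gS : g <= nonlinearity sg * Sm.
  rewrite /g ler_pdivrMr//; apply: le_trans (_ : nonlinearity sg * (Lam * Sm) <= _).
    by apply: ler_wpM2l sumge; exact: ltW.
  by rewrite mulrCA mulrC.
pose h := t - u; have vt : v - t = h by rewrite /h /t; lra.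
have h0 : 0 < h by rewrite /h /t; lra.
have tI : u <= t <= v by rewrite /t; lra.
have uI : u <= u <= v by rewrite lexx ltW.
have vI : u <= v <= v by rewrite lexx ltW.
set A := iter N G t - iter N G u in HR; set B := iter N G v - iter N G t in HR.
have A0 : 0 < A by rewrite subr_gt0 it_mono_lt /t; lra.
have B0 : 0 < B by rewrite subr_gt0 it_mono_lt /t; lra.
(* The solution of [(1 + g) * (h - et) = h + et]: two lengths within [et] of [h] have a ratio below
   [1 + g]. *)
pose et := g * h / (2 + g).
have etE : et * (2 + g) = g * h by rewrite /et mulfVK// gt_eqF; lra.
have cle : g * b / (2 * (2 + g)) * (y - x) <= et.
  rewrite /et ler_pdivlMr; last lra.
  rewrite (_ : g * b / (2 * (2 + g)) * (y - x) * (2 + g) = g / 2 * (b * (y - x))).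
    have -> : g * h = g / 2 * (v - u) by rewrite /h /t; field.
    by apply: ler_wpM2l => //; lra.
  by field; rewrite gt_eqF; lra.
have [l1|l1] := lerP et `|(iter N G t - t) - (iter N G u - u)|.
  by exists t, u; split=> //; exact: le_trans l1.
have [l2|l2] := lerP et `|(iter N G v - v) - (iter N G t - t)|.
  by exists v, t; split=> //; exact: le_trans l2.
exfalso.
move: l1 l2; rewrite !ltr_norml.
rewrite (_ : iter N G t - t - _ = A - h); last by rewrite /A /h; ring.
rewrite (_ : iter N G v - v - _ = B - h); last by rewrite /B -vt; ring.
move=> /andP[a1 a2] /andP[b1 b2].
have key X Y : 0 < X -> (1 + nonlinearity sg * Sm) * (h * X) <= Y * h ->
    X - h > - et -> Y - h < et -> False.
  move=> X0; rewrite mulrCA (mulrC Y) ler_pM2l// => k1 k2 k3.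
  have : (1 + g) * X <= Y by apply: le_trans k1; rewrite ler_pM2r// lerD2l.
  have : (1 + g) * (h - et) < (1 + g) * X by rewrite ltr_pM2l; lra.
  lra.
by move: HR; rewrite vt -/h; case: ifP => _ HR; [apply: (key B A)|apply: (key A B)].
Qed.

End Distortion.

(** * Growth of the sums of squares *)

Lemma sum_nat_mul {R : nmodType} (F : nat -> R) (K M : nat) :
  \sum_(0 <= j < K * M) F j = \sum_(0 <= k < K) \sum_(0 <= i < M) F (k * M + i)%N.
Proof.
elim: K => [|K IH]; first by rewrite mul0n !big_geq.
rewrite mulSnr big_nat_recr//= (@big_cat_nat _ _ _ (K * M))//= ?leq_addr// IH.
congr (_ + _); rewrite -{1}(add0n (K * M)%N) big_addn addKn.
by apply: eq_bigr => i _; rewrite addnC.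
Qed.

Lemma sum_sq_le {R : realDomainType} (n : nat) (L : nat -> R) :
  (forall j, (j < n)%N -> 0 <= L j) ->
  \sum_(0 <= j < n) L j ^+ 2 <= (\sum_(0 <= j < n) L j) ^+ 2.
Proof.
elim: n => [|n IH] L0; first by rewrite !big_geq// expr0n.
rewrite !big_nat_recr//= sqrrD.
have := IH (fun j jn => L0 j (ltnW jn)); have := L0 n (ltnSn n).
have : 0 <= \sum_(0 <= j < n) L j.
  by rewrite big_nat; apply: sumr_ge0 => j /andP[_ jn]; apply: L0; exact: ltnW.
move=> s0 l0 h; have := mulr_ge0 s0 l0; lra.
Qed.

(* If refining a partition raises the mean square by a factor at most [1 + r e^2], every piece is close to the
   average of its cell. *)
Lemma variance_gap {R : realFieldType} (M r : nat) (L : nat -> R) (a : nat -> nat -> R) (e : R) :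
  (0 < r)%N -> 0 < e ->
  (forall j, (j < M)%N -> 0 <= L j) ->
  (forall j, (j < M)%N -> \sum_(0 <= i < r) a j i = L j) ->
  \sum_(0 <= j < M) \sum_(0 <= i < r) a j i ^+ 2 <
    (1 + r%:R * e ^+ 2) / r%:R * \sum_(0 <= j < M) L j ^+ 2 ->
  forall j i, (j < M)%N -> (i < r)%N ->
    `|a j i - L j / r%:R| <= e * \sum_(0 <= j < M) L j.
Proof.
move=> r0 e0 L0 aL h j i jM ir.
have rR : 0 < r%:R :> R by rewrite ltr0n.
have I0 : 0 <= \sum_(0 <= j < M) L j.
  by rewrite big_nat; apply: sumr_ge0 => k /andP[_ /L0].
rewrite leNgt; apply/negP => gt.
have sq : (e * \sum_(0 <= j < M) L j) ^+ 2 < (a j i - L j / r%:R) ^+ 2.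
  by rewrite -[ltRHS]real_normK ?num_real// ltr_pXn2r// nnegrE mulr_ge0// ltW.
have expand k : (k < M)%N -> \sum_(0 <= i < r) (a k i - L k / r%:R) ^+ 2 =
    \sum_(0 <= i < r) a k i ^+ 2 - L k ^+ 2 / r%:R.
  move=> kM; rewrite (eq_bigr (fun i => a k i ^+ 2 - 2 * (L k / r%:R) * a k i + (L k / r%:R) ^+ 2)).
    rewrite big_split/= sumrB -mulr_sumr aL// sumr_const_nat subn0 -mulr_natl.
    by field; rewrite gt_eqF.
  by move=> l _; ring.
have tot : \sum_(0 <= k < M) \sum_(0 <= i < r) (a k i - L k / r%:R) ^+ 2 =
    \sum_(0 <= k < M) \sum_(0 <= i < r) a k i ^+ 2 - (\sum_(0 <= k < M) L k ^+ 2) / r%:R.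
  by rewrite mulr_suml -sumrB; apply: eq_big_nat => k /andP[_ /expand].
have one : (a j i - L j / r%:R) ^+ 2 <=
    \sum_(0 <= k < M) \sum_(0 <= i < r) (a k i - L k / r%:R) ^+ 2.
  rewrite (bigD1_seq j) ?iota_uniq ?mem_index_iota//=.
  rewrite (bigD1_seq i (r := index_iota 0 r)) ?iota_uniq ?mem_index_iota//=.
  rewrite -addrA lerDl addr_ge0//; first by apply: sumr_ge0 => *; exact: sqr_ge0.
  by apply: sumr_ge0 => k _; apply: sumr_ge0 => l _; exact: sqr_ge0.
have := sum_sq_le L0; set A := \sum_(0 <= j < M) L j ^+ 2 in h tot *; move=> AI.
have : (1 + r%:R * e ^+ 2) / r%:R * A = A / r%:R + e ^+ 2 * A by field; rewrite gt_eqF.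
have : e ^+ 2 * A <= e ^+ 2 * (\sum_(0 <= j < M) L j) ^+ 2 by rewrite ler_wpM2l// sqr_ge0.
rewrite exprMn in sq; lra.
Qed.

Definition cell_sq {R : realType} (psi : R -> R) (y t : R) (n : nat) : R :=
  \sum_(0 <= j < n) (psi (y + j.+1%:R * t) - psi (y + j%:R * t)) ^+ 2.

Lemma cell_sq_mul {R : realType} (psi : R -> R) (y t : R) (K M : nat) :
  cell_sq psi y t (K * M) =
  \sum_(0 <= k < K) cell_sq psi (y + k%:R * (M%:R * t)) t M.
Proof.
rewrite /cell_sq sum_nat_mul; apply: eq_bigr => k _; apply: eq_bigr => i _.
by congr ((psi _ - psi _) ^+ 2); rewrite ?mulrSr ?natrD ?natrM; ring.
Qed.

Lemma telescope_cells {R : realType} (psi : R -> R) (y t : R) (n : nat) :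
  \sum_(0 <= j < n) (psi (y + j.+1%:R * t) - psi (y + j%:R * t)) =
  psi (y + n%:R * t) - psi y.
Proof.
by rewrite (telescope_sumr (fun j : nat => psi (y + j%:R * t)))// mul0r addr0.
Qed.

(** Removing margins of measure [d] from a tile costs [9 * distortion_const sg], and passing to a
    break-free arc costs [2 ^+ 28]. The division by 4 leaves half of the oscillation as a
    displacement at one point, and half of that displacement in one of two cells. *)
Definition tile_osc1 {R : realType} (sg : R) : R :=
  osc_const sg (9 * distortion_const sg * 2 ^+ 28)^-1 / 4.

(** The middle half of a long cell keeps at least a quarter of its length, and its break-free arc
    costs another [2 ^+ 28]; hence the exponent 30. *)
Definition tile_osc2 {R : realType} (sg : R) : R :=
  osc_const sg (tile_osc1 sg / 2 ^+ 30).

Lemma tile_osc1_gt0 {R : realType} (sg : R) : 0 < sg -> sg != 1 -> 0 < tile_osc1 sg.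
Proof.
move=> sg0 sg1; apply: divr_gt0 => //; apply: osc_const_gt0 => //.
rewrite invr_gt0; apply: mulr_gt0; last by rewrite exprn_gt0.
by apply: mulr_gt0 => //; exact: distortion_const_gt0.
Qed.

Lemma tile_osc2_gt0 {R : realType} (sg : R) : 0 < sg -> sg != 1 -> 0 < tile_osc2 sg.
Proof.
move=> sg0 sg1; apply: osc_const_gt0 => //; apply: divr_gt0; last by rewrite exprn_gt0.
exact: tile_osc1_gt0.
Qed.

(** * A tile of measure between [4 * d] and [8 * d] whose cells are all cut evenly is impossible *)

Section Tile.
Context {R : realType} (p sg rho : R) (G phi psi : R -> R).
Hypothesis S : moebius_lift p sg rho G phi psi.
Context (N : nat) (d s : R) (kN : int).
Hypothesis C : closest_return rho N d s kN.
Hypothesis d8 : 8 * d < 1.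
Context (y t : R) (M r : nat).
Hypotheses (t_gt0 : 0 < t) (st : `|s| <= t / 8).
Hypotheses (MtL : 4 * d <= M%:R * t) (MtU : M%:R * t <= 8 * d).
Implicit Types (x u v : R) (k : int).

Let I := psi (y + M%:R * t) - psi y.
Let L (j : nat) := psi (y + j.+1%:R * t) - psi (y + j%:R * t).
Let c3 := tile_osc1 sg.
Let d_gt0 : 0 < d. Proof. by have [] := C. Qed.
Let psiK := ml_psiK S.
Let it_mono_lt := iter_lift_mono_lt (ml_incr S).

Let P x := iter N G x - kN%:~R.

Let phi_P x : phi (P x) = phi x + s.
Proof.
have [_ _ _ _ [Ns _]] := C.
by rewrite /P -mulrNz (phi_addz S) (phi_iter S) Ns mulrNz; ring.
Qed.

Let I_gt0 : 0 < I.
Proof. by rewrite subr_gt0; apply: (psi_lt S); have := d_gt0; have := MtL; lra. Qed.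

Let c1 := 4 * c3.

(** An oscillation of [4 * c3 * I] forces a displacement of half that size at one of the two points.
    The margins [d] keep [P x] inside the tile, since [|s| < d]. *)
Let big_displacement : exists x,
  [/\ y + d <= phi x, phi x <= y + M%:R * t - d & 2 * c3 * I <= `|P x - x|].
Proof.
have dd := d_gt0; have mL := MtL; have mU := MtU.
pose x0 := psi y; pose x1 := psi (y + M%:R * t).
pose x0' := psi (y + d); pose x1' := psi (y + M%:R * t - d).
have e0 : phi x0 = y by exact: psiK.
have e1 : phi x1 = y + M%:R * t by exact: psiK.
have e0' : phi x0' = y + d by exact: psiK.
have e1' : phi x1' = y + M%:R * t - d by exact: psiK.
have o0 : x0 < x0' by apply: (phi_lt S); lra.
have o1 : x1' < x1 by apply: (phi_lt S); lra.
have o2 : x0' < x1' by apply: (phi_lt S); lra.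
have cmp := arc_comparable S C d8 (ltW o0) (ltW o1) (ltac:(lra)) (ltac:(lra)).
have [u [v [xu uv vx bl bf]]] := break_free_subarc S C d8 o2 (ltac:(lra)).
have Lam0 := distortion_const_gt0 (ml_sg_gt0 S).
pose b := (9 * distortion_const sg * 2 ^+ 28)^-1.
have K0 : 0 < 9 * distortion_const sg * 2 ^+ 28.
  by apply: mulr_gt0; [exact: mulr_gt0|rewrite exprn_gt0].
have b0 : 0 < b by rewrite invr_gt0.
have bI : b * (x1 - x0) <= v - u.
  rewrite /b ler_pdivrMl//; apply: le_trans cmp _.
  by rewrite -[leRHS]mulrA ler_pM2l// mulr_gt0.
have [w [w' [/andP[uw wv] /andP[uw' wv'] osc]]] :=
  displacement_osc S C d8 b0 bI (ltac:(lra)) uv (ltac:(lra)) (ltac:(lra)) (ltac:(lra)) bf.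
have cE : osc_const sg b = 4 * c3 by rewrite /c3 /tile_osc1 -/b mulrC divfK.
have inI z : u <= z -> z <= v -> y + d <= phi z /\ phi z <= y + M%:R * t - d.
  move=> uz zv; rewrite -e0' -e1'; split; apply: (ml_phi_homo S); lra.
have [h|h] := lerP (2 * c3 * I) `|P w - w|.
  by have [a1 a2] := inI _ uw wv; exists w; split=> //; lra.
have [h'|h'] := lerP (2 * c3 * I) `|P w' - w'|.
  by have [a1 a2] := inI _ uw' wv'; exists w'; split=> //; lra.
exfalso; move: osc; rewrite leNgt => /negP; apply.
rewrite (_ : _ - (_ - w') = (P w - w) - (P w' - w')); last by rewrite /P; ring.
apply: le_lt_trans (ler_normB _ _) _; rewrite cE -/I; lra.
Qed.

(** The arc between [x] and [P x] has measure at most [t / 8], so two consecutive cells cover it and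
    one of them has half of its length. *)
Let big_cell : exists2 j, (j < M)%N & c3 * I <= L j.
Proof.
have [x [xl xu disp]] := big_displacement.
have dd := d_gt0; have st' := st; have tt := t_gt0.
have [_ _ _ _ [_ sd]] := C.
pose lo := Num.min x (P x); pose hi := Num.max x (P x).
have [lohi [flo1 flo2] [fhi1 fhi2]] : [/\ `|P x - x| = hi - lo,
   y < phi lo /\ phi lo < y + M%:R * t &
   phi hi < y + M%:R * t /\ phi hi <= phi lo + t / 8].
  move: sd st'; rewrite !ltr_norml ler_norml => /andP[a1 a2] /andP[a3 a4].
  have fP := phi_P x.
  have [h|h] := leP x (P x).
    rewrite /hi /lo max_r// min_l// ger0_norm ?subr_ge0//.
    have := ml_phi_homo S h; split=> //; split; lra.
  rewrite /hi /lo (max_l (ltW h)) (min_r (ltW h)) ltr0_norm ?subr_lt0// opprB.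
  have := ml_phi_homo S (ltW h); split=> //; split; lra.
have q0 : 0 < (phi lo - y) / t by rewrite divr_gt0// subr_gt0.
have [j [jlo jhi]] : exists j : nat, j%:R * t < phi lo - y /\ phi lo - y <= j.+1%:R * t.
  have := ceil_itv ((phi lo - y) / t); case: (Num.ceil _) => [[|n]|n].
  - by rewrite mulr0z => /andP[_]; lra.
  - rewrite -[n.+1%:Z - 1]/(n.+1%:Z + (-1)) intrD -!pmulrn => /andP[h1 h2].
    exists n; move: h1 h2; rewrite -natr1 ltr_pdivlMr// ler_pdivrMr// => h1 h2.
    by split=> //; apply: le_lt_trans h1; rewrite ler_pM2r//; lra.
  - rewrite NegzE mulrNz => /andP[_]; have : 0 <= n.+1%:~R :> R by rewrite ler0z.
    lra.
have jS : j.+2%:R * t = j.+1%:R * t + t by rewrite -[j.+2%:R]natr1 mulrDl mul1r.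
have jM : (j < M)%N.
  by rewrite -(ltr_nat R) -(ltr_pM2r tt); lra.
have lolow : psi (y + j%:R * t) < lo by apply: (phi_lt S); rewrite psiK; lra.
have hi2 : hi < psi (y + j.+2%:R * t).
  by apply: (phi_lt S); rewrite psiK jS; lra.
have hiM : hi < psi (y + M%:R * t) by apply: (phi_lt S); rewrite psiK.
have [jM'|jM'] := ltnP j.+1 M; last first.
  (* In the last cell of the tile there is no successor, but the arc ends before the tile does, so
     this cell alone covers it. *)
  have jE : M = j.+1 by apply/eqP; rewrite eqn_leq jM' jM.
  exists j => //; rewrite /L -jE; have := I_gt0; rewrite jE in hiM.
  have c30 : 0 < c3 by apply: tile_osc1_gt0; [exact: ml_sg_gt0 S|exact: ml_sg_neq1 S].
  move=> I0; have := mulr_gt0 c30 I0; rewrite -jE in hiM; lra.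
have [h|h] := leP (c3 * I) (L j); first by exists j.
by exists j.+1 => //; move: h disp; rewrite /L; lra.
Qed.

Hypothesis r24 : (24 <= r)%N.
Hypothesis rc : 12 < r%:R * tile_osc2 sg.

Let a (j i : nat) :=
  psi (y + (j * r + i).+1%:R * (t / r%:R)) - psi (y + (j * r + i)%:R * (t / r%:R)).

Let r_gt0 : 0 < r%:R :> R. Proof. by rewrite ltr0n; exact: leq_trans r24. Qed.

Hypothesis even : forall j i, (j < M)%N -> (i < r)%N ->
  `|a j i - L j / r%:R| <= c3 / r%:R ^+ 2 * I.

(** The tolerance [c3 / r ^ 2] in [even] is made for this: on a cell of length at least [c3 * I],
    even [r] accumulated errors stay below one average piece. *)
Let sub_partial j i : (j < M)%N -> c3 * I <= L j -> (i <= r)%N ->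
  `|psi (y + j%:R * t + i%:R * (t / r%:R)) - psi (y + j%:R * t) - i%:R * L j / r%:R| <= L j / r%:R.
Proof.
move=> jM Lj ir; have rr := r_gt0.
have L0 : 0 <= L j by rewrite subr_ge0; apply: (psi_le S); rewrite lerD2l ler_pM2r// ler_nat.
have -> : psi (y + j%:R * t + i%:R * (t / r%:R)) - psi (y + j%:R * t) = \sum_(0 <= l < i) a j l.
  rewrite -(telescope_cells psi (y + j%:R * t) (t / r%:R) i); apply: eq_bigr => l _.
  by rewrite /a; congr (psi _ - psi _); rewrite ?mulrSr ?natrD ?natrM; field; rewrite gt_eqF.
have -> : i%:R * L j / r%:R = \sum_(0 <= l < i) (L j / r%:R).
  by rewrite sumr_const_nat subn0 -[RHS]mulr_natl mulrA.
rewrite -sumrB; apply: le_trans (ler_norm_sum _ _ _) _.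
apply: (@le_trans _ _ (\sum_(0 <= l < i) (L j / r%:R ^+ 2))).
  apply: ler_sum_nat => l /andP[_ li].
  apply: le_trans (even jM (leq_trans li ir)) _.
  by rewrite mulrAC ler_wpM2r// invr_ge0 exprn_ge0// ltW.
rewrite sumr_const_nat subn0 -[leLHS]mulr_natl.
rewrite (_ : L j / r%:R = r%:R * (L j / r%:R ^+ 2)); last by field; rewrite gt_eqF.
by rewrite ler_wpM2r ?ler_nat// divr_ge0// exprn_ge0// ltW.
Qed.

(** The factor 3 is one accumulated error from [sub_partial] plus at most two grid steps between [x]
    and the grid point used. *)
Let nearly_affine j x : (j < M)%N -> c3 * I <= L j ->
  y + j%:R * t < phi x -> phi x < y + j.+1%:R * t ->
  `|x - psi (y + j%:R * t) - L j * (phi x - (y + j%:R * t)) / t| <= 3 * L j / r%:R.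
Proof.
move=> jM Lj x1 x2; have rr := r_gt0; have tt := t_gt0.
have L0 : 0 <= L j by rewrite subr_ge0; apply: (psi_le S); rewrite lerD2l ler_pM2r// ler_nat.
set z := psi _; set f := phi x - _.
have f0 : 0 < f by rewrite subr_gt0.
have ft : f < t by move: x2; rewrite -natr1 /f; lra.
pose q := f / (t / r%:R).
have tr0 : 0 < t / r%:R by rewrite divr_gt0.
have q0 : 0 <= q by apply: ltW; exact: divr_gt0.
have qr : q < r%:R.
  by rewrite /q ltr_pdivrMr// mulrCA mulfV ?mulr1// gt_eqF.
have /andP[i1 i2] := truncn_itv q0; set i := Num.truncn q in i1 i2.
have ir : (i < r)%N by rewrite -(ltr_nat R); lra.
have fE : f = q * (t / r%:R) by rewrite /q mulfVK// gt_eqF.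
have LfE : L j * f / t = q * (L j / r%:R) by rewrite fE; field; rewrite !gt_eqF.
rewrite LfE; set l := L j / r%:R.
have l0 : 0 <= l by rewrite divr_ge0// ltW.
have -> : 3 * L j / r%:R = 3 * l by rewrite /l mulrA.
have ql1 : i%:R * l <= q * l by rewrite ler_wpM2r.
have ql2 : q * l <= i%:R * l + l.
  rewrite -[X in _ + X]mul1r -mulrDl natr1 ler_wpM2r// ltW//.
have up : x - z <= i%:R * l + 2 * l.
  have xl : x < psi (y + j%:R * t + i.+1%:R * (t / r%:R)).
    apply: (phi_lt S); rewrite psiK -ltrBlDl -/f fE ltr_pM2r//.
  have := sub_partial jM Lj ir; rewrite -/z ler_norml -mulrA -/l -natr1 => /andP[_].
  by rewrite natr1; rewrite -natr1 mulrDl mul1r in xl *; rewrite mulrDl mul1r; lra.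
(* [phi] is only weakly monotone, so a grid point with the same [phi]-value as [x] may lie to the
   right of [x]; the grid point before it is used. *)
have lw : i%:R * l - 2 * l <= x - z.
  case: (posnP i) => [->|i0].
    have : z < x by apply: (phi_lt S); rewrite psiK; lra.
    by rewrite mul0r; lra.
  have xl : psi (y + j%:R * t + i.-1%:R * (t / r%:R)) < x.
    apply: (phi_lt S); rewrite psiK -ltrBrDl -/f fE ltr_pM2r//.
    by apply: lt_le_trans i1; rewrite ltr_nat; case: (i) i0.
  have := sub_partial jM Lj (leq_trans (leq_pred _) (ltnW ir)).
  rewrite -/z ler_norml -mulrA -/l => /andP[+ _].
  have iE : i%:R = i.-1%:R + 1 :> R by rewrite natr1 prednK.
  by rewrite iE mulrDl mul1r; lra.
by rewrite ler_norml; lra.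
Qed.

(** On the long cell [P] is nearly the translation by [L j * s / t], so its displacement oscillates
    by at most [12 * L j / r]. A break-free arc in the middle half, which [P] keeps inside the cell
    as [|s| <= t / 8], oscillates by [tile_osc2 sg * I], and [rc] makes the two incompatible. *)
Lemma tile_not_even : False.
Proof.
have dd := d_gt0; have mL := MtL; have mU := MtU; have tt := t_gt0; have rr := r_gt0.
have sg0 := ml_sg_gt0 S; have sg1 := ml_sg_neq1 S.
have c30 : 0 < c3 by apply: tile_osc1_gt0.
have [j jM Lj] := big_cell; have I0 := I_gt0.
have L0 : 0 < L j by apply: lt_le_trans Lj; rewrite mulr_gt0.
have LI : L j <= I.
  rewrite lerB//; apply: (psi_le S).
    by rewrite lerD2l ler_pM2r// ler_nat.
  by rewrite lerDl mulr_ge0// ltW.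
set z := y + j%:R * t.
have zS : y + j.+1%:R * t = z + t by rewrite /z -natr1; ring.
pose x0 := psi (z + t / 4); pose x1 := psi (z + 3 * t / 4).
have e0 : phi x0 = z + t / 4 by exact: psiK.
have e1 : phi x1 = z + 3 * t / 4 by exact: psiK.
have x01 : x0 < x1 by apply: (phi_lt S); rewrite e0 e1; lra.
have tM : t <= M%:R * t by rewrite ler_peMl ?ler1n ?(ltW tt)//; apply: leq_trans jM.
have aff x : z < phi x -> phi x < z + t ->
    `|x - psi z - L j * (phi x - z) / t| <= L j / 8 /\
    `|x - psi z - L j * (phi x - z) / t| <= 3 * L j / r%:R.
  move=> h1 h2; have h := nearly_affine jM Lj h1 (ltac:(rewrite zS; exact: h2)).
  split=> //; apply: le_trans h _; rewrite ler_pdivrMr// mulrAC ler_pdivlMr//.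
  have : 24 <= r%:R :> R by rewrite ler_nat.
  by move=> h24; have : L j * 24 <= L j * r%:R; [rewrite ler_pM2l|lra].
have [b0 _] := aff x0 (ltac:(lra)) (ltac:(lra)).
have [b1 _] := aff x1 (ltac:(lra)) (ltac:(lra)).
have A4 : L j / 4 <= x1 - x0.
  move: b0 b1; rewrite e0 e1 !ler_norml.
  rewrite (_ : L j * (z + t / 4 - z) / t = L j / 4); last by field; rewrite gt_eqF.
  rewrite (_ : L j * (z + 3 * t / 4 - z) / t = 3 * L j / 4); last by field; rewrite gt_eqF.
  lra.
have [u [v [xu uv vx bl bf]]] := break_free_subarc S C d8 x01 (ltac:(rewrite e0 e1; lra)).
pose b := c3 / 2 ^+ 30.
have b_gt0 : 0 < b by rewrite divr_gt0// exprn_gt0.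
have bI : b * (psi (y + M%:R * t) - psi y) <= v - u.
  rewrite -/I /b mulrAC ler_pdivrMr ?exprn_gt0//; apply: le_trans Lj _.
  have : 2 ^+ 30 = 4 * 2 ^+ 28 :> R.
    by rewrite -[30%N]/(2 + 28)%N exprD expr2; congr (_ * _); lra.
  by move: bl; move: (2 ^+ 28) (2 ^+ 30) => A B bl ->; lra.
have yx0 : psi y <= x0.
  by apply: (psi_le S); rewrite /z -addrA lerDl addr_ge0 ?mulr_ge0// ?(ltW tt)//; lra.
have x1M : x1 <= psi (y + M%:R * t).
  apply: (psi_le S); rewrite (@le_trans _ _ (y + j.+1%:R * t))//; first by rewrite zS; lra.
  by rewrite lerD2l ler_pM2r// ler_nat.
have [w [w' [/andP[uw wv] /andP[uw' wv'] osc]]] :=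
  displacement_osc S C d8 b_gt0 bI (ltac:(lra)) uv (ltac:(lra))
  (ltac:(rewrite !psiK; lra)) (ltac:(rewrite !psiK; lra)) bf.
have disp x : u <= x -> x <= v -> `|P x - x - L j * s / t| <= 6 * L j / r%:R.
  move=> ux xv.
  have f0 : z + t / 4 <= phi x by rewrite -e0; apply: (ml_phi_homo S); lra.
  have f1 : phi x <= z + 3 * t / 4 by rewrite -e1; apply: (ml_phi_homo S); lra.
  have := st; rewrite ler_norml => /andP[s1 s2].
  have fP := phi_P x.
  have [_ g1] := aff x (ltac:(lra)) (ltac:(lra)).
  have [_ g2] := aff (P x) (ltac:(lra)) (ltac:(lra)).
  rewrite fP in g2.
  rewrite (_ : P x - x - _ = (P x - psi z - L j * (phi x + s - z) / t) -
    (x - psi z - L j * (phi x - z) / t)); last by field; rewrite gt_eqF.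
  apply: le_trans (ler_normB _ _) _.
  by rewrite (_ : 6 * L j / r%:R = 3 * L j / r%:R + 3 * L j / r%:R) ?lerD//; field; rewrite gt_eqF.
have d1 := disp _ uw wv; have d2 := disp _ uw' wv'.
have : `|iter N G w - w - (iter N G w' - w')| <= 12 * L j / r%:R.
  rewrite (_ : _ - (_ - w') = (P w - w - L j * s / t) - (P w' - w' - L j * s / t)); last by rewrite /P; ring.
  apply: le_trans (ler_normB _ _) _.
  by rewrite (_ : 12 * L j / r%:R = 6 * L j / r%:R + 6 * L j / r%:R) ?lerD//; field; rewrite gt_eqF.
move/(le_trans osc); rewrite -/I -/(tile_osc2 sg) ler_pdivlMr// mulrAC => h.
have : 12 * I < r%:R * tile_osc2 sg * I by rewrite ltr_pM2r//; exact: rc.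
rewrite (mulrC r%:R); lra.
Qed.

End Tile.

(** Contrapositive of [tile_not_even] through [variance_gap] with [e = tile_osc1 sg / r ^ 2], so
    that [r * e ^ 2] is the stated gain. *)
Lemma tile_growth {R : realType} (p sg rho : R) (G phi psi : R -> R)
    (N : nat) (d s : R) (kN : int) (y t : R) (M r : nat) :
  moebius_lift p sg rho G phi psi -> closest_return rho N d s kN -> 8 * d < 1 ->
  0 < t -> `|s| <= t / 8 -> 4 * d <= M%:R * t -> M%:R * t <= 8 * d ->
  (24 <= r)%N -> 12 < r%:R * tile_osc2 sg ->
  (1 + tile_osc1 sg ^+ 2 / r%:R ^+ 3) / r%:R * cell_sq psi y t M <=
  cell_sq psi y (t / r%:R) (M * r).
Proof.
move=> S C d8 t0 st ML MU r24 rc; rewrite leNgt; apply/negP => lt.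
have r0 : 0 < r%:R :> R by rewrite ltr0n; exact: leq_trans r24.
apply: (tile_not_even S C d8 t0 st ML MU r24 rc (y := y)) => j i jM ir.
rewrite -(telescope_cells psi y t M).
pose L (j : nat) := psi (y + j.+1%:R * t) - psi (y + j%:R * t).
pose a (j i : nat) :=
  psi (y + (j * r + i).+1%:R * (t / r%:R)) - psi (y + (j * r + i)%:R * (t / r%:R)).
move: j i jM ir; apply: (@variance_gap _ M r L a) => //.
- exact: leq_trans r24.
- by rewrite divr_gt0 ?exprn_gt0// tile_osc1_gt0 ?(ml_sg_gt0 S) ?(ml_sg_neq1 S).
- by move=> k kM; rewrite subr_ge0; apply: (psi_le S); rewrite lerD2l ler_pM2r// ler_nat.
- move=> k kM.
  have := telescope_cells psi (y + k%:R * t) (t / r%:R) r.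
  rewrite (_ : y + k%:R * t + r%:R * (t / r%:R) = y + k.+1%:R * t).
    rewrite /L => <-; apply: eq_bigr => l _; rewrite /a.
    by congr (psi _ - psi _); rewrite ?mulrSr ?natrD ?natrM; field; rewrite gt_eqF.
  by rewrite -natr1; field; rewrite gt_eqF.
move: lt; rewrite /cell_sq sum_nat_mul.
rewrite (_ : tile_osc1 sg ^+ 2 / r%:R ^+ 3 = r%:R * (tile_osc1 sg / r%:R ^+ 2) ^+ 2)//.
by field; rewrite gt_eqF.
Qed.

Lemma dyadic_small {R : archiRealFieldType} (T e : R) : 0 < e ->
  exists n0 : nat, forall n, (n0 <= n)%N -> T / 2 ^+ n < e.
Proof.
move=> e0; exists (Num.bound (`|T| / e)) => n hn.
have h : `|T| / e < n%:R.
  apply: lt_le_trans (archi_boundP _) _; first by rewrite divr_ge0// ltW.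
  by rewrite ler_nat.
have n2 : n%:R <= 2 ^+ n :> R by rewrite -natrX ler_nat ltnW// ltn_expl.
rewrite ltr_pdivrMr ?exprn_gt0//; apply: le_lt_trans (ler_norm _) _.
rewrite mulrC -ltr_pdivrMr//; exact: lt_le_trans n2.
Qed.

(** * Growth of the sums of squares along dyadic scales *)

Section DyadicGrowth.
Context {R : realType} (p sg rho : R) (G phi psi : R -> R).
Hypothesis S : moebius_lift p sg rho G phi psi.
Hypothesis irr : irrational rho.
Context (y0 T0 : R) (m : nat).
Hypothesis T0_gt0 : 0 < T0.
Hypothesis m24 : (24 <= 2 ^ m)%N.
Hypothesis mc : 12 < 2 ^+ m * tile_osc2 sg.

Let kap := tile_osc1 sg ^+ 2 / (2 ^+ m) ^+ 3.
Let Sq n := cell_sq psi y0 (T0 / 2 ^+ n) (2 ^ n).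

(** For cells of measure [t] a return with [|s| <= t / 8 < d] is taken. The window splits into
    dyadic tiles of measure between [4 * d] and [8 * d], each a union of cells, and [tile_growth] is
    summed over the tiles. *)
Lemma dyadic_growth1 : exists n1, forall n, (n1 <= n)%N ->
  (1 + kap) / 2 ^+ m * Sq n <= Sq (n + m)%N.
Proof.
have T0' := T0_gt0.
(* The bound [T0 / 4] makes the whole window long enough to be a tile, and [1 / 16] ensures
   [8 * d < 1]. *)
have e0 : 0 < Num.min (T0 / 4) (1 / 16) by rewrite lt_min; apply/andP; split; lra.
have [tau tau0 small] := closest_return_small irr e0.
have dr : 0 < dint rho by have := dint_gt0 irr (ltnSn 0); rewrite mul1r.
have f0 : 0 < Num.min tau (dint rho) by rewrite lt_min tau0.
have [n1 Hn1] := dyadic_small T0 f0; exists n1 => n /Hn1.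
set t := T0 / 2 ^+ n; rewrite lt_min => /andP[t_tau t_dr].
have t0 : 0 < t by rewrite divr_gt0// exprn_gt0.
have [N [d [s [kN [C /andP[st td]]]]]] :=
  closest_return_exists (tau := t / 8) irr (ltac:(apply/andP; split; lra)).
have d0 : 0 < d by have [] := C.
have := small _ _ _ _ C (ltac:(lra)); rewrite le_min => /andP[dT d16].
have exq : exists q : nat, T0 / 2 ^+ q < 8 * d.
  by have [q hq] := dyadic_small T0 (ltac:(lra) : 0 < 8 * d); exists q; apply: hq.
pose q := ex_minn exq.
have [qU qL] : T0 / 2 ^+ q < 8 * d /\ 4 * d <= T0 / 2 ^+ q.
  rewrite /q; case: ex_minnP => -[|i] hi imin; split=> //.
    by rewrite expr0 divr1; lra.
  rewrite leNgt; apply/negP => hlt; have := imin i.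
  rewrite ltnn => /implyP; rewrite implybF => /negP; apply.
  move: hlt; rewrite exprS invfM mulrA => hlt.
  have -> : T0 / 2 ^+ i = 2 * (T0 / 2 / 2 ^+ i) by field; rewrite gt_eqF// exprn_gt0.
  lra.
have qn : (q <= n)%N.
  rewrite -ltnS -(ltn_exp2l (m := 2))// -(ltr_nat R) !natrX exprS.
  have : T0 / (2 * 2 ^+ n) < T0 / 2 ^+ q.
    rewrite (_ : T0 / (2 * 2 ^+ n) = t / 2); last by rewrite /t invfM; ring.
    move: (T0 / 2 ^+ q) qL => z qL; lra.
  by rewrite ltr_pM2l// ltf_pV2// posrE ?mulr_gt0// exprn_gt0.
pose M := (2 ^ (n - q))%N.
have KM : (2 ^ n = 2 ^ q * M)%N by rewrite /M -expnD subnKC.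
have Mt : M%:R * t = T0 / 2 ^+ q.
  have : 2 ^+ n = 2 ^+ q * M%:R :> R by rewrite -natrX KM natrM natrX.
  move=> e; rewrite /t e; field; rewrite pnatr_eq0 -lt0n expn_gt0/=.
  by rewrite gt_eqF// exprn_gt0.
have rE : (2 ^ m)%:R = 2 ^+ m :> R by rewrite natrX.
have r0 : 0 < (2 ^ m)%:R :> R by rewrite rE exprn_gt0.
have -> : Sq (n + m) = cell_sq psi y0 (t / (2 ^ m)%:R) (2 ^ q * (M * 2 ^ m)).
  by rewrite /Sq mulnA -KM -expnD exprD invfM mulrA rE.
rewrite /Sq -/t KM !cell_sq_mul mulr_sumr; apply: ler_sum_nat => k _.
rewrite (_ : (M * 2 ^ m)%:R * (t / (2 ^ m)%:R) = M%:R * t); last first.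
  by rewrite natrM; field; rewrite gt_eqF.
have := @tile_growth _ _ _ _ _ _ _ N d s kN (y0 + k%:R * (M%:R * t)) t M (2 ^ m)
  S C (ltac:(lra)) t0 st.
rewrite !rE; apply; rewrite ?Mt//; exact: ltW.
Qed.

Lemma dyadic_growth : exists n1 (K : R), 0 < K /\
  forall k, K * ((1 + kap) / 2 ^+ m) ^+ k <= Sq (n1 + k * m)%N.
Proof.
have [n1 h] := dyadic_growth1; exists n1, (Sq n1); split.
  rewrite /Sq /cell_sq -[(2 ^ n1)%N]prednK ?expn_gt0// big_nat_recl//.
  apply: ltr_wpDr; first by apply: sumr_ge0 => i _; exact: sqr_ge0.
  apply: exprn_gt0; rewrite subr_gt0; apply: (psi_lt S).
  by rewrite mul0r mul1r ltrD2l divr_gt0// exprn_gt0.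
have kap0 : 0 <= kap by rewrite divr_ge0 ?sqr_ge0// !exprn_ge0.
elim=> [|k IH]; first by rewrite expr0 mulr1 mul0n addn0.
rewrite mulSn addnCA addnC exprS mulrCA; apply: le_trans (h _ (leq_addr _ _)).
rewrite ler_wpM2l// divr_ge0 ?exprn_ge0//; lra.
Qed.

End DyadicGrowth.

(** * Cross-ratio distortion under negative Schwarzian derivative *)

Section SchwarzianGap.
Context {R : realType}.
Implicit Types (f g df F : R -> R) (a b x : R).

Lemma MVT_is_derive f df a b : a < b ->
  (forall x, a <= x <= b -> is_derive x 1 f (df x)) ->
  exists c, [/\ a < c, c < b & f b - f a = df c * (b - a)].
Proof.
move=> ab d.
have [c /itvP cab e] : exists2 c, c \in `]a, b[%R & f b - f a = df c * (b - a).
  apply: MVT => // [x /itvP xab|]; first by apply: d; rewrite !xab.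
  apply: derivable_within_continuous => x /itvP xab.
  by have [] := d x (ltac:(by rewrite !xab)).
by exists c; rewrite !cab.
Qed.

(** A negative value at [x] would require a negative slope before [x] and a positive one after it,
    while the slope decreases. *)
Lemma concave_ge0 f f1 f2 a b x : a <= x <= b -> f a = 0 -> f b = 0 ->
  (forall z, a <= z <= b -> is_derive z 1 f (f1 z)) ->
  (forall z, a <= z <= b -> is_derive z 1 f1 (f2 z)) ->
  (forall z, a <= z <= b -> f2 z <= 0) -> 0 <= f x.
Proof.
move=> /andP[]; rewrite le_eqVlt => /orP[/eqP<- _ ->//|ax].
rewrite le_eqVlt => /orP[/eqP-> _ ->//|xb] fa fb d1 d2 neg.
have [c1 [ac1 c1x e1]] := MVT_is_derive ax (fun z h => d1 z (ltac:(lra))).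
have [c2 [xc2 c2b e2]] := MVT_is_derive xb (fun z h => d1 z (ltac:(lra))).
have c12 : c1 < c2 by lra.
have [c [cc1 cc2 e]] := MVT_is_derive c12 (fun z h => d2 z (ltac:(lra))).
have := neg c (ltac:(lra)) => n.
have le21 : f1 c2 <= f1 c1.
  by rewrite -subr_le0 e; apply: mulr_le0_ge0 => //; lra.
rewrite leNgt; apply/negP => fx.
have : f1 c1 < 0.
  by rewrite -(pmulr_llt0 _ (ltac:(lra) : 0 < x - a)) -e1; lra.
have : 0 < f1 c2.
  by rewrite -(pmulr_lgt0 _ (ltac:(lra) : 0 < b - x)) -e2; lra.
lra.
Qed.

Lemma is_derive_sqrtV g (l : R) x : is_derive x 1 g l -> 0 < g x ->
  is_derive x 1 (fun z => (Num.sqrt (g z))^-1)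
    (- l / (2 * g x * Num.sqrt (g x))).
Proof.
move=> d gx.
have q0 : 0 < Num.sqrt (g x) by rewrite sqrtr_gt0.
have d1 : is_derive x 1 (Num.sqrt \o g) ((2 * Num.sqrt (g x))^-1 * l).
  apply: is_derive1_comp => //; exact: is_derive1_sqrt.
have q0' : (Num.sqrt \o g) x != 0 by rewrite /= gt_eqF.
apply: (@is_derive_eq _ _ _ _ _ _ _ _ (is_deriveV q0' d1)).
have ge : g x = Num.sqrt (g x) ^+ 2 by rewrite sqr_sqrtr// ltW.
rewrite /= /GRing.scale/=; set q := Num.sqrt (g x) in q0 ge *.
by rewrite ge; field; rewrite gt_eqF.
Qed.

Section Gap.
Context (F F1 F2 F3 : R -> R) (a b s0 v0 V : R).
Hypotheses (ab : a < b) (s0_ge0 : 0 <= s0) (v0_gt0 : 0 < v0).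
Hypothesis dF : forall x, a <= x <= b -> is_derive x 1 F (F1 x).
Hypothesis dF1 : forall x, a <= x <= b -> is_derive x 1 F1 (F2 x).
Hypothesis dF2 : forall x, a <= x <= b -> is_derive x 1 F2 (F3 x).
Hypothesis F1_gt0 : forall x, a <= x <= b -> 0 < F1 x.
Let v x := (Num.sqrt (F1 x))^-1.
Hypothesis v_bound : forall x, a <= x <= b -> v0 <= v x <= V.
Hypothesis schw : forall x, a <= x <= b ->
  F3 x / F1 x - 3 / 2 * (F2 x / F1 x) ^+ 2 <= - s0.

Let v1 x := - F2 x / (2 * F1 x * Num.sqrt (F1 x)).

Let dv x : a <= x <= b -> is_derive x 1 v (v1 x).
Proof. by move=> h; apply: is_derive_sqrtV; [exact: dF1|exact: F1_gt0]. Qed.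

Let dv1 x : a <= x <= b -> is_derive x 1 v1
  (- 2^-1 * (F3 x / F1 x - 3 / 2 * (F2 x / F1 x) ^+ 2) * v x).
Proof.
move=> h; have F0 := F1_gt0 h.
have q0 : 0 < Num.sqrt (F1 x) by rewrite sqrtr_gt0.
have -> : v1 = (fun z => - 2^-1 * (F2 z * ((F1 z)^-1 * v z))).
  by apply/funext => z; rewrite /v1 /v -mulrA !invfM; ring.
have dV := is_deriveV (lt0r_neq0 F0) (dF1 h).
have d1 := is_deriveM dV (dv h).
have d2 := is_deriveM (dF2 h) d1.
have d3 := is_deriveZ (- 2^-1) d2.
apply: (@is_derive_eq _ _ _ _ _ _ _ _ d3).
have ge : F1 x = Num.sqrt (F1 x) ^+ 2 by rewrite sqr_sqrtr// ltW.
rewrite fctE /= /GRing.scale/= /v1 /v; set q := Num.sqrt (F1 x) in q0 ge *.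
by rewrite ge; field; rewrite gt_eqF.
Qed.

(* [v = F'^(-1/2)] satisfies [v'' = - S(F) v / 2], so it is convex; replacing it by its chord [Lc] would turn [F] into a
   Moebius map with the same derivatives at the endpoints, for which the cross-ratio distortion is 1. *)
Let kp := s0 * v0 / 2.
Let Lc x := v a + (v b - v a) / (b - a) * (x - a).

Let is_derive_Lc x : is_derive x 1 Lc ((v b - v a) / (b - a)).
Proof.
have d1 := is_deriveB (is_derive_id x (1 : R)) (is_derive_cst a x (1 : R)).
have d2 := is_deriveZ ((v b - v a) / (b - a)) d1.
have d3 := is_deriveD (is_derive_cst (v a) x (1 : R)) d2.
apply: (@is_derive_eq _ _ _ _ _ _ _ _ d3).
by rewrite /GRing.scale/=; ring.
Qed.

(** Since [v'' >= kp], the chord minus [v] minus the parabola is concave, and it vanishes at both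
    ends. *)
Let chord_gap x : a <= x <= b -> kp / 2 * ((x - a) * (b - x)) <= Lc x - v x.
Proof.
move=> xab; rewrite -subr_ge0; have ba : b - a != 0 by rewrite subr_eq0 gt_eqF.
pose f z := Lc z - v z - kp / 2 * ((z - a) * (b - z)).
pose f1 z := (v b - v a) / (b - a) - v1 z - kp / 2 * (a + b - 2 * z).
pose f2 z := 2^-1 * (F3 z / F1 z - 3 / 2 * (F2 z / F1 z) ^+ 2) * v z + kp.
rewrite -/(f x); apply: (@concave_ge0 f f1 f2 a b).
- exact: xab.
- by rewrite /f /Lc; ring.
- by rewrite /f /Lc; field.
- move=> z h.
  have da := is_deriveB (is_derive_id z (1 : R)) (is_derive_cst a z (1 : R)).
  have db := is_deriveB (is_derive_cst b z (1 : R)) (is_derive_id z (1 : R)).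
  have d1 := is_deriveZ (kp / 2) (is_deriveM da db).
  have d2 := is_deriveB (is_deriveB (is_derive_Lc z) (dv h)) d1.
  apply: (@is_derive_eq _ _ _ _ _ _ _ _ d2).
  rewrite /f1 ?fctE /GRing.scale/=; ring.
- move=> z h.
  have d0 := is_deriveZ 2 (is_derive_id z (1 : R)).
  have da := is_deriveB (is_derive_cst (a + b) z (1 : R)) d0.
  have d1 := is_deriveZ (kp / 2) da.
  have d2 := is_deriveB (is_deriveB (is_derive_cst ((v b - v a) / (b - a)) z (1 : R)) (dv1 h)) d1.
  apply: (@is_derive_eq _ _ _ _ _ _ _ _ d2).
  by rewrite /f2 ?fctE /GRing.scale/=; field; rewrite gt_eqF// F1_gt0.
- move=> z h; rewrite /f2 /kp; have := schw h.
  set sw := _ - _ => swn; have /andP[vz _] := v_bound h.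
  have vz0 : 0 <= v z by apply: le_trans vz; exact: ltW.
  have := ler_wpM2r vz0 swn; have := ler_wpM2l s0_ge0 vz; lra.
Qed.

(** [F' = v^(-2)] is compared with [Lc^(-2)], whose primitive [(x - a) / (v a * Lc x)] equals
    [(b - a) / (v a * v b)] at [b]. The chord gap adds a multiple of [(x - a) * (b - x)], whose
    integral is [(b - a)^3 / 6]; monotonicity of [f] takes the place of integration. *)
Lemma schwarzian_gap :
  (1 + s0 * v0 ^+ 3 / (24 * V ^+ 3) * (b - a) ^+ 2) * ((b - a) ^+ 2 * (F1 a * F1 b)) <=
  (F b - F a) ^+ 2.
Proof.
have v00 := v0_gt0; have ab' := ab; have l0 : 0 < b - a by rewrite subr_gt0.
have Ia : a <= a <= b by rewrite lexx ltW.
have Ib : a <= b <= b by rewrite lexx ltW.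
have /andP[va0 vaV] := v_bound Ia; have /andP[vb0 vbV] := v_bound Ib.
have LE x : Lc x = ((b - x) * v a + (x - a) * v b) / (b - a).
  by rewrite /Lc; field; rewrite gt_eqF.
have L_lb x : a <= x <= b -> v0 <= Lc x.
  move=> /andP[h1 h2]; rewrite LE ler_pdivlMr//.
  have : (b - x) * v0 <= (b - x) * v a by rewrite ler_wpM2l// subr_ge0.
  have : (x - a) * v0 <= (x - a) * v b by rewrite ler_wpM2l// subr_ge0.
  lra.
have L_ub x : a <= x <= b -> Lc x <= V.
  move=> /andP[h1 h2]; rewrite LE ler_pdivrMr//.
  have : (b - x) * v a <= (b - x) * V by rewrite ler_wpM2l// subr_ge0.
  have : (x - a) * v b <= (x - a) * V by rewrite ler_wpM2l// subr_ge0.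
  lra.
have V0 : 0 < V by lra.
have V3 : 0 < V ^+ 3 by rewrite exprn_gt0.
(* From [v^(-2) - L^(-2) = (L - v) * (L + v) / (v^2 * L^2) >= (L - v) / V^3], valid as
   [v <= L <= V]. *)
pose k2 := kp / (2 * V ^+ 3).
have kp0 : 0 <= kp by rewrite divr_ge0// mulr_ge0// ltW.
have k20 : 0 <= k2 by rewrite divr_ge0// mulr_ge0// ltW.
pose f x := F x - (x - a) / (v a * Lc x) -
  k2 * ((b - a) / 2 * (x - a) ^+ 2 - (x - a) ^+ 3 / 3).
pose f1 x := F1 x - (Lc x) ^- 2 - k2 * ((x - a) * (b - x)).
have df x : a <= x <= b -> is_derive x 1 f (f1 x).
  move=> h; have L0 : 0 < Lc x by apply: lt_le_trans (L_lb _ h).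
  have va00 : 0 < v a by lra.
  have da := is_deriveB (is_derive_id x (1 : R)) (is_derive_cst a x (1 : R)).
  have d1 := is_deriveZ (v a) (is_derive_Lc x).
  have nz : (v a \*: Lc) x != 0 by rewrite /= /GRing.scale/= gt_eqF ?mulr_gt0.
  have d2 := is_deriveM da (is_deriveV nz d1).
  have d3 := is_deriveZ ((b - a) / 2) (is_deriveX 2 da).
  have d4 := is_deriveZ (3^-1) (is_deriveX 3 da).
  have d5 := is_deriveZ k2 (is_deriveB d3 d4).
  have d6 := is_deriveB (is_deriveB (dF h) d2) d5.
  have fE : f = (F - ((id - cst a) * (fun y => ((v a \*: Lc) y)^-1)) -
    (k2 \*: (((b - a) / 2 \*: (id - cst a) ^+ 2) - (3^-1 \*: (id - cst a) ^+ 3)))).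
    by apply/funext => z; rewrite /f /GRing.scale/= [_ / 3]mulrC.
  rewrite fE; apply: (@is_derive_eq _ _ _ _ _ _ _ _ d6).
  have lE : Lc x = v a + (v b - v a) / (b - a) * (x - a) by [].
  have xE : (v b - v a) / (b - a) * (x - a) = Lc x - v a by rewrite lE; ring.
  rewrite /f1 ?fctE /= /GRing.scale/=.
  set D := (v b - v a) / (b - a) in xE *.
  have -> : F1 x - (Lc x) ^- 2 - k2 * ((x - a) * (b - x)) =
    F1 x - (v a) / (v a * (Lc x) ^+ 2) - k2 * ((x - a) * (b - x)).
    by congr (_ - _ - _); field; rewrite !gt_eqF.
  have -> : v a = Lc x - D * (x - a) by rewrite xE; ring.
  have L1 : Lc x - D * (x - a) != 0 by rewrite xE opprB addrC subrK gt_eqF.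
  by field; rewrite L1 gt_eqF.
have pos x : a <= x <= b -> 0 <= f1 x.
  move=> h; have L0 : 0 < Lc x by apply: lt_le_trans (L_lb _ h).
  have /andP[vx0 vxV] := v_bound h; have vx : 0 < v x by lra.
  have gap := chord_gap h; have LV := L_ub _ h.
  have q0 : 0 <= (x - a) * (b - x) by case/andP: h => *; rewrite mulr_ge0// subr_ge0.
  have F1E : F1 x = (v x) ^- 2.
    by rewrite /v -exprVn invrK sqr_sqrtr// ltW// F1_gt0.
  have vL : v x <= Lc x.
    rewrite -subr_ge0; apply: le_trans gap; rewrite mulr_ge0// divr_ge0//.
  rewrite /f1 F1E.
  have e1 : (v x) ^- 2 - (Lc x) ^- 2 =
    (Lc x - v x) * (Lc x + v x) / ((v x) ^+ 2 * (Lc x) ^+ 2).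
    by field; rewrite !gt_eqF.
  rewrite e1 subr_ge0.
  apply: (@le_trans _ _ ((Lc x - v x) / V ^+ 3)).
    rewrite ler_pdivlMr// (_ : k2 * _ * _ = kp / 2 * ((x - a) * (b - x)))//.
    by rewrite /k2; field; rewrite gt_eqF.
  rewrite -mulrA ler_wpM2l ?subr_ge0//.
  rewrite ler_pdivlMr ?mulr_gt0 ?exprn_gt0// mulrC ler_pdivrMr//.
  apply: (@le_trans _ _ (Lc x ^+ 2 * Lc x ^+ 2)).
    by rewrite ler_wpM2r ?sqr_ge0// ler_pXn2r// nnegrE ltW.
  apply: (@le_trans _ _ (Lc x * V ^+ 3)).
    rewrite -exprD (exprS _ 3) ler_wpM2l ?(ltW L0)// ler_pXn2r// nnegrE ltW//.
  rewrite ler_wpM2r ?(ltW V3)//; lra.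
have [c [ac cb e]] := MVT_is_derive ab df.
have fba : f a <= f b.
  by rewrite -subr_ge0 e mulr_ge0 ?pos ?(ltW l0)//; lra.
have Lb : Lc b = v b by rewrite /Lc; field; rewrite gt_eqF.
have fa : f a = F a by rewrite /f subrr; ring.
have fb : f b = F b - (b - a) / (v a * v b) - k2 * (b - a) ^+ 3 / 6.
  by rewrite /f Lb; field; apply/andP; split; rewrite gt_eqF//; lra.
have FE z : a <= z <= b -> F1 z = (v z) ^- 2.
  by move=> h; rewrite /v -exprVn invrK sqr_sqrtr// ltW// F1_gt0.
rewrite (FE _ Ia) (FE _ Ib); set X := v a in va0 vaV fa fb *; set Y := v b in vb0 vbV fb *.
have X0 : 0 < X by lra.
have Y0 : 0 < Y by lra.
pose K := s0 * v0 ^+ 3 / (24 * V ^+ 3).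
have kXY : K <= k2 * (X * Y) / 6.
  have -> : K = k2 * (v0 * v0) / 6 by rewrite /K /k2 /kp; field; rewrite gt_eqF.
  rewrite ler_pM2r// ler_wpM2l//; apply: ler_pM => //; exact: ltW.
have K0 : 0 <= K by rewrite divr_ge0 ?mulr_ge0 ?exprn_ge0// ltW.
have main : (b - a) / (X * Y) * (1 + K * (b - a) ^+ 2) <= F b - F a.
  have : (b - a) / (X * Y) * (1 + K * (b - a) ^+ 2) <=
      (b - a) / (X * Y) * (1 + k2 * (X * Y) / 6 * (b - a) ^+ 2).
    rewrite ler_wpM2l//; first by rewrite divr_ge0 ?mulr_ge0// ltW.
    by rewrite lerD2l ler_wpM2r// sqr_ge0.
  move/le_trans; apply.
  have -> : (b - a) / (X * Y) * (1 + k2 * (X * Y) / 6 * (b - a) ^+ 2) =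
    (b - a) / (X * Y) + k2 * (b - a) ^+ 3 / 6.
    by field; rewrite !gt_eqF.
  lra.
have KL : 0 <= K * (b - a) ^+ 2 by rewrite mulr_ge0// sqr_ge0.
rewrite -/K; apply: (@le_trans _ _ (((b - a) / (X * Y) * (1 + K * (b - a) ^+ 2)) ^+ 2)).
  rewrite exprMn mulrC (_ : (b - a) ^+ 2 * _ = ((b - a) / (X * Y)) ^+ 2).
    rewrite ler_wpM2l ?sqr_ge0// expr2; move: KL; move: (K * _) => z z0.
    have := mulr_ge0 z0 z0; lra.
  by field; rewrite !gt_eqF.
by rewrite ler_pXn2r// nnegrE; [|apply: le_trans main];
  rewrite mulr_ge0 ?divr_ge0 ?mulr_ge0//; try lra; exact: ltW.
Qed.

End Gap.

End SchwarzianGap.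

(** * Upper bound for the sums of squares *)

Lemma small_term {R : realFieldType} (n m : nat) (f : nat -> R) (B : R) : (0 < n)%N ->
  \sum_(m <= j < m + n) f j <= B -> exists j, (m <= j < m + n)%N /\ f j <= B / n%:R.
Proof.
move=> n0 h; apply: contrapT => H.
have big j : (m <= j < m + n)%N -> B / n%:R < f j.
  by move=> jI; rewrite ltNge; apply/negP => hj; apply: H; exists j.
have : \sum_(m <= j < m + n) B / n%:R < \sum_(m <= j < m + n) f j.
  by apply: ltr_sum_nat => //; rewrite -addn1 leq_add2l.
rewrite sumr_const_nat addKn -[X in X < _]mulr_natl mulrCA mulfV ?pnatr_eq0 -?lt0n// mulr1.
by move=> /(lt_le_trans)/(_ h); rewrite ltxx.
Qed.

Section DenseOrbit.
Context {R : realType} (rho : R) (N : nat) (d s : R) (kN : int).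
Hypothesis C : closest_return rho N d s kN.

(** Among the rotation points of the second return, each translated to lie just below [y], the
    highest one works: if it were further than [2 * d] from [y], its right neighbour would be higher
    and still below [y]. *)
Lemma closest_return_dense (y : R) : exists (j : nat) (k : int),
  (N <= j < N + N)%N /\ y - 2 * d <= j%:R * rho + k%:~R < y.
Proof.
have N0 : (0 < N)%N by have [] := C => /ltnW.
have [m [k1 [k2 [mN /andP[a1 a2] /andP[b1 b2]]]]] := closest_return_next C.
pose K (j : nat) : int := Num.ceil (y - j%:R * rho) - 1.
have KP j : j%:R * rho + (K j)%:~R < y.
  by have := ceil_itv (y - j%:R * rho); rewrite -/(K j) => /andP[]; lra.
have Kmax j (k : int) : j%:R * rho + k%:~R < y -> j%:R * rho + k%:~R <= j%:R * rho + (K j)%:~R.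
  move=> h; rewrite lerD2l ler_int /K lerBrDr lezD1 -(ltr_int R).
  by apply: lt_le_trans (ceil_ge _); lra.
pose pt (i : 'I_N) := (N + i)%:R * rho + (K (N + i)%N)%:~R.
pose i0 := [arg max_(i > Ordinal N0) pt i]%O.
have imax i : pt i <= pt i0.
  by rewrite /i0; case: Order.TotalTheory.arg_maxP => // i' _ h; apply: h.
exists (N + i0)%N, (K (N + i0)%N); split; first by rewrite leq_addr ltn_add2l ltn_ord.
rewrite KP andbT leNgt; apply/negP; rewrite -/(pt i0) => lt.
have nxt (j : nat) (k : int) (e : R) : (j < N)%N -> 0 < e -> e < 2 * d ->
    (N + j)%:R * rho + k%:~R = pt i0 + e -> False.
  move=> jN e0 e2 E; have le : (N + j)%:R * rho + (K (N + j)%N)%:~R <= pt i0 := imax (Ordinal jN).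
  have := Kmax (N + j)%N k (ltac:(rewrite E; lra)); rewrite E; lra.
case: (ltnP (i0 + m) N) => h.
  apply: (nxt (i0 + m)%N (K (N + i0)%N - k1) _ h a1 a2).
  by rewrite /pt intrB addnA natrD; ring.
have jN : (i0 + m - N < N)%N by have := ltn_ord i0; clear - mN h; lia.
apply: (nxt (i0 + m - N)%N (K (N + i0)%N - k2) _ jN b1 b2).
by rewrite /pt intrB subnKC// !natrD; ring.
Qed.

End DenseOrbit.

Section CellUpperBound.
Context {R : realType} (p sg rho : R) (G phi psi : R -> R).
Hypothesis S : moebius_lift p sg rho G phi psi.
(** [X] stands for the cross-ratio of the conjugacy, supplied by [conj_cocycle]. The gain in
    [X_strict] is asked only at distance [de] from the breaks, where [S(F)] is bounded away from
    0. *)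
Context (X : R -> R -> R) (al E kp de : R).
Hypotheses (al_gt0 : 0 < al) (al_le1 : al <= 1) (E_ge0 : 0 <= E) (kp_gt0 : 0 < kp).
Implicit Types (u v x y : R) (k : int).
Hypothesis X_gt0 : forall u v, u < v -> 0 < X u v.
Hypothesis X_upper : forall u v, u < v -> v < u + 1 -> X u v <= 1 + E * (v - u) `^ al.
Hypothesis X_lower : forall u v, u < v -> v < u + 1 -> 1 <= (1 + E * (v - u) `^ al) * X u v.
Hypothesis X_mono : forall k u v, p + k%:~R < u -> u < v -> v < p + k%:~R + 1 ->
  X (G u) (G v) <= X u v.
Hypothesis X_strict : forall k u v,
  p + k%:~R + de <= u -> u < v -> v <= p + k%:~R + 1 - de ->
  X (G u) (G v) * (1 + kp * (v - u) ^+ 2) <= X u v.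
Context (y0 T0 d0 : R).
Hypotheses (d0_gt0 : 0 < d0) (d0_small : 8 * d0 < 1) (T0_gt0 : 0 < T0).
Hypotheses (loc_l : phi (p + de) < y0 - 4 * d0) (loc_r : y0 + T0 + 4 * d0 < phi (p + 1 - de)).
Hypothesis T0_small : T0 + 4 * d0 < 1.
Hypothesis de_gt0 : 0 < de.

Let it_mono := iter_lift_mono (ml_incr S).
Let it_mono_lt := iter_lift_mono_lt (ml_incr S).

Let powR_le (a b : R) : 0 <= a -> a <= b -> a `^ al <= b `^ al.
Proof.
move=> a0 ab; apply: ge0_ler_powR => //; rewrite ?nnegrE//; first exact: ltW.
exact: le_trans ab.
Qed.

(** Bounds [((1 + E * e)^2 - 1) / e] for [0 < e <= 9]. *)
Let const_e := 2 * E + 9 * E ^+ 2.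
Let const := (distortion_const sg * 2 ^+ 28) ^+ 2 * (18 * const_e / kp).

Section OneReturn.
Context (N : nat) (d s : R) (kN : int).
Hypothesis C : closest_return rho N d s kN.
Hypothesis dd0 : d <= d0.

Let d_gt0 : 0 < d. Proof. by have [] := C. Qed.
Let d8 : 8 * d < 1. Proof. by have := dd0; have := d0_small; lra. Qed.
Let N_gt0 : (0 < N)%N. Proof. by have [/ltnW] := C. Qed.

Let x0 := psi 0.
Let x1 := psi (4 * d).

Let phi_x0 : phi x0 = 0. Proof. exact: ml_psiK S _. Qed.
Let phi_x1 : phi x1 = 4 * d. Proof. exact: ml_psiK S _. Qed.
Let x01 : x0 < x1.
Proof. by apply: (phi_lt S); rewrite phi_x0 phi_x1 mulr_gt0. Qed.

Let loc (j : nat) : bool :=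
  `[< exists k, p + k%:~R + de <= iter j G x0 /\ iter j G x1 <= p + k%:~R + 1 - de >].

(** Some time [i < N] and some time [i'] in the third return have an image of length at most
    [9 / N], where the Hoelder bounds pin [X] to within [O(d^al)] of 1. In between [X] only
    decreases, so the gains of the second return, proportional to squared lengths, add up to
    [O(d^al)]. *)
Let arcs_sum : \sum_(N <= j < N + N | loc j) (iter j G x1 - iter j G x0) ^+ 2 <=
  const * d `^ al.
Proof.
have dp := d_gt0; have kp0 := kp_gt0; have E0 := E_ge0.
have D8 : phi x1 - phi x0 <= 8 * d by rewrite phi_x0 phi_x1; lra.
have [u [v [xu uv vx bl bf]]] := break_free_subarc S C d8 x01 D8.
pose w j := iter j G v - iter j G u.
have w0 j : 0 < w j by rewrite subr_gt0 it_mono_lt.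
pose Y j := X (iter j G u) (iter j G v).
have Y0 j : 0 < Y j by apply: X_gt0; rewrite it_mono_lt.
have D9 : phi v - phi u < 9 * d.
  have := ml_phi_homo S (ltW xu); have := ml_phi_homo S (ltW vx).
  rewrite phi_x0 phi_x1; lra.
have blk b : \sum_(b <= j < b + N) w j <= 9.
  have := @arc_sum_le _ _ _ _ _ _ _ S _ _ _ _ C 8 (iter b G u) (iter b G v).
  rewrite it_mono_lt (phi_iter_sub S) => /(_ uv D9) h.
  rewrite -{1}(add0n b) big_addn addKn; apply: le_trans h.
  by rewrite le_eqVlt; apply/orP; left; apply/eqP; apply: eq_bigr => j _; rewrite /w !iterD.
have [i [/andP[_ iN] wi]] := small_term N_gt0 (blk 0%N).
have [i' [/andP[i'N i'3] wi']] := small_term N_gt0 (blk (N + N)%N).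
rewrite add0n in iN.
have ii' : (i <= i')%N by apply: leq_trans (ltnW iN) _; apply: leq_trans i'N; rewrite leq_addr.
have three j : (j < i')%N -> (j < 3 * N)%N by move=> h; clear - h i'3; lia.
have locY j : (j < i')%N -> Y j.+1 * (1 + (if loc j then kp * w j ^+ 2 else 0)) <= Y j.
  move=> /three j3; have [k [k1 k2]] := bf _ j3.
  case: ifPn => [/asboolP[k' [k'1 k'2]]|_].
    apply: (@X_strict k'); rewrite ?it_mono_lt//.
      by apply: le_trans k'1 _; rewrite it_mono ltW.
    by apply: le_trans k'2; rewrite it_mono ltW.
  by rewrite addr0 mulr1; apply: (@X_mono k); rewrite ?it_mono_lt.
pose Sm n := \sum_(i <= j < n) (if loc j then kp * w j ^+ 2 else 0).
have Sm0 n : 0 <= Sm n.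
  apply: sumr_ge0 => j _; case: ifP => // _; rewrite mulr_ge0 ?sqr_ge0//; exact: ltW.
(* The product of the factors [1 + q_j] is bounded below by 1 plus the sum of the [q_j]. *)
have tele n : (i <= n <= i')%N -> Y n * (1 + Sm n) <= Y i.
  elim: n => [|n IH].
    by move=> /andP[i0 _]; rewrite /Sm big_geq// addr0 mulr1; move: i0; rewrite leqn0 => /eqP->.
  move=> /andP[]; rewrite leq_eqVlt => /orP[/eqP <- _|in' ni'].
    by rewrite /Sm big_geq// addr0 mulr1.
  apply: le_trans (IH (ltac:(by rewrite -ltnS in' ltnW))).
  apply: le_trans (_ : Y n.+1 * (1 + (if loc n then kp * w n ^+ 2 else 0)) * (1 + Sm n) <= _).
    rewrite -mulrA ler_pM2l// /Sm big_nat_recr//= -/(Sm n).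
    have q0 : 0 <= (if loc n then kp * w n ^+ 2 else 0).
      by case: ifP => // _; rewrite mulr_ge0 ?sqr_ge0//; exact: ltW.
    have := mulr_ge0 q0 (Sm0 n); move: (if _ then _ else _) (Sm n) => q z; lra.
  by rewrite ler_wpM2r ?locY// addr_ge0.
have NR : 0 < N%:R :> R by rewrite ltr0n.
have [_ [_ [_ [_ _ _ [_ Nd]]]]] := closest_return_winding C.
pose e := (9 / N%:R) `^ al.
have e0 : 0 <= e by exact: powR_ge0.
have vu1 j : iter j G v < iter j G u + 1.
  apply: (phi_lt S); rewrite (ml_phi_per S).
  have := phi_iter_sub S j u v; have := ml_phi_homo S (ltW xu).
  have := ml_phi_homo S (ltW vx); rewrite phi_x0 phi_x1; have := d8; lra.
have we j : w j <= 9 / N%:R -> w j `^ al <= e.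
  by move=> h; apply: powR_le => //; exact: ltW.
have Yi : Y i <= 1 + E * e.
  apply: le_trans (X_upper _ (vu1 i)) _; first by rewrite it_mono_lt.
  by rewrite lerD2l ler_wpM2l// we.
have Yi' : 1 <= (1 + E * e) * Y i'.
  apply: le_trans (X_lower _ (vu1 i')) _; first by rewrite it_mono_lt.
  by apply: ler_wpM2r; [exact: ltW (Y0 i')|rewrite lerD2l ler_wpM2l// we].
have e9 : e <= 9.
  have -> : 9 = (9 : R) `^ 1 by rewrite powRr1.
  apply: (@le_trans _ _ (9 `^ al)).
    apply: powR_le; first by rewrite divr_ge0.
    by rewrite ler_piMr// invf_le1// ler1n.
  by rewrite ler_powR// ler1n.
have Smb : Sm i' <= const_e * e.
  have t := tele i' (ltac:(by rewrite ii' leqnn)).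
  have : 1 + Sm i' <= (1 + E * e) * (1 + E * e).
    apply: le_trans (_ : (1 + E * e) * Y i' * (1 + Sm i') <= _).
      by rewrite ler_peMl//; have := Sm0 i'; lra.
    rewrite -mulrA ler_wpM2l//; last by apply: le_trans t _.
    by rewrite addr_ge0 ?mulr_ge0.
  have : E ^+ 2 * (e * e) <= E ^+ 2 * (9 * e) by rewrite ler_wpM2l ?sqr_ge0// ler_wpM2r.
  by rewrite /const_e; move: (E ^+ 2 * (e * e)) (mulrACA E e E e); rewrite expr2 => z zE; lra.
(* The winding estimate [1 <= N * (2 * d)] gives [9 / N <= 18 * d], and [18^al <= 18]. *)
have ed : e <= 18 * d `^ al.
  apply: (@le_trans _ _ ((18 * d) `^ al)).
    apply: powR_le; first by rewrite divr_ge0.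
    rewrite ler_pdivrMr//; lra.
  rewrite powRM// ?(ltW dp)// ler_wpM2r ?powR_ge0//.
  rewrite -[leRHS]powRr1// ler_powR// ler1n//.
have Lam0 := distortion_const_gt0 (ml_sg_gt0 S).
have arc_le j : (j < 3 * N)%N ->
    iter j G x1 - iter j G x0 <= distortion_const sg * 2 ^+ 28 * w j.
  move=> j3; have := distortion S C d8 D8 (ltnW j3) (lexx _) x01 (lexx _) (ltW xu) uv (ltW vx).
  move=> h; rewrite -(ler_pM2r (_ : 0 < v - u)) ?subr_gt0//.
  apply: le_trans h _; move: (2 ^+ 28) bl => z bl.
  rewrite (_ : _ * (v - u) = distortion_const sg * (z * (v - u) * w j)); last by ring.
  by apply: ler_wpM2l; [exact: ltW|apply: ler_wpM2r bl; exact: ltW (w0 j)].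
apply: (@le_trans _ _ ((distortion_const sg * 2 ^+ 28) ^+ 2 * \sum_(N <= j < N + N | loc j) w j ^+ 2)).
  rewrite mulr_sumr big_nat_cond [leRHS]big_nat_cond; apply: ler_sum => j /andP[/andP[j1 j2] _].
  rewrite -exprMn ler_pXn2r ?nnegrE ?subr_ge0 ?it_mono ?(ltW x01)//.
    by apply: arc_le; clear - j2; lia.
  by apply: mulr_ge0 (ltW (w0 j)); apply: mulr_ge0 (ltW Lam0) _; exact: exprn_ge0.
rewrite /const -mulrA ler_wpM2l ?sqr_ge0//.
rewrite mulrAC ler_pdivlMr// [leLHS]mulrC.
apply: (@le_trans _ _ (Sm i')).
  have le1 : (i <= N)%N := ltnW iN; have le2 : (N + N <= i')%N := i'N.
  have le3 : (N <= i')%N := leq_trans (leq_addr N N) le2.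
  rewrite /Sm (big_cat_nat le1 le3)/= (big_cat_nat (leq_addr N N) le2)/=.
  have pos a b : 0 <= \sum_(a <= j < b) (if loc j then kp * w j ^+ 2 else 0).
    apply: sumr_ge0 => j _; case: ifP => // _; rewrite mulr_ge0 ?sqr_ge0//; exact: ltW.
  rewrite mulr_sumr [in leLHS]big_mkcond/=.
  have := pos i N; have := pos (N + N)%N i'; lra.
apply: le_trans Smb _; rewrite (_ : 18 * _ * _ = const_e * (18 * d `^ al)).
  by rewrite ler_wpM2l// /const_e addr_ge0 ?mulr_ge0 ?sqr_ge0.
by ring.
Qed.

(** Each cell fits into a translated image of [[x0, x1]] with time in the second return: the image
    begins less than or exactly [2 * d] before the cell, whose measure is at most [d], and has
    measure [4 * d]. Cells sharing an image are disjoint in it, so their squares sum to at most the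
    square of its length. *)
Lemma cell_sq_upper n : T0 / 2 ^+ n <= d ->
  cell_sq psi y0 (T0 / 2 ^+ n) (2 ^ n) <= const * d `^ al.
Proof.
move=> td; set t := T0 / 2 ^+ n in td *; apply: le_trans arcs_sum.
have dp := d_gt0; have t0 : 0 < t by rewrite divr_gt0// exprn_gt0.
have tn : (2 ^ n)%:R * t = T0.
  by rewrite /t natrX mulrCA mulfV ?mulr1// gt_eqF// exprn_gt0.
have dd := dd0; have L1 := loc_l; have L2 := loc_r; have TS := T0_small.
have ex (c : nat) := closest_return_dense C (y0 + c%:R * t).
pose J c := projT1 (cid (ex c)); pose K c := projT1 (cid (projT2 (cid (ex c)))).
have JK c : (N <= J c < N + N)%N /\
    y0 + c%:R * t - 2 * d <= (J c)%:R * rho + (K c)%:~R < y0 + c%:R * t.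
  exact: projT2 (cid (projT2 (cid (ex c)))).
have Jlt c : (J c - N < N)%N by have [/andP[]] := JK c; clear; lia.
pose J' c := Ordinal (Jlt c).
have JE c : J c = (N + J' c)%N by rewrite /= subnKC//; have [/andP[]] := JK c.
rewrite /cell_sq; pose l (c : nat) := psi (y0 + c.+1%:R * t) - psi (y0 + c%:R * t).
have cS (c : nat) : y0 + c.+1%:R * t = y0 + c%:R * t + t by rewrite -natr1; ring.
have l0 c : 0 < l c by rewrite subr_gt0; apply: (psi_lt S); rewrite cS; lra.
have sub c : (c < 2 ^ n)%N ->
  [/\ iter (J c) G x0 + (K c)%:~R <= psi (y0 + c%:R * t),
      psi (y0 + c.+1%:R * t) <= iter (J c) G x1 + (K c)%:~R & loc (J c)].
  move=> cn; have [_ /andP[h1 h2]] := JK c.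
  have c0 : 0 <= c%:R * t by rewrite mulr_ge0// ltW.
  have c1 : c%:R * t <= T0 by rewrite -tn ler_pM2r// ler_nat ltnW.
  have f0 : phi (iter (J c) G x0 + (K c)%:~R) = (J c)%:R * rho + (K c)%:~R.
    by rewrite (phi_addz S) (phi_iter S) phi_x0 add0r.
  have f1 : phi (iter (J c) G x1 + (K c)%:~R) = (J c)%:R * rho + (K c)%:~R + 4 * d.
    by rewrite (phi_addz S) (phi_iter S) phi_x1; ring.
  split.
  - by apply/ltW/(phi_lt S); rewrite (ml_psiK S) f0.
  - by apply/ltW/(phi_lt S); rewrite (ml_psiK S) f1 cS; lra.
  - apply/asboolP; exists (- K c); rewrite mulrNz; split.
      have : p + de < iter (J c) G x0 + (K c)%:~R by apply: (phi_lt S); rewrite f0; lra.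
      lra.
    have : iter (J c) G x1 + (K c)%:~R < p + 1 - de by apply: (phi_lt S); rewrite f1; lra.
    lra.
have RE f : \sum_(N <= j < N + N | loc j) f j = \sum_(j < N | loc (N + j)%N) f (N + j)%N :> R.
  rewrite -{1}(add0n N) big_addn addKn big_mkord.
  by apply: eq_big => j; rewrite addnC.
rewrite RE big_mkord.
rewrite (partition_big (fun c : 'I_(2 ^ n) => J' c) (fun j : 'I_N => loc (N + j)%N))/=; last first.
  by move=> c _; rewrite subnKC; [have [] := sub c (ltn_ord c)|have [/andP[]] := JK c].
apply: ler_sum => j lj; set len := iter _ G x1 - iter _ G x0.
have len0 : 0 <= len by rewrite subr_ge0 it_mono ltW.
have JcE (c : 'I_(2 ^ n)) : J' c == j -> J c = (N + j)%N by move=> /eqP <-; exact: JE.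
have suml : \sum_(c < 2 ^ n | J' c == j) l c <= len.
  have [c0 /= /JcE Jc0|none] := pickP (fun c : 'I_(2 ^ n) => J' c == j); last first.
    by rewrite big_pred0.
  (* Cells assigned to the same time use the same translate, because the window enlarged by [2 * d]
     has measure less than 1. *)
  have Kle (c c' : 'I_(2 ^ n)) : J c = J c' -> K c <= K c'.
    move=> JJ; have [_ /andP[h1 h2]] := JK c; have [_ /andP[h3 h4]] := JK c'.
    have c1 : c%:R * t <= T0 by rewrite -tn ler_pM2r// ler_nat ltnW.
    have c'0 : 0 <= c'%:R * t by rewrite mulr_ge0// ltW.
    by rewrite -ltzD1 -(ltr_int R) intrD; rewrite JJ in h2; lra.
  rewrite -big_filter (_ : len = (iter (N + j) G x1 + (K c0)%:~R) - (iter (N + j) G x0 + (K c0)%:~R)); last first.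
    by rewrite /len; ring.
  apply: (disjoint_sum_le (I := 'I_(2 ^ n)) (x := fun c : 'I_(2 ^ n) => psi (y0 + c%:R * t))
    (y := fun c : 'I_(2 ^ n) => psi (y0 + c.+1%:R * t))).
  - by rewrite lerD2r -subr_ge0.
  - by rewrite filter_uniq// index_enum_uniq.
  - move=> c; rewrite mem_filter => /andP[/JcE Jc _].
    have [s1 s2 _] := sub c (ltn_ord c).
    have KK : K c = K c0 by apply/eqP; rewrite eq_le !Kle// Jc Jc0.
    by rewrite -Jc -KK; split=> //; rewrite -subr_gt0; exact: l0.
  - move=> c c' _ _ cc'; have mono (i i' : nat) : (i < i')%N ->
        psi (y0 + i.+1%:R * t) <= psi (y0 + i'%:R * t).
      by move=> h; apply: (psi_le S); rewrite lerD2l ler_pM2r// ler_nat.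
    move: cc'; rewrite -(inj_eq val_inj) neq_ltn => /orP[h|h]; [left|right]; exact: mono.
have lle (c : 'I_(2 ^ n)) : J' c == j -> l c <= len.
  move=> cj; apply: le_trans suml; rewrite (bigD1 c)//= lerDl.
  by apply: sumr_ge0 => i _; exact: ltW.
apply: (@le_trans _ _ (\sum_(c < 2 ^ n | J' c == j) l c * len)).
  apply: ler_sum => c cj; rewrite expr2 -/(l c); apply: ler_wpM2l; [exact: ltW|exact: lle].
by rewrite -mulr_suml expr2 ler_wpM2r.
Qed.

End OneReturn.

Lemma cell_sq_power_bound : exists B, forall N d s kN n,
  closest_return rho N d s kN -> d <= d0 -> T0 / 2 ^+ n <= d ->
  cell_sq psi y0 (T0 / 2 ^+ n) (2 ^ n) <= B * d `^ al.
Proof. by exists const => N d s kN n C dd0; exact: cell_sq_upper C dd0 n. Qed.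

End CellUpperBound.

(** * Maps with a break *)

Section Regularity.
Context {R : realType}.
Implicit Types (f g : R -> R) (a b x y l : R).

Lemma near_oo a b x : a < x -> x < b -> \near x, a < x /\ x < b.
Proof.
move=> ax xb; have := @near_in_itvoo R a b x; rewrite in_itv/= ax xb => /(_ isT).
by apply: filterS => y; rewrite in_itv/= => /andP[].
Qed.

Lemma is_derive_seg_oo a b f x l : a < x -> x < b ->
  is_derive_seg a b f x l -> is_derive x 1 f l.
Proof.
move=> ax xb hd.
suff cv : h^-1 *: ((f \o shift x) (h *: 1) - f x) @[h --> 0^'] --> l.
  by apply: DeriveDef; [exact: cvgP cv|exact: cvg_lim cv].
apply/cvgrPdist_lt => e e0; move/cvgrPdist_lt/(_ e e0): hd.
rewrite !near_withinE => /nbhs_ballP[r /= r0 hr].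
have [r' /= r'0 hr'] := (nbhs_ballP _ _).1 (near_oo ax xb).
apply/nbhs_ballP; exists (Num.min r r'); first by rewrite /= lt_min r0.
move=> h; rewrite /ball/= sub0r normrN lt_min => /andP[h1 h2] hn0.
have hx : x - (h + x) = - h by ring.
have [a1 a2] := hr' (h + x) (ltac:(by rewrite /ball/= hx normrN)).
have := hr (h + x) (ltac:(by rewrite /ball/= hx normrN)) (ltac:(by rewrite -subr_eq0 addrK)).
rewrite /= in_itv/= !ltW// => /(_ isT); rewrite addrK /shift/= /GRing.scale/= mulr1.
by rewrite [_^-1 * _]mulrC.
Qed.

Lemma is_derive_continuous f x l : is_derive x 1 f l -> {for x, continuous f}.
Proof. by move=> [d _]; apply/differentiable_continuous/derivable1_diffP. Qed.

Lemma is_derive1E f x l : is_derive x 1 f l -> derive1 f x = l.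
Proof. by move=> [_ <-]; rewrite derive1E. Qed.

Lemma derivable_is_derive1 f x : derivable f x 1 -> is_derive x 1 f (derive1 f x).
Proof. by move=> d; rewrite derive1E; exact: derivableP. Qed.

Lemma circle_homeo_surj f y : circle_homeo f -> exists x, f x = y.
Proof.
move=> [fc fi fp]; pose k := Num.floor (y - f 0).
have := floor_itv (y - f 0); rewrite -/k => /andP[k1 k2].
have e1 := liftDz fp 0 k; have e2 := liftDz fp 0 (k + 1); rewrite !add0r in e1 e2.
have le : (k%:~R : R) <= (k + 1)%:~R by rewrite ler_int lerDl.
have fI : Num.min (f k%:~R) (f (k + 1)%:~R) <= y <= Num.max (f k%:~R) (f (k + 1)%:~R).
  by rewrite e1 e2 ge_min le_max; apply/andP; split; apply/orP; [left|right]; lra.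
by have [x _ <-] := IVT le (continuous_subspaceT fc) fI; exists x.
Qed.

Lemma compact_bounds f a b : a <= b -> (forall x, a <= x <= b -> {for x, continuous f}) ->
  exists m M, forall x, a <= x <= b -> [/\ m <= f x, f x <= M,
    (exists2 x0, a <= x0 <= b & f x0 = m) & (exists2 x1, a <= x1 <= b & f x1 = M)].
Proof.
move=> ab fc.
have cc : {within `[a, b], continuous f}.
  by apply: continuous_in_subspaceT => x; rewrite inE/= in_itv/= => /fc.
have [x1 x1I max] := EVT_max ab cc; have [x0 x0I min] := EVT_min ab cc.
rewrite !in_itv/= in x0I x1I.
exists (f x0), (f x1) => x xI; split; [exact: min|exact: max|by exists x0|by exists x1].
Qed.

End Regularity.

Section SegmentDerivatives.
Context {R : realType} (p c : R) (F : R -> R).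
Hypothesis BF : class_B 3 p c F.
Hypothesis schw : forall x, ~ circle_eq x p -> schwarzian F x < 0.
Implicit Types (a b x : R).

Lemma open_cell_not_p (k : int) x : p + k%:~R < x -> x < p + k%:~R + 1 -> ~ circle_eq x p.
Proof.
move=> h1 h2; rewrite /circle_eq => /intrP[m e].
have k1 : (k%:~R : R) < m%:~R by lra.
have k2 : (m%:~R : R) < (k + 1)%:~R by rewrite intrD; lra.
by move: k1 k2; rewrite !ltr_int; lia.
Qed.

Lemma class_B_derivatives : exists F2 F3 : R -> R, forall x, p < x -> x < p + 1 ->
  [/\ is_derive x 1 F (derive1 F x), 0 < derive1 F x,
      is_derive x 1 (derive1 F) (F2 x), is_derive x 1 F2 (F3 x) /\ {for x, continuous F3} &
      F3 x / derive1 F x - 3 / 2 * (F2 x / derive1 F x) ^+ 2 < 0].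
Proof.
have [_ [F1 [d1 [F2 [d2 [F3 [d3 c3]]]]]] pos _] := BF.
have d1' x : p < x -> x < p + 1 -> is_derive x 1 F (F1 x).
  by move=> h1 h2; apply: (is_derive_seg_oo h1 h2); apply: d1; rewrite in_itv/= !ltW.
have d2' x : p < x -> x < p + 1 -> is_derive x 1 F1 (F2 x).
  by move=> h1 h2; apply: (is_derive_seg_oo h1 h2); apply: d2; rewrite in_itv/= !ltW.
have d3' x : p < x -> x < p + 1 -> is_derive x 1 F2 (F3 x).
  by move=> h1 h2; apply: (is_derive_seg_oo h1 h2); apply: d3; rewrite in_itv/= !ltW.
have e1 x : p < x -> x < p + 1 -> derive1 F x = F1 x.
  by move=> h1 h2; apply/is_derive1E/d1'.
have dd1 x : p < x -> x < p + 1 -> is_derive x 1 (derive1 F) (F2 x).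
  move=> h1 h2; apply: (@near_eq_is_derive _ _ _ F1); last exact: d2'.
  by have := near_oo h1 h2; apply: filterS => z [z1 z2]; rewrite e1.
have dd2 x : p < x -> x < p + 1 -> is_derive x 1 (derive1 (derive1 F)) (F3 x).
  move=> h1 h2; apply: (@near_eq_is_derive _ _ _ F2); last exact: d3'.
  by have := near_oo h1 h2; apply: filterS => z [z1 z2]; rewrite (is_derive1E (dd1 _ z1 z2)).
exists F2, F3 => x h1 h2; split.
- by rewrite e1//; exact: d1'.
- have xI : x \in `[p, p + 1] by rewrite in_itv/= !ltW.
  have [d d0 hd] := pos x xI.
  by rewrite (is_derive1E (is_derive_seg_oo h1 h2 hd)).
- exact: dd1.
- split; first exact: d3'.
  have p1 : p < p + 1 by rewrite ltrDl.
  have [ci _ _] := (continuous_within_itvP F3 p1).1 c3.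
  by apply: ci; rewrite in_itv/= h1.
- have := schw (@open_cell_not_p 0 x (ltac:(lra)) (ltac:(lra))).
  rewrite /schwarzian /derive1n/=.
  by rewrite (is_derive1E (dd2 _ h1 h2)) (is_derive1E (dd1 _ h1 h2)).
Qed.

End SegmentDerivatives.

Lemma is_derive_shift_lift {R : realType} (f : R -> R) (k : int) (x l : R) :
  (forall y, f (y + 1) = f y + 1) -> is_derive (x + k%:~R) 1 f l -> is_derive x 1 f l.
Proof.
move=> fper d; have -> : f = (f \o shift k%:~R) - cst k%:~R.
  by apply/funext => y; rewrite fctE /= liftDz// addrK.
have d1 : is_derive x 1 (f \o shift k%:~R) (l * 1).
  by apply: is_derive1_comp => //; exact: is_derive_shift.
have d2 := is_deriveB d1 (is_derive_cst (k%:~R : R) x (1 : R)).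
by apply: (@is_derive_eq _ _ _ _ _ _ _ _ d2); rewrite mulr1 subr0.
Qed.

Section CompactGap.
Context {R : realType} (p c : R) (F : R -> R).
Hypothesis BF : class_B 3 p c F.
Hypothesis schw : forall x, ~ circle_eq x p -> schwarzian F x < 0.

(** On a compact interval off the break the continuous function [S(F)] has a negative maximum; the
    constant may degenerate as the interval approaches [p]. *)
Lemma schwarzian_gap_compact (l r : R) : p < l -> l <= r -> r < p + 1 ->
  exists2 kp, 0 < kp & forall a b, l <= a -> a < b -> b <= r ->
    (1 + kp * (b - a) ^+ 2) * ((b - a) ^+ 2 * (derive1 F a * derive1 F b)) <=
    (F b - F a) ^+ 2.
Proof.
move=> pl lr rp; have [F2 [F3 dF]] := class_B_derivatives BF schw.
have inI x : l <= x <= r -> p < x /\ x < p + 1 by move=> h; lra.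
pose v x := (Num.sqrt (derive1 F x))^-1.
have cv x : l <= x <= r -> {for x, continuous v}.
  move=> /inI[h1 h2]; have [_ F10 d1 _ _] := dF _ h1 h2.
  exact: is_derive_continuous (is_derive_sqrtV d1 F10).
pose sw x := F3 x / derive1 F x - 3 / 2 * (F2 x / derive1 F x * (F2 x / derive1 F x)).
have cs x : l <= x <= r -> {for x, continuous sw}.
  move=> /inI[h1 h2]; have [_ F10 d1 [d2 c3] _] := dF _ h1 h2.
  have c1 := is_derive_continuous d1; have c2 := is_derive_continuous d2.
  have cV : (derive1 F y)^-1 @[y --> x] --> (derive1 F x)^-1.
    by apply: cvgV => //; rewrite gt_eqF.
  have c21 : F2 y / derive1 F y @[y --> x] --> F2 x / derive1 F x by exact: cvgM c2 cV.
  have cq : F2 y / derive1 F y * (F2 y / derive1 F y) @[y --> x] -->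
      F2 x / derive1 F x * (F2 x / derive1 F x) by exact: (cvgM c21 c21).
  apply: cvgB; first exact: cvgM c3 cV.
  exact: cvgM (cvg_cst _) cq.
have [v0 [V hv]] := compact_bounds lr cv.
have [m [M hs]] := compact_bounds lr cs.
have Il : l <= l <= r by rewrite lexx.
have v00 : 0 < v0.
  have [_ _ [x0 h <-] _] := hv _ Il; have [h1 h2] := inI _ h.
  by have [_ F10 _ _ _] := dF _ h1 h2; rewrite invr_gt0 sqrtr_gt0.
have V0 : 0 < V by have [h1 h2 _ _] := hv _ Il; lra.
have M0 : M < 0.
  have [_ _ _ [x0 h <-]] := hs _ Il; have [h1 h2] := inI _ h.
  by have [_ _ _ _ +] := dF _ h1 h2; rewrite /sw expr2.
exists ((- M) * v0 ^+ 3 / (24 * V ^+ 3)).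
  by rewrite divr_gt0 ?mulr_gt0 ?exprn_gt0// oppr_gt0.
move=> a b la ab br.
apply: (@schwarzian_gap _ F (derive1 F) F2 F3 a b (- M) v0 V) => //.
- by rewrite oppr_ge0 ltW.
- by move=> x h; have [h1 h2] := inI x (ltac:(lra)); have [] := dF _ h1 h2.
- by move=> x h; have [h1 h2] := inI x (ltac:(lra)); have [] := dF _ h1 h2.
- by move=> x h; have [h1 h2] := inI x (ltac:(lra)); have [_ _ _ []] := dF _ h1 h2.
- by move=> x h; have [h1 h2] := inI x (ltac:(lra)); have [] := dF _ h1 h2.
- by move=> x h; have [-> -> _ _] := hv x (ltac:(lra)).
- by move=> x h; have [_ + _ _] := hs x (ltac:(lra)); rewrite /sw expr2 opprK.
Qed.

End CompactGap.

(** * Normal form of a linear fractional map with a break *)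

Section LinearFractional.
Context {R : realType} (p c : R) (G : R -> R).
Hypotheses (c_gt0 : 0 < c) (c_neq1 : c != 1).
Hypothesis BG : class_B 3 p c G.
Hypothesis LG : linear_fractional p G.

Let Gper x : G (x + 1) = G x + 1. Proof. by have [[_ _ +] _ _ _] := BG; apply. Qed.

Lemma sqrt_break_neq1 : Num.sqrt c != 1.
Proof.
apply: contra c_neq1 => /eqP h.
by rewrite -[c]sqr_sqrtr ?(ltW c_gt0)// h expr1n.
Qed.

(** With denominator [q] one has [G' = D / q^2], so the break size is [(q p / q (p + 1))^2] and the
    quotient is a square root of [c]. It is the positive one as [q] has no zero on the cell, and
    [G (p + 1) = G p + 1] determines [D]. *)
Lemma linear_fractional_diff (k : int) (u v : R) :
  p + k%:~R <= u -> u <= v -> v <= p + k%:~R + 1 ->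
  let sg := Num.sqrt c in
  (G v - G u) * ((sg + (1 - sg) * (u - k%:~R - p)) *
                 (sg + (1 - sg) * (v - k%:~R - p))) = sg * (v - u).
Proof.
have [a [b [a' [b' [D0 h]]]]] := LG.
pose q x := a' * x + b'; pose D := a * b' - b * a'.
have hq x : p <= x -> x <= p + 1 -> q x != 0 /\ G x = (a * x + b) / q x.
  by move=> h1 h2; apply: h; rewrite in_itv/= h1.
have dG x : p < x -> x < p + 1 -> is_derive x 1 G (D / q x ^+ 2).
  move=> h1 h2; have [qx _] := hq x (ltW h1) (ltW h2).
  have da := is_deriveD (is_deriveZ a (is_derive_id x (1 : R))) (is_derive_cst b x (1 : R)).
  have dq := is_deriveD (is_deriveZ a' (is_derive_id x (1 : R))) (is_derive_cst b' x (1 : R)).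
  have qx' : (a' \*: id + cst b') x != 0 :> R by [].
  have dd := is_deriveM da (is_deriveV qx' dq).
  apply: (@near_eq_is_derive _ _ _ ((a \*: id + cst b) * (fun y => ((a' \*: id + cst b') y)^-1))).
    have := near_oo h1 h2; apply: filterS => z [z1 z2].
    by have [_ ->] := hq z (ltW z1) (ltW z2).
  apply: (@is_derive_eq _ _ _ _ _ _ _ _ dd); rewrite ?fctE /= /GRing.scale/= -/(q x) /D.
  by rewrite /q in qx *; field.
have p1 : p < p + 1 by rewrite ltrDl.
have [qp Gp] := hq p (lexx _) (ltW p1).
have [qp1 Gp1] := hq (p + 1) (ltW p1) (lexx _).
have [_ _ _ [dl [dr [Hl Hr cE]]]] := BG.
have qc x : q y @[y --> x] --> q x.
  by apply: cvgD; [apply: cvgM; [exact: cvg_cst|exact: cvg_id]|exact: cvg_cst].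
have drE : dr = D / q p ^+ 2.
  have c1 : D / q x ^+ 2 @[x --> p^'+] --> D / q p ^+ 2.
    apply: cvg_at_right_filter; apply: cvgM; first exact: cvg_cst.
    apply: cvgV; first by rewrite expf_neq0.
    by rewrite expr2; under eq_fun do rewrite expr2; apply: cvgM; exact: qc.
  have c2 : derive1 G x @[x --> p^'+] --> D / q p ^+ 2.
    apply: cvg_trans c1; apply: near_eq_cvg; near=> x.
    have x1 : p < x by near: x; exact: nbhs_right_gt.
    have x2 : x < p + 1 by near: x; exact: nbhs_right_lt.
    by rewrite (is_derive1E (dG _ x1 x2)).
  exact: (cvg_unique _ Hr c2).
have dlE : dl = D / q (p + 1) ^+ 2.
  have c1 : D / q (x + 1) ^+ 2 @[x --> p^'-] --> D / q (p + 1) ^+ 2.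
    apply: cvg_at_left_filter; apply: cvgM; first exact: cvg_cst.
    apply: cvgV; first by rewrite expf_neq0.
    have qs : q (y + 1) @[y --> p] --> q (p + 1).
      apply: cvgD; last exact: cvg_cst.
      by apply: cvgM; [exact: cvg_cst|apply: cvgD; [exact: cvg_id|exact: cvg_cst]].
    by rewrite expr2; under eq_fun do rewrite expr2; apply: cvgM.
  have c2 : derive1 G x @[x --> p^'-] --> D / q (p + 1) ^+ 2.
    apply: cvg_trans c1; apply: near_eq_cvg; near=> x.
    have x1 : p - 1 < x by near: x; apply: nbhs_left_gt; rewrite ltrBlDr.
    have x2 : x < p by near: x; exact: nbhs_left_lt.
    suff dE : is_derive x 1 G (D / q (x + 1) ^+ 2) by rewrite (is_derive1E dE).
    apply: (@is_derive_shift_lift _ G 1) => //; apply: dG; rewrite mulr1z; lra.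
  exact: (cvg_unique _ Hl c2).
have D00 : D != 0 by [].
have cq : c = (q p / q (p + 1)) ^+ 2 by rewrite -cE drE dlE; field; rewrite D00 qp qp1.
have qpos : 0 < q p / q (p + 1).
  rewrite lt_neqAle eq_sym mulf_neq0 ?invr_neq0//= leNgt; apply/negP => neg.
  have neg' : q p * q (p + 1) < 0.
    have : 0 < q (p + 1) ^+ 2 by rewrite lt0r sqr_ge0 expf_neq0.
    move=> s0; have := neg; rewrite -(pmulr_llt0 _ s0).
    by rewrite (_ : q p / q (p + 1) * q (p + 1) ^+ 2 = q p * q (p + 1))//; field.
  (* If the end values had opposite signs, the affine [q] would vanish at [p + t]. *)
  pose t := q p / (q p - q (p + 1)).
  have dq0 : q p - q (p + 1) != 0.
    apply/eqP => e; have e' : q (p + 1) = q p by lra.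
    by have := sqr_ge0 (q p); move: neg'; rewrite e' expr2; lra.
  have dq2 : 0 < (q p - q (p + 1)) ^+ 2 by rewrite lt0r sqr_ge0 expf_neq0.
  have tE : t = (q p * (q p - q (p + 1))) / (q p - q (p + 1)) ^+ 2 by rewrite /t; field.
  have t0 : 0 <= t.
    by rewrite tE divr_ge0 ?(ltW dq2)//; have := sqr_ge0 (q p); rewrite expr2; lra.
  have t1 : t <= 1.
    rewrite tE ler_pdivrMr// mul1r; have := sqr_ge0 (q (p + 1)); rewrite !expr2; lra.
  have [+ _] := hq (p + t) (ltac:(lra)) (ltac:(lra)).
  have -> : q (p + t) = q p - t * (q p - q (p + 1)) by rewrite /q; ring.
  by rewrite /t mulfVK// subrr eqxx.
have sgE : Num.sqrt c = q p / q (p + 1) by rewrite cq sqrtr_sqr gtr0_norm.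
move=> h1 h2 h3 /=; set sg := Num.sqrt c in sgE *.
have qsg : q p = sg * q (p + 1) by rewrite sgE mulfVK.
have DE : D = sg * q (p + 1) ^+ 2.
  have := Gper p; rewrite Gp Gp1 => e.
  have : (a * (p + 1) + b) / q (p + 1) - (a * p + b) / q p = 1 by rewrite e; ring.
  have -> : (a * (p + 1) + b) / q (p + 1) - (a * p + b) / q p = D / (q p * q (p + 1)).
    by rewrite /D; rewrite /q in qp qp1 *; field; rewrite qp qp1.
  move/(congr1 (fun z => z * (q p * q (p + 1)))); rewrite mulfVK ?mulf_neq0// mul1r => ->.
  by rewrite qsg; ring.
have qE x : q x = q (p + 1) * (sg + (1 - sg) * (x - p)).
  have -> : q x = q p + (q (p + 1) - q p) * (x - p) by rewrite /q; ring.
  by rewrite qsg; ring.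
have [qu Gu] := hq (u - k%:~R) (ltac:(lra)) (ltac:(lra)).
have [qv Gv] := hq (v - k%:~R) (ltac:(lra)) (ltac:(lra)).
have Ku : G u = G (u - k%:~R) + k%:~R by rewrite -(liftDz Gper) subrK.
have Kv : G v = G (v - k%:~R) + k%:~R by rewrite -(liftDz Gper) subrK.
have -> : G v - G u = D * (v - u) / (q (u - k%:~R) * q (v - k%:~R)).
  rewrite Ku Kv Gu Gv /D; rewrite /q in qu qv *; field; first by rewrite qu qv.
rewrite DE; move: qu qv; rewrite (qE (u - k%:~R)) (qE (v - k%:~R)).
set wu := sg + _; set wv := sg + (1 - sg) * (v - _ - _) => wu0 wv0.
have wu' : wu != 0 by apply: contra wu0 => /eqP->; rewrite mulr0.
have wv' : wv != 0 by apply: contra wv0 => /eqP->; rewrite mulr0.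
by field; rewrite wu' wv' qp1.
Unshelve. all: by end_near. Qed.

Lemma linear_fractional_moebius (rho : R) (phi psi : R -> R) :
  {homo phi : x y / x <= y} -> (forall x, phi (x + 1) = phi x + 1) ->
  (forall x, phi (G x) = phi x + rho) -> phi p = 0 -> cancel psi phi ->
  moebius_lift p (Num.sqrt c) rho G phi psi.
Proof.
move=> h1 h2 h3 h4 h5; have [hom _ _ _] := BG; have [_ inc _] := hom.
split=> //; first by rewrite sqrtr_gt0.
- exact: sqrt_break_neq1.
- by move=> y; exact: circle_homeo_surj.
- exact: linear_fractional_diff.
Qed.

End LinearFractional.

(** * The conjugacy *)

Lemma int_valued_cst {R : realType} (f : R -> R) :
  continuous f -> (forall x, f x \is a Num.int) -> forall x, f x = f 0.
Proof.
move=> fc fi x; apply: contrapT => /eqP neq.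
wlog: f fc fi neq / f x < f 0 => [wl|lt].
  move: (neq); rewrite neq_lt => /orP[|lt]; first exact: wl.
  apply: (wl (- f)); rewrite ?fctE ?eqr_opp ?ltrN2//.
    by move=> z; apply: cvgN; exact: fc.
  by move=> z; rewrite rpredN.
have [m mE] := intrP (fi x); have [n nE] := intrP (fi 0).
have mn : m%:~R + 1 <= n%:~R :> R.
  by rewrite -(intrD _ m 1) ler_int lezD1 -(ltr_int R) -mE -nE.
have [z fz] : exists z, f z = m%:~R + 2^-1.
  have cc a b : {within `[a, b], continuous f} by exact: continuous_subspaceT.
  have [x0|x0] := leP x 0.
    have [|z _ <-] := @IVT R f x 0 (m%:~R + 2^-1) x0 (cc _ _); last by exists z.
    by rewrite ge_min le_max mE nE; apply/andP; split; apply/orP; [left|right]; lra.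
  have [|z _ <-] := @IVT R f 0 x (m%:~R + 2^-1) (ltW x0) (cc _ _); last by exists z.
  by rewrite ge_min le_max mE nE; apply/andP; split; apply/orP; [right|left]; lra.
have [q qE] := intrP (fi z); have e : q%:~R = m%:~R + 2^-1 :> R by rewrite -qE.
have q1 : (m%:~R : R) < q%:~R by lra.
have q2 : (q%:~R : R) < (m + 1)%:~R by rewrite intrD; lra.
by move: q1 q2; rewrite !ltr_int; clear; lia.
Qed.

Section DiffeoBounds.
Context {R : realType} (H : R -> R).
Hypothesis HD : circle_diffeo H.

Lemma diffeo_derive1_gt0 x : 0 < derive1 H x.
Proof.
have [[_ inc _] [dH _] [Hi [HK _ [dHi _]]]] := HD.
rewrite lt0r; apply/andP; split.
  apply/eqP => e0.
  have d1 := derivable_is_derive1 (dH x); have d2 := derivable_is_derive1 (dHi (H x)).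
  have d3 := is_derive1_comp d2 d1.
  have d4 : is_derive x 1 (Hi \o H) 1.
    by rewrite (_ : Hi \o H = id); [exact: is_derive_id|apply/funext => z; exact: HK].
  by have := is_derive1E d3; rewrite (is_derive1E d4) e0 mulr0 => /eqP; rewrite oner_eq0.
apply: (@incr_derive1_ge0 _ H setT); first by move=> z _; exact: dH.
  by move=> y z _ _; exact: inc.
by rewrite interiorT.
Qed.

Lemma diffeo_derive1_shift x (k : int) : derive1 H (x + k%:~R) = derive1 H x.
Proof.
have [[_ _ per] [dH _] _] := HD; apply/esym/is_derive1E.
exact: is_derive_shift_lift per (derivable_is_derive1 (dH _)).
Qed.

Lemma diffeo_derive1_bounds : exists h0 h1, 0 < h0 /\
  forall x, h0 <= derive1 H x <= h1.
Proof.
have [_ [_ cH] _] := HD.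
have [m [M h]] := compact_bounds (ler01 : (0 : R) <= 1) (fun x _ => cH x).
have I0 : (0 <= (0 : R)) && ((0 : R) <= 1) by apply/andP; split.
exists m, M; split.
  by have [_ _ [x0 _ <-] _] := h 0 I0; exact: diffeo_derive1_gt0.
move=> x; have /andP[f1 f2] := floor_itv x; rewrite intrD in f2.
have := diffeo_derive1_shift (x - (Num.floor x)%:~R) (Num.floor x).
by rewrite subrK => ->; have [-> ->] := h (x - (Num.floor x)%:~R) (ltac:(lra)).
Qed.

End DiffeoBounds.

Section MoebiusDerivative.
Context {R : realType} (p sg rho : R) (G phi psi : R -> R).
Hypothesis S : moebius_lift p sg rho G phi psi.
Implicit Types (x y u v : R) (k : int).

Definition cell_weight y : R := sg + (1 - sg) * (y - p).

Lemma cell_weight_gt0 y : p < y -> y < p + 1 -> 0 < cell_weight y.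
Proof.
move=> h1 h2; have sg0 := ml_sg_gt0 S.
have : 0 < sg * (p + 1 - y) by rewrite mulr_gt0// subr_gt0.
by rewrite /cell_weight; lra.
Qed.

Lemma moebius_is_derive k y : p + k%:~R < y -> y < p + k%:~R + 1 ->
  is_derive y 1 G (sg / cell_weight (y - k%:~R) ^+ 2).
Proof.
move=> h1 h2; have sg0 := ml_sg_gt0 S.
set wy := cell_weight _.
have wy0 : 0 < wy by apply: cell_weight_gt0; lra.
pose wt z := wy + (1 - sg) * (z - y).
have wE z : cell_weight (z - k%:~R) = wt z by rewrite /wt /wy /cell_weight; ring.
have da := is_deriveB (is_derive_id y (1 : R)) (is_derive_cst y y (1 : R)).
have db := is_deriveD (is_derive_cst wy y (1 : R)) (is_deriveZ (1 - sg) da).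
have nz : (cst wy + ((1 - sg) \*: (id - cst y))) y != 0 :> R.
  have -> : (cst wy + ((1 - sg) \*: (id - cst y))) y = wy + (1 - sg) * (y - y) :> R by [].
  by rewrite subrr mulr0 addr0 gt_eqF.
have dc := is_deriveZ (sg / wy) (is_deriveM da (is_deriveV nz db)).
have dd := is_deriveD (is_derive_cst (G y) y (1 : R)) dc.
apply: (near_eq_is_derive _ (is_derive_eq dd _)).
  have := near_oo h1 h2; apply: filterS => z [z1 z2].
  rewrite !fctE /= /GRing.scale/= -/(wt z).
  have wz0 : 0 < wt z by rewrite -wE; apply: cell_weight_gt0; lra.
  have [yz|zy] := leP y z.
    have := ml_moebius S (ltW h1) yz (ltW z2).
    rewrite -/(cell_weight (z - k%:~R)) -/(cell_weight (y - k%:~R)) -/wy wE => e.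
    have -> : G z = G y + (G z - G y) * (wy * wt z) / (wy * wt z).
      by rewrite mulfK ?mulf_neq0 ?gt_eqF//; ring.
    by rewrite e; field; rewrite !gt_eqF.
  have := ml_moebius S (ltW z1) (ltW zy) (ltW h2).
  rewrite -/(cell_weight (z - k%:~R)) -/(cell_weight (y - k%:~R)) -/wy wE => e.
  have -> : G z = G y - (G y - G z) * (wt z * wy) / (wt z * wy).
    by rewrite mulfK ?mulf_neq0 ?gt_eqF//; ring.
  by rewrite e; field; rewrite !gt_eqF.
by rewrite !fctE /= /GRing.scale/=; field; rewrite gt_eqF.
Qed.

Lemma moebius_cross_ratio k u v : p + k%:~R < u -> u < v -> v < p + k%:~R + 1 ->
  (G v - G u) ^+ 2 = (v - u) ^+ 2 * (derive1 G u * derive1 G v).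
Proof.
move=> h1 h2 h3.
rewrite (is_derive1E (moebius_is_derive h1 (lt_trans h2 h3))).
rewrite (is_derive1E (moebius_is_derive (lt_trans h1 h2) h3)).
have := ml_moebius S (ltW h1) (ltW h2) (ltW h3).
rewrite -/(cell_weight (u - k%:~R)) -/(cell_weight (v - k%:~R)).
have : 0 < cell_weight (u - k%:~R) by apply: cell_weight_gt0; lra.
have : 0 < cell_weight (v - k%:~R) by apply: cell_weight_gt0; lra.
set wu := cell_weight (u - k%:~R); set wv := cell_weight (v - k%:~R) => wv0 wu0 e.
have -> : G v - G u = sg * (v - u) / (wu * wv).
  by rewrite -e mulfK// mulf_neq0 ?gt_eqF.
by field; rewrite !gt_eqF.
Qed.

Lemma moebius_derive1_gt0 k y : p + k%:~R < y -> y < p + k%:~R + 1 -> 0 < derive1 G y.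
Proof.
move=> h1 h2; rewrite (is_derive1E (moebius_is_derive h1 h2)) divr_gt0 ?(ml_sg_gt0 S)//.
by apply: exprn_gt0; apply: cell_weight_gt0; lra.
Qed.

Lemma moebius_derive1_continuous k y : p + k%:~R < y -> y < p + k%:~R + 1 ->
  {for y, continuous (derive1 G)}.
Proof.
move=> h1 h2.
have w0 : cell_weight (y - k%:~R) != 0 by rewrite gt_eqF//; apply: cell_weight_gt0; lra.
have wc : cell_weight (z - k%:~R) @[z --> y] --> cell_weight (y - k%:~R).
  apply: cvgD; first exact: cvg_cst.
  apply: cvgM; first exact: cvg_cst.
  by apply: cvgB; [apply: cvgB; [exact: cvg_id|exact: cvg_cst]|exact: cvg_cst].
have gc : sg / cell_weight (z - k%:~R) ^+ 2 @[z --> y] --> sg / cell_weight (y - k%:~R) ^+ 2.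
  apply: cvgM; first exact: cvg_cst.
  apply: cvgV; first by rewrite expf_neq0.
  by rewrite expr2; under eq_fun do rewrite expr2; exact: (cvgM wc wc).
rewrite /prop_for /continuous_at (is_derive1E (moebius_is_derive h1 h2)).
apply: cvg_trans gc; apply: near_eq_cvg; have := near_oo h1 h2; apply: filterS => z [z1 z2].
by rewrite (is_derive1E (moebius_is_derive z1 z2)).
Qed.

End MoebiusDerivative.

Section Conjugacy.
Context {R : realType} (p c sg rho : R) (F G H phi psi : R -> R).
Hypothesis S : moebius_lift p sg rho G phi psi.
Hypotheses (c_gt0 : 0 < c) (c_neq1 : c != 1).
Hypothesis BF : class_B 3 p c F.
Hypothesis schw : forall x, ~ circle_eq x p -> schwarzian F x < 0.
Hypothesis Gc : continuous G.
Hypothesis HD : circle_diffeo H.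
Hypothesis conj : forall x, circle_eq (H (F x)) (G (H x)).
Implicit Types (x y u v : R) (k : int).

Let Fc : continuous F. Proof. by have [[]] := BF. Qed.
Let Fper x : F (x + 1) = F x + 1. Proof. by have [[_ _ +] _ _ _] := BF; apply. Qed.
Let Hc : continuous H. Proof. by have [[]] := HD. Qed.
Let Hinc : {homo H : x y / x < y}. Proof. by have [[]] := HD. Qed.
Let Hper x : H (x + 1) = H x + 1. Proof. by have [[_ _ +] _ _] := HD; apply. Qed.
Let dH x : is_derive x 1 H (derive1 H x).
Proof. by have [_ [d _] _] := HD; exact: derivable_is_derive1. Qed.

Lemma conj_shift : exists k0, forall x, H (F x) = G (H x) + k0%:~R.
Proof.
have cc : continuous (fun x => H (F x) - G (H x)).
  move=> x; apply: cvgB.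
    by apply: continuous_comp; [exact: Fc|exact: Hc].
  by apply: continuous_comp; [exact: Hc|exact: Gc].
have [k0 k0E] := intrP (conj 0); exists k0 => x.
have := int_valued_cst cc conj x; rewrite k0E; lra.
Qed.

Lemma break_lift_derive k x : p + k%:~R < x -> x < p + k%:~R + 1 ->
  is_derive x 1 F (derive1 F x) /\ 0 < derive1 F x.
Proof.
move=> h1 h2; have [F2 [F3 dF]] := class_B_derivatives BF schw.
have [d1 d0 _ _ _] := dF (x - k%:~R) (ltac:(lra)) (ltac:(lra)).
have d2 : is_derive x 1 F (derive1 F (x - k%:~R)).
  by apply: (@is_derive_shift_lift _ F (- k) _ _ Fper); rewrite mulrNz.
by rewrite (is_derive1E d2).
Qed.

Lemma conj_chain k k' x : p + k%:~R < x -> x < p + k%:~R + 1 ->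
  p + k'%:~R < H x -> H x < p + k'%:~R + 1 ->
  derive1 H (F x) * derive1 F x = derive1 G (H x) * derive1 H x.
Proof.
move=> h1 h2 h3 h4; have [k0 E] := conj_shift.
have [dF _] := break_lift_derive h1 h2.
have dG := moebius_is_derive S h3 h4.
have d1 := is_derive1_comp (dH (F x)) dF.
have d2 := is_deriveD (is_derive1_comp dG (dH x)) (is_derive_cst (k0%:~R : R) x (1 : R)).
rewrite (is_derive1E dG) -(is_derive1E d1) -[RHS]addr0 -(is_derive1E d2).
by congr (derive1 _ _); apply/funext => z; rewrite fctE /= E.
Qed.

(** If [G] were smooth at [H p], the chain rule would express [F'] near [p] by the continuous
    function [Q], and the one-sided limits of [F'] at [p] would agree, against [c != 1]. *)
Lemma conj_break : exists l : int, H p = p + l%:~R.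
Proof.
pose k := Num.floor (H p - p); have := floor_itv (H p - p).
rewrite -/k intrD => /andP[k1 k2]; exists k.
apply: contrapT => neq.
have h1 : p + k%:~R < H p.
  by rewrite lt_neqAle eq_sym; apply/andP; split; [apply/eqP|lra].
have h2 : H p < p + k%:~R + 1 by lra.
pose Q x := derive1 G (H x) * derive1 H x / derive1 H (F x).
have cH1 : continuous (derive1 H) by have [_ []] := HD.
have Hne x : derive1 H x != 0 by rewrite gt_eqF// diffeo_derive1_gt0.
have Qc : Q x @[x --> p] --> Q p.
  apply: cvgM; first apply: cvgM.
  - apply: (@cvg_comp _ _ _ H (derive1 G) _ (nbhs (H p))); first exact: Hc.
    exact: (moebius_derive1_continuous S h1 h2).
  - exact: cH1.
  - apply: cvgV => //; apply: (@cvg_comp _ _ _ F (derive1 H) _ (nbhs (F p))); first exact: Fc.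
    exact: cH1.
have nearH : \forall x \near p, p + k%:~R < H x /\ H x < p + k%:~R + 1.
  have hc : H x @[x --> p] --> H p := @Hc p; exact: hc _ (near_oo h1 h2).
have FQ (j : int) x : p + j%:~R < x -> x < p + j%:~R + 1 ->
    p + k%:~R < H x /\ H x < p + k%:~R + 1 -> Q x = derive1 F x.
  by move=> x1 x2 [y1 y2]; rewrite /Q -(conj_chain x1 x2 y1 y2) mulrC mulKf.
have [_ _ _ [dl [dr [Hl Hr cE]]]] := BF.
have drE : dr = Q p.
  suff c2 : derive1 F x @[x --> p^'+] --> Q p by exact: (cvg_unique _ Hr c2).
  apply: cvg_trans (cvg_at_right_filter Qc).
  apply: near_eq_cvg; near=> x; apply: (FQ 0).
  - by rewrite addr0; near: x; exact: nbhs_right_gt.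
  - by rewrite addr0; near: x; apply: nbhs_right_lt; rewrite ltrDl.
  - by near: x; exact: cvg_at_right_filter nearH.
have dlE : dl = Q p.
  suff c2 : derive1 F x @[x --> p^'-] --> Q p by exact: (cvg_unique _ Hl c2).
  apply: cvg_trans (cvg_at_left_filter Qc).
  apply: near_eq_cvg; near=> x; apply: (FQ (- 1)).
  - by rewrite mulrNz mulr1z; near: x; apply: nbhs_left_gt; rewrite ltrBlDr ltrDl.
  - by rewrite mulrNz mulr1z subrK; near: x; exact: nbhs_left_lt.
  - by near: x; exact: cvg_at_left_filter nearH.
have Qp : Q p != 0.
  by rewrite /Q mulf_neq0 ?mulf_neq0 ?invr_neq0// gt_eqF// (moebius_derive1_gt0 S h1 h2).
by move/eqP: c_neq1; apply; rewrite -cE drE dlE divff.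
Unshelve. all: by end_near. Qed.

End Conjugacy.

Section Cocycle.
Context {R : realType} (p c sg rho al : R) (F G H phi psi : R -> R).
Hypothesis S : moebius_lift p sg rho G phi psi.
Hypotheses (c_gt0 : 0 < c) (c_neq1 : c != 1).
Hypothesis BF : class_B 3 p c F.
Hypothesis schw : forall x, ~ circle_eq x p -> schwarzian F x < 0.
Hypothesis Gc : continuous G.
Hypothesis HD : circle_diffeo H.
Hypothesis conj : forall x, circle_eq (H (F x)) (G (H x)).
Hypothesis HH : C1_hoelder al H.
Hypothesis al_gt0 : 0 < al.
Implicit Types (x y u v : R) (k : int).

Let Fper x : F (x + 1) = F x + 1. Proof. by have [[_ _ +] _ _ _] := BF; apply. Qed.
Let Finc : {homo F : x y / x < y}. Proof. by have [[]] := BF. Qed.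
Let Hinc : {homo H : x y / x < y}. Proof. by have [[]] := HD. Qed.
Let Hper x : H (x + 1) = H x + 1. Proof. by have [[_ _ +] _ _] := HD; apply. Qed.
Let Hmono_lt := lift_mono_lt Hinc.

Lemma derive1_lift_shift (k : int) x l : is_derive x 1 F l -> derive1 F (x + k%:~R) = l.
Proof.
move=> d; apply: is_derive1E; apply: (@is_derive_shift_lift _ F (- k) _ _ Fper).
by rewrite mulrNz addrK.
Qed.

(* [X u v] is the degenerate cross-ratio of the conjugacy on the arc with image [[u, v]]; Moebius maps preserve it,
   so along [G] it changes exactly by the cross-ratio distortion of [F]. *)
Lemma conj_cocycle : exists (X : R -> R -> R) (E : R), 0 <= E /\
  [/\ forall u v, u < v -> 0 < X u v,
      forall u v, u < v -> v < u + 1 -> X u v <= 1 + E * (v - u) `^ al,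
      forall u v, u < v -> v < u + 1 -> 1 <= (1 + E * (v - u) `^ al) * X u v,
      forall k u v, p + k%:~R < u -> u < v -> v < p + k%:~R + 1 -> X (G u) (G v) <= X u v &
      forall de : R, 0 < de -> de <= 1 / 2 -> exists2 kp : R, 0 < kp & forall k u v,
        p + k%:~R + de <= u -> u < v -> v <= p + k%:~R + 1 - de ->
        X (G u) (G v) * (1 + kp * (v - u) ^+ 2) <= X u v].
Proof.
have [_ [dH _] [Hi [HK HiK _]]] := HD.
have [_ [K0 hK0]] := HH.
have [h0 [h1 [h00 hb]]] := diffeo_derive1_bounds HD.
have [k0 E0] := conj_shift BF Gc HD conj.
have [l Hp] := conj_break S c_neq1 BF schw Gc HD conj.
pose K := Num.max K0 0; have K_ge0 : 0 <= K by rewrite le_max lexx orbT.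
have hK x y : `|derive1 H x - derive1 H y| <= K * `|x - y| `^ al.
  by apply: le_trans (hK0 x y) _; rewrite ler_wpM2r ?powR_ge0// le_max lexx.
have H1pos x : 0 < derive1 H x by exact: diffeo_derive1_gt0.
have Hi_lt u v : u < v -> Hi u < Hi v by move=> uv; rewrite -Hmono_lt !HiK.
have HiD y k : Hi (y + k%:~R) = Hi y + k%:~R.
  by apply: (can_inj HK); rewrite HiK (liftDz Hper) HiK.
have Hip : Hi p = p - l%:~R.
  by rewrite -[in RHS](HK p) Hp HiD addrK.
have mv u v : u < v -> exists z, [/\ Hi u < z, z < Hi v & v - u = derive1 H z * (Hi v - Hi u)].
  move=> uv; have [z [z1 z2 e]] := MVT_is_derive (Hi_lt _ _ uv)
    (fun x _ => derivable_is_derive1 (dH x)).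
  by exists z; rewrite -e !HiK.
pose X u v := (v - u) ^+ 2 / ((Hi v - Hi u) ^+ 2 * (derive1 H (Hi u) * derive1 H (Hi v))).
pose e0 := K / h0 * (h0^-1 `^ al).
have e00 : 0 <= e0 by rewrite mulr_ge0 ?powR_ge0// divr_ge0// ltW.
have XE u v : u < v -> exists2 z, X u v = derive1 H z ^+ 2 / (derive1 H (Hi u) * derive1 H (Hi v)) &
    forall x y, x \in [:: Hi u; Hi v; z] -> y \in [:: Hi u; Hi v; z] ->
      derive1 H x <= (1 + e0 * (v - u) `^ al) * derive1 H y.
  move=> uv; have [z [z1 z2 e]] := mv u v uv; exists z.
    rewrite /X e; field; rewrite !gt_eqF//= subr_gt0; exact: Hi_lt.
  have len : Hi v - Hi u <= (v - u) / h0.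
    rewrite ler_pdivlMr// e mulrC ler_pM2r ?subr_gt0 ?Hi_lt//.
    by have /andP[] := hb z.
  have close x y : Hi u <= x <= Hi v -> Hi u <= y <= Hi v ->
      derive1 H x <= (1 + e0 * (v - u) `^ al) * derive1 H y.
    move=> xI yI.
    have d1 : derive1 H x - derive1 H y <= K * `|x - y| `^ al := le_trans (ler_norm _) (hK x y).
    have d2 : `|x - y| `^ al <= ((v - u) * h0^-1) `^ al.
      apply: ge0_ler_powR; rewrite ?nnegrE//; first exact: ltW.
        by rewrite mulr_ge0 ?subr_ge0 ?invr_ge0 ?(ltW uv) ?(ltW h00).
      by apply: le_trans len; rewrite ler_norml; lra.
    rewrite powRM ?subr_ge0 ?invr_ge0 ?(ltW uv) ?(ltW h00)// in d2.
    have d3 : K * `|x - y| `^ al <= K * ((v - u) `^ al * h0^-1 `^ al) by rewrite ler_wpM2l.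
    have d4 : K * ((v - u) `^ al * h0^-1 `^ al) <= e0 * (v - u) `^ al * derive1 H y.
      rewrite (_ : K * _ = e0 * (v - u) `^ al * h0).
        apply: ler_wpM2l; last by have /andP[] := hb y.
        by apply: mulr_ge0 e00 _; exact: powR_ge0.
      by rewrite /e0; field; rewrite gt_eqF.
    lra.
  have inI x : x \in [:: Hi u; Hi v; z] -> Hi u <= x <= Hi v.
    rewrite !inE => /or3P[] /eqP->; rewrite ?lexx ?(ltW (Hi_lt _ _ uv))//.
    by rewrite !ltW.
  by move=> x y /inI xI /inI yI; exact: close.
pose E := 2 * e0 + e0 ^+ 2.
have Eb u v : u < v -> v < u + 1 ->
    (1 + e0 * (v - u) `^ al) ^+ 2 <= 1 + E * (v - u) `^ al.
  move=> uv vu; have q0 := powR_ge0 (v - u) al.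
  have q1 : (v - u) `^ al <= 1.
    have <- : 1 `^ al = 1 :> R by rewrite powR1.
    apply: ge0_ler_powR; rewrite ?nnegrE//; first exact: ltW.
      by rewrite subr_ge0 ltW.
    by lra.
  have : e0 ^+ 2 * ((v - u) `^ al * (v - u) `^ al) <= e0 ^+ 2 * ((v - u) `^ al).
    by rewrite ler_wpM2l ?sqr_ge0// ler_piMr.
  by rewrite /E !expr2; lra.
have X_gt0 u v : u < v -> 0 < X u v.
  move=> uv; rewrite divr_gt0 ?mulr_gt0 ?exprn_gt0 ?subr_gt0//; exact: Hi_lt.
(* Chain rule at both ends: the factors of [G] cancel by its cross-ratio identity, and [X] is
   divided by the distortion of [F], which is at least [1 + t]. *)
have step t u v k : p + k%:~R < u -> u < v -> v < p + k%:~R + 1 -> 0 <= t ->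
    (1 + t) * ((Hi v - Hi u) ^+ 2 * (derive1 F (Hi u) * derive1 F (Hi v))) <=
      (F (Hi v) - F (Hi u)) ^+ 2 ->
    X (G u) (G v) * (1 + t) <= X u v.
  move=> k1 uv k2 t0 gap.
  (* As the conjugacy matches the breaks, break-free arcs of [G] correspond to break-free arcs of
     [F]. *)
  have cellE : Hi (p + k%:~R) = p + (k - l)%:~R by rewrite HiD Hip intrB; ring.
  have a1 : p + (k - l)%:~R < Hi u by rewrite -cellE Hi_lt.
  have b2 : Hi v < p + (k - l)%:~R + 1.
    by rewrite -cellE -[1]/(1%:~R) -HiD Hi_lt.
  have ab := Hi_lt _ _ uv.
  have [_ f0] := break_lift_derive BF schw a1 (lt_trans ab b2).
  have [_ g0] := break_lift_derive BF schw (lt_trans a1 ab) b2.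
  have ch1 := conj_chain S BF schw Gc HD conj a1 (lt_trans ab b2)
    (ltac:(rewrite HiK; exact: k1)) (ltac:(rewrite HiK; exact: lt_trans k2)).
  have ch2 := conj_chain S BF schw Gc HD conj (lt_trans a1 ab) b2
    (ltac:(rewrite HiK; exact: lt_trans k1 uv)) (ltac:(rewrite HiK; exact: k2)).
  rewrite !HiK in ch1 ch2.
  have HiG w : Hi (G w) = F (Hi w) + (- k0)%:~R.
    by apply: (can_inj HK); rewrite HiK (liftDz Hper) E0 HiK mulrNz addrK.
  have Fab : F (Hi u) < F (Hi v) by exact: Finc.
  rewrite /X (moebius_cross_ratio S k1 uv k2) !HiG !(diffeo_derive1_shift HD).
  rewrite opprD addrACA subrr addr0.
  set A := derive1 H (F (Hi u)) in ch1 *; set B := derive1 H (F (Hi v)) in ch2 *.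
  set f := derive1 F (Hi u) in f0 ch1 gap *; set g := derive1 F (Hi v) in g0 ch2 gap *.
  set P := derive1 G u in ch1 *; set Q := derive1 G v in ch2 *.
  have A0 : 0 < A by exact: H1pos.
  have B0 : 0 < B by exact: H1pos.
  set m := derive1 H (Hi u) in ch1 *; set n := derive1 H (Hi v) in ch2 *.
  have m0 : 0 < m by exact: H1pos.
  have n0 : 0 < n by exact: H1pos.
  set dl := Hi v - Hi u in gap *; set De := F (Hi v) - F (Hi u) in gap *.
  have dl0 : 0 < dl by rewrite subr_gt0.
  have De0 : 0 < De by rewrite subr_gt0.
  have PE : P = A * f / m by rewrite ch1 mulfK// gt_eqF.
  have QE : Q = B * g / n by rewrite ch2 mulfK// gt_eqF.
  rewrite PE QE.
  have -> : (v - u) ^+ 2 * (A * f / m * (B * g / n)) / (De ^+ 2 * (A * B)) * (1 + t) =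
    (v - u) ^+ 2 / (dl ^+ 2 * (m * n)) * ((1 + t) * (dl ^+ 2 * (f * g)) / De ^+ 2).
    by field; rewrite !gt_eqF.
  rewrite ler_piMr//; last by rewrite ler_pdivrMr ?mul1r// exprn_gt0.
  by rewrite divr_ge0 ?sqr_ge0// !mulr_ge0 ?sqr_ge0// ltW.
exists X, E; split; first by apply: addr_ge0; [apply: mulr_ge0|exact: sqr_ge0].
have mem u v z : [/\ Hi u \in [:: Hi u; Hi v; z], Hi v \in [:: Hi u; Hi v; z] &
    z \in [:: Hi u; Hi v; z]] by split; rewrite !inE eqxx ?orbT.
have gapk (L M : R) : p < L -> L <= M -> M < p + 1 ->
    exists2 kp, 0 < kp & forall (k : int) a b, L + k%:~R <= a -> a < b -> b <= M + k%:~R ->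
    (1 + kp * (b - a) ^+ 2) * ((b - a) ^+ 2 * (derive1 F a * derive1 F b)) <= (F b - F a) ^+ 2.
  move=> pL LM Mp; have [kp kp0 hk] := schwarzian_gap_compact BF schw pL LM Mp.
  exists kp => // k a b La ab bM.
  have := hk (a - k%:~R) (b - k%:~R) (ltac:(lra)) (ltac:(lra)) (ltac:(lra)).
  have [da _] := @break_lift_derive _ p c F BF schw 0 (a - k%:~R) (ltac:(lra)) (ltac:(lra)).
  have [db _] := @break_lift_derive _ p c F BF schw 0 (b - k%:~R) (ltac:(lra)) (ltac:(lra)).
  have := derive1_lift_shift k da; have := derive1_lift_shift k db.
  have Fa := liftDz Fper (a - k%:~R) k; have Fb := liftDz Fper (b - k%:~R) k.
  rewrite !subrK in Fa Fb *; move=> -> ->; rewrite Fa Fb.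
  have -> : b - k%:~R - (a - k%:~R) = b - a by ring.
  rewrite (_ : F (b - k%:~R) + _ - _ = F (b - k%:~R) - F (a - k%:~R))//; ring.
split=> //.
- move=> u v uv vu; have [z -> hz] := XE u v uv; have [mu mv' mz] := mem u v z.
  apply: le_trans (Eb _ _ uv vu); rewrite ler_pdivrMr ?mulr_gt0// !expr2 mulrACA.
  by apply: ler_pM; rewrite ?(ltW (H1pos _))//; apply: hz.
- move=> u v uv vu; have [z Xz hz] := XE u v uv; have [mu mv' mz] := mem u v z.
  apply: (@le_trans _ _ ((1 + e0 * (v - u) `^ al) ^+ 2 * X u v)); last first.
    by rewrite ler_wpM2r ?(ltW (X_gt0 _ _ uv))// Eb.
  rewrite Xz mulrA ler_pdivlMr ?mulr_gt0// mul1r -exprMn expr2.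
  by apply: ler_pM; rewrite ?(ltW (H1pos _))//; apply: hz.
- move=> k u v k1 uv k2.
  have a1 : p < Hi u + (l - k)%:~R.
    have := Hi_lt _ _ k1; rewrite HiD Hip intrB; lra.
  have b1 : Hi v + (l - k)%:~R < p + 1.
    have := Hi_lt _ _ k2; rewrite -[1]/(1%:~R) !HiD Hip intrB; lra.
  have ab := Hi_lt _ _ uv.
  (* The compact interval is the arc itself; its gain depends on the arc, so only its sign is
     kept. *)
  have [kp kp0 hk] := gapk (Hi u + (l - k)%:~R) (Hi v + (l - k)%:~R) a1 (ltac:(lra)) b1.
  have gap := hk (k - l) (Hi u) (Hi v) (ltac:(rewrite !intrB; lra)) ab (ltac:(rewrite !intrB; lra)).
  have := @step 0 u v k k1 uv k2 (lexx _); rewrite addr0 mulr1; apply.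
  apply: le_trans gap; rewrite ler_wpM2r//.
    have [_ f0] := @break_lift_derive _ p c F BF schw (k - l) (Hi u)
      (ltac:(rewrite !intrB in a1 *; lra)) (ltac:(rewrite !intrB in b1 *; lra)).
    have [_ g0] := @break_lift_derive _ p c F BF schw (k - l) (Hi v)
      (ltac:(rewrite !intrB in a1 *; lra)) (ltac:(rewrite !intrB in b1 *; lra)).
    by rewrite mulr_ge0 ?sqr_ge0// mulr_ge0// ltW.
  by rewrite lerDl mulr_ge0 ?sqr_ge0// ltW.
- move=> de de0 de1.
  have L1 : p < Hi (p + de) + l%:~R.
    have : p - l%:~R < Hi (p + de) by rewrite -Hip; apply: Hi_lt; lra.
    lra.
  have M1 : Hi (p + 1 - de) + l%:~R < p + 1.
    have : Hi (p + 1 - de) < Hi (p + 1%:~R) by apply: Hi_lt; rewrite mulr1z; lra.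
    rewrite HiD Hip mulr1z; lra.
  have LM : Hi (p + de) <= Hi (p + 1 - de).
    by rewrite leNgt -Hmono_lt !HiK -leNgt; lra.
  have [kp kp0 hk] := gapk (Hi (p + de) + l%:~R) (Hi (p + 1 - de) + l%:~R) L1 (ltac:(lra)) M1.
  have h10 : 0 < h1 by have /andP[? ?] := hb 0; lra.
  (* The gain of [F] is in terms of the arc before [H], which has length at least [(v - u) / h1]. *)
  exists (kp / h1 ^+ 2) => [|k u v k1 uv k2]; first by rewrite divr_gt0// exprn_gt0.
  have ab := Hi_lt _ _ uv.
  have Lu : Hi (p + de) + k%:~R <= Hi u.
    by rewrite -HiD leNgt -Hmono_lt !HiK -leNgt; lra.
  have Mv : Hi v <= Hi (p + 1 - de) + k%:~R.
    by rewrite -HiD leNgt -Hmono_lt !HiK -leNgt; lra.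
  have gap := hk (k - l) (Hi u) (Hi v) (ltac:(rewrite !intrB; lra)) ab (ltac:(rewrite !intrB; lra)).
  have t0 : 0 <= kp / h1 ^+ 2 * (v - u) ^+ 2.
    by rewrite mulr_ge0 ?sqr_ge0// divr_ge0 ?sqr_ge0// ltW.
  apply: (@step _ u v k (ltac:(lra)) uv (ltac:(lra)) t0).
  apply: le_trans gap; rewrite ler_wpM2r//.
    have [_ f0] := @break_lift_derive _ p c F BF schw (k - l) (Hi u)
      (ltac:(rewrite !intrB; lra)) (ltac:(rewrite !intrB; lra)).
    have [_ g0] := @break_lift_derive _ p c F BF schw (k - l) (Hi v)
      (ltac:(rewrite !intrB; lra)) (ltac:(rewrite !intrB; lra)).
    by rewrite mulr_ge0 ?sqr_ge0// mulr_ge0// ltW.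
  rewrite lerD2l (_ : kp / _ * _ = kp * ((v - u) / h1) ^+ 2); last by field; rewrite gt_eqF.
  rewrite ler_pM2l// ler_pXn2r// ?nnegrE.
  + have [z [_ _ ->]] := mv u v uv; rewrite ler_pdivrMr// mulrC ler_pM2l ?subr_gt0//.
    by have /andP[] := hb z.
  + by rewrite divr_ge0 ?subr_ge0 ?(ltW uv) ?(ltW h10).
  + by rewrite subr_ge0 ltW.
Qed.

End Cocycle.

(** * Conclusion *)

Lemma irrational_addz {R : realType} (rho : R) (k : int) :
  irrational rho -> irrational (rho + k%:~R).
Proof.
move=> irr /rationalP[a [b e]]; apply: irr; apply/rationalP.
have [b0|b0] := posnP b.
  by exists (- k), 1%N; rewrite divr1 mulrNz; move: e; rewrite b0 invr0 mulr0; lra.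
exists (a - k * b%:Z), b; rewrite intrB intrM -pmulrn mulrBl mulfK ?pnatr_eq0 -?lt0n//.
by rewrite -e addrK.
Qed.

Lemma bernoulli {R : realDomainType} (x : R) (n : nat) : 0 <= x -> 1 + n%:R * x <= (1 + x) ^+ n.
Proof.
move=> x0; elim: n => [|n IH]; first by rewrite mul0r addr0 expr0.
rewrite exprS -natr1 mulrDl mul1r.
have := mulr_ge0 (mulr_ge0 (ler0n R n) x0) x0.
have : (1 + x) * (1 + n%:R * x) <= (1 + x) * (1 + x) ^+ n by rewrite ler_wpM2l// addr_ge0.
lra.
Qed.

Lemma powR_exprn {R : realType} (x r : R) (n : nat) : 0 <= x -> (x ^+ n) `^ r = (x `^ r) ^+ n.
Proof.
move=> x0; elim: n => [|n IH]; first by rewrite !expr0 powR1.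
by rewrite !exprS powRM ?exprn_ge0// IH.
Qed.

Definition growth_gain {R : realType} (sg : R) (m : nat) : R :=
  tile_osc1 sg ^+ 2 / (2 ^+ m) ^+ 3.

(** For a return of distance [d], take the least [k] such that cells of measure [T1 / b^k] fit into
    [d]. Then [d] is below [b * T1 / b^k], and the two bounds on the sum of squares leave [K * th^k]
    bounded by a constant. Small [d] makes [k] arbitrarily large, while [th > 1]. *)
Lemma hoelder_conj_absurd {R : realType} (c p rho al : R) (m : nat) (F G : R -> R) :
  0 < c -> c != 1 -> (24 <= 2 ^ m)%N -> 12 < 2 ^+ m * tile_osc2 (Num.sqrt c) ->
  0 < al -> al <= 1 -> (2 ^+ m) `^ (1 - al) < 1 + growth_gain (Num.sqrt c) m ->
  class_B 3 p c F -> irrational rho ->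
  (forall x : R, ~ circle_eq x p -> schwarzian F x < 0) ->
  class_B 3 p c G -> linear_fractional p G -> has_rotation_number G rho ->
  ~ C1_hoelder_conjugate al F G.
Proof.
move=> c0 c1 m24 mc al0 al1 gain BF irr schw BG LG [kr rotG] [H [HD HH conj]].
set sg := Num.sqrt c in mc gain; set kap := growth_gain sg m in gain.
have [Gc Ginc Gper] : circle_homeo G by have [] := BG.
have irr' := irrational_addz (k := kr) irr; set rho' := rho + _ in irr' rotG.
have [phi [psi [ph1 ph2 ph3 ph4 ph5]]] := rotation_semiconj Ginc Gper rotG irr' p.
have S := linear_fractional_moebius c0 c1 BG LG ph1 ph2 ph3 ph4 ph5.
have [X [E [E0 [X0 Xu Xl Xm Xs]]]] := conj_cocycle S c1 BF schw Gc HD conj HH al0.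
have psi1 : p < psi (1 / 8) by apply: (phi_lt S); rewrite ph5 ph4; lra.
have psi7 : psi (7 / 8) < p + 1 by apply: (phi_lt S); rewrite ph5 ph2 ph4; lra.
(* The [de]-neighbourhood of the break then has [phi]-values outside the open interval from [1 / 8]
   to [7 / 8]. *)
pose de := Num.min (1 / 2) (Num.min (psi (1 / 8) - p) (p + 1 - psi (7 / 8))).
have de0 : 0 < de by rewrite !lt_min; apply/and3P; split; lra.
have [de1 de2 de3] : [/\ de <= 1 / 2, de <= psi (1 / 8) - p & de <= p + 1 - psi (7 / 8)].
  by split; rewrite /de !ge_min lexx ?orbT.
have [kp kp0 Xs'] := Xs de de0 de1.
have phl : phi (p + de) <= 1 / 8 by rewrite -[leRHS]ph5; apply: ph1; lra.
have phr : 7 / 8 <= phi (p + 1 - de) by rewrite -[leLHS]ph5; apply: ph1; lra.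
(* The window from [1 / 4] to [1 / 2], enlarged by [4 * d0 = 1 / 16], stays between [1 / 8] and
   [7 / 8]. *)
pose y0 : R := 1 / 4; pose T0 : R := 1 / 4; pose d0 : R := 1 / 64.
have T00 : 0 < T0 by rewrite /T0; lra.
have d00 : 0 < d0 by rewrite /d0; lra.
have [B hB] := @cell_sq_power_bound _ p sg rho' G phi psi S X al E kp de al0 al1 E0 kp0
  X0 Xu Xl Xm Xs' y0 T0 d0 (ltac:(rewrite /d0; lra)) T00
  (ltac:(rewrite /y0 /d0; lra)) (ltac:(rewrite /y0 /T0 /d0; lra)) (ltac:(rewrite /T0 /d0; lra)).
have [n1 [K [K0 hK]]] := dyadic_growth S irr' y0 T00 m24 mc.
pose b : R := 2 ^+ m.
have b0 : 0 < b by rewrite exprn_gt0.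
have b1 : 1 < b by rewrite /b -natrX ltr1n; apply: leq_trans m24.
pose T1 := T0 / 2 ^+ n1.
have T10 : 0 < T1 by rewrite divr_gt0// exprn_gt0.
have tE k : T0 / 2 ^+ (n1 + k * m) = T1 / b ^+ k.
  by rewrite exprD mulnC exprM invfM mulrA.
pose th := (1 + kap) / b `^ (1 - al).
have pw0 : 0 < b `^ (1 - al) by rewrite powR_gt0.
have th1 : 1 < th by rewrite /th ltr_pdivlMr// mul1r.
have bound (k0 : nat) : exists2 k, (k0 <= k)%N & K * th ^+ k <= B * (b * T1) `^ al.
  have e0 : 0 < Num.min d0 (T1 / b ^+ k0.+1) by rewrite lt_min d00 divr_gt0// exprn_gt0.
  have [tau tau0 small] := closest_return_small irr' e0.
  have dr : 0 < dint rho' by have := dint_gt0 irr' (ltnSn 0); rewrite mul1r.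
  have [N [d [s [kN [C /andP[st _]]]]]] := closest_return_exists
    (tau := Num.min tau (dint rho') / 2) irr' (ltac:(
      have h1 : Num.min tau (dint rho') <= dint rho' by [rewrite ge_min lexx orbT];
      have h2 : 0 < Num.min tau (dint rho') by [rewrite lt_min tau0];
      apply/andP; split; lra)).
  have st' : `|s| <= tau.
    have h1 : Num.min tau (dint rho') <= tau by rewrite ge_min lexx.
    lra.
  have := small _ _ _ _ C st'; rewrite le_min => /andP[dd0 dk0].
  have dp : 0 < d by have [] := C.
  have exk : exists k : nat, T1 / b ^+ k <= d.
    have [i hi] := dyadic_small T1 dp; exists i; apply: le_trans (ltW (hi i (leqnn i))).
    rewrite ler_pM2l// lef_pV2 ?posrE ?exprn_gt0// lerXn2r ?nnegrE//; first exact: ltW.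
    by rewrite /b -natrX ler_nat; apply: leq_trans m24.
  pose k := ex_minn exk.
  have [kd kmin] : T1 / b ^+ k <= d /\ forall i, T1 / b ^+ i <= d -> (k <= i)%N.
    by rewrite /k; case: ex_minnP => i hi imin; split.
  have k0k : (k0 < k)%N.
    rewrite ltnNge; apply/negP => kk.
    have : T1 / b ^+ k0.+1 < T1 / b ^+ k.
      by rewrite ltr_pM2l// ltf_pV2 ?posrE ?exprn_gt0// ltr_eXn2l//.
    by have := le_lt_trans kd => _; lra.
  exists k; first exact: ltnW.
  have dub : d < b * T1 / b ^+ k.
    rewrite ltNge; apply/negP => h.
    have kS : k = k.-1.+1 by case: (k) k0k.
    have := kmin k.-1; rewrite {1 2}kS => hm.
    have : (k.-1.+1 <= k.-1)%N.
      apply: hm; apply: le_trans h; rewrite [in leRHS]kS exprS invfM.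
      by rewrite mulrACA mulfV ?gt_eqF// mul1r.
    by rewrite ltnn.
  have up := hB N d s kN (n1 + k * m)%N C dd0 (ltac:(rewrite tE; exact: kd)).
  have lo := hK k; have le := le_trans lo up.
  have B0 : 0 <= B.
    rewrite -(pmulr_lge0 _ (powR_gt0 al dp)); apply: le_trans le.
    by rewrite mulr_ge0 ?(ltW K0)// exprn_ge0// divr_ge0 ?(ltW b0)// addr_ge0// divr_ge0 ?sqr_ge0// !exprn_ge0.
  have dal : d `^ al <= (b * T1) `^ al / (b `^ al) ^+ k.
    apply: (@le_trans _ _ ((b * T1 / b ^+ k) `^ al)).
      apply: ge0_ler_powR; rewrite ?nnegrE ?(ltW dp) ?(ltW al0) ?(ltW dub)//.
      by rewrite ltW// (lt_trans dp).
    rewrite powRM ?mulr_ge0 ?invr_ge0 ?exprn_ge0 ?(ltW b0) ?(ltW T10)//.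
    by rewrite -exprVn powR_exprn ?invr_ge0 ?(ltW b0)// -powR_inv1 ?(ltW b0)// -powRrM mulN1r powRN exprVn.
  have bal : b `^ al * b `^ (1 - al) = b.
    rewrite -powRD; last by rewrite (gt_eqF b0) implybT.
    by rewrite addrC subrK powRr1// ltW.
  have le2 : K * ((1 + kap) / b) ^+ k <= B * (b * T1) `^ al / (b `^ al) ^+ k.
    by apply: le_trans le _; rewrite -mulrA ler_wpM2l.
  move: le2; rewrite ler_pdivlMr ?exprn_gt0 ?powR_gt0//.
  rewrite -mulrA -exprMn (_ : (1 + kap) / b * b `^ al = th)//.
  rewrite /th -{1}bal invfM; field.
  by rewrite !gt_eqF// powR_gt0.
have [k0 hk0] : exists k0 : nat, forall k, (k0 <= k)%N -> B * (b * T1) `^ al < K * th ^+ k.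
  set Z := B * _; pose x := th - 1.
  have x0 : 0 < x by rewrite subr_gt0.
  exists (Num.bound (`|Z| / K / x)) => k hk.
  have zz : `|Z| / K / x < k%:R.
    apply: lt_le_trans (archi_boundP _) _; first by rewrite !divr_ge0// ltW.
    by rewrite ler_nat.
  have := bernoulli k (ltW x0); rewrite (_ : 1 + x = th); last by rewrite /x; ring.
  move=> bn; apply: le_lt_trans (ler_norm _) _; rewrite mulrC -ltr_pdivrMr//.
  by apply: lt_le_trans bn; move: zz; rewrite ltr_pdivrMr//; lra.
have [k kk hk] := bound k0.
by have := le_lt_trans hk (hk0 k kk); rewrite ltxx.
Qed.

Theorem theorem2 (R : realType) (c : R) (c_gt0 : 0 < c) (c_neq1 : c != 1) :
  exists nu : R, 0 < nu < 1 /\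
    forall (p rho : R) (F G : R -> R),
      class_B 3 p c F ->
      irrational rho ->
      has_rotation_number F rho ->
      (forall x : R, ~ circle_eq x p -> schwarzian F x < 0) ->
      class_B 3 p c G ->
      linear_fractional p G ->
      has_rotation_number G rho ->
      forall alpha : R, 1 - nu < alpha -> alpha <= 1 ->
        ~ C1_hoelder_conjugate alpha F G.
Proof.
pose sg := Num.sqrt c.
have sg0 : 0 < sg by rewrite sqrtr_gt0.
have sg1 : sg != 1 by exact: sqrt_break_neq1.
have o2 := tile_osc2_gt0 sg0 sg1; have o1 := tile_osc1_gt0 sg0 sg1.
have [m [m24 mc]] : exists m : nat, (24 <= 2 ^ m)%N /\ 12 < 2 ^+ m * tile_osc2 sg.
  have [m hm] := dyadic_small 12 o2; exists (maxn m 5); split.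
    by apply: (@leq_trans (2 ^ 5)) => //; rewrite leq_exp2l// leq_maxr.
  have := hm (maxn m 5) (leq_maxl _ _); rewrite ltr_pdivrMr ?exprn_gt0//.
  by rewrite mulrC.
pose kap := growth_gain sg m; pose b : R := 2 ^+ m.
have kap0 : 0 < kap by rewrite divr_gt0 ?exprn_gt0.
have b1 : 1 < b by rewrite /b -natrX ltr1n; apply: leq_trans m24.
(* With [nu = 1 / n] this gives [b^(1 - alpha) <= b^(1 / n) < 1 + kap]; [n >= 2] keeps [nu] below 1
   and thus [alpha] positive. *)
have [n n2 bn] : exists2 n : nat, (2 <= n)%N & b < (1 + kap) ^+ n.
  exists (maxn 2 (Num.bound (b / kap))); first exact: leq_maxl.
  have := bernoulli (maxn 2 (Num.bound (b / kap))) (ltW kap0); apply: lt_le_trans.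
  rewrite -[ltLHS]add0r ltr_leD// -ler_pdivrMr//.
  apply: (@le_trans _ _ (Num.bound (b / kap))%:R); last by rewrite ler_nat leq_maxr.
  by rewrite ltW// archi_boundP// divr_ge0// ltW// (lt_trans ltr01).
have n0 : 0 < n%:R :> R by rewrite ltr0n; apply: leq_trans n2.
exists (n%:R^-1); split.
  by rewrite invr_gt0 n0 invf_lt1// ltr1n.
move=> p rho F G BF irr _ schw BG LG rotG al al_gt al_le.
apply: (@hoelder_conj_absurd _ c p rho al m) => //.
  have : n%:R^-1 < 1 :> R by rewrite invf_lt1// ltr1n.
  lra.
rewrite -/sg -/b -/kap; apply: (@le_lt_trans _ _ (b `^ n%:R^-1)).
  by apply: ler_powR; [exact: ltW|lra].
have <- : ((1 + kap) ^+ n) `^ n%:R^-1 = 1 + kap.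
  by rewrite -powR_mulrn ?addr_ge0 ?(ltW kap0)// -powRrM mulfV ?gt_eqF// powRr1// addr_ge0 ?(ltW kap0).
apply: gt0_ltr_powR; rewrite ?nnegrE ?invr_gt0//; first by rewrite exprn_ge0.
by rewrite exprn_ge0// addr_ge0// ltW.
Qed.
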